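(* Let $G$ be a Lie group with Lie algebra $\mathfrak{g}$, let $T_0<T_N$, let $\tau_0\in[T_0,T_N)$, and let $f_1,f_2:G\times\mathbb{R}^+\to\mathfrak{g}$ be of class $C^1$. For a duration $\lambda\ge 0$ consider the system on $G$ $$\dot g(t)=g(t)\,\xi(t),\qquad \xi(t)=f\big(g(t),\lambda;t\big),\qquad t\in[T_0,T_N],$$ with fixed initial state $g(T_0)$ (independent of $\lambda$), where $$f\big(g,\lambda;t\big)=\begin{cases}f_1(g;t), & t<\tau_0\ \text{ or }\ t\ge\tau_0+\lambda,\\ f_2(g;t), & \tau_0\le t<\tau_0+\lambda,\end{cases}$$ and the objective function $$J(\lambda)=\int_{T_0}^{T_N}L\big(g(\tau)\big)\,d\tau+\varphi\big(g(T_N)\big),$$ where $L,\varphi:G\to\mathbb{R}$ are of class $C^1$ and $g$ is the trajectory determined by $\lambda$. Then the mode insertion gradient is $$\left.\frac{dJ}{d\lambda}\right|_{\lambda=0^+}=\rho(\tau_0)^T\Big[f_2\big(g(\tau_0);\tau_0\big)-f_1\big(g(\tau_0);\tau_0\big)\Big],$$ where on the right-hand side $g$ is the trajectory for $\lambda=0$ (i.e. of $\dot g=g\,f_1(g;t)$ with the given initial state) and the costate $\rho$ is the solution on $[T_0,T_N]$ of $$\dot\rho(s)^T=-\rho(s)^T\Big[D_gf_1\big(g(s);s\big)-\mathrm{ad}_{f_1(g(s);s)}\Big]-D_gL\big(g(s)\big),\qquad \rho(T_N)^T=D_g\varphi\big(g(T_N)\big).$$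
   Context: $G$ is a finite-dimensional real Lie group; $g\xi$, for $g\in G$ and $\xi\in\mathfrak{g}$, denotes the left translate of $\xi$ to $T_gG$ (matrix product for matrix Lie groups). $\mathrm{ad}_\xi\eta=[\xi,\eta]$ is the Lie bracket on $\mathfrak{g}$ (the bracket of left-invariant vector fields; the matrix commutator for matrix groups). For a differentiable map $F:G\to V$ into a finite-dimensional real vector space ($V=\mathbb{R}$ or $V=\mathfrak{g}$), $D_gF=D_gF|_g:\mathfrak{g}\to V$ is the linear map defined by $D_gF|_g\cdot\eta=\frac{d}{ds}F\big(g\exp(s\eta)\big)\big|_{s=0}$ for all $\eta\in\mathfrak{g}$. For $f_1(g;t)$, $D_g$ is taken in the $g$ argument only, with $t$ fixed. A basis of $\mathfrak{g}$ is fixed, so that $\mathfrak{g}\cong\mathbb{R}^n$; $\rho(s)^T$ is a row vector (an element of $\mathfrak{g}^*$), and $D_gL$, $D_g\varphi$ are row vectors. The trajectory for given $\lambda$ is the continuous solution, satisfying the differential equation away from the switching times; the trajectory for $\lambda=0$ is assumed to exist on all of $[T_0,T_N]$. The mode insertion gradient is the one-sided derivative $\left.\frac{dJ}{d\lambda}\right|_{\lambda=0^+}=\lim_{\lambda\to0^+}\frac{J(\lambda)-J(0)}{\lambda}$. *)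

(* Defs.v *)
From HB Require Import structures.
From mathcomp Require Import all_boot all_order all_algebra.
From mathcomp Require Import all_classical all_reals all_analysis.
Set Implicit Arguments.
Unset Strict Implicit.
Unset Printing Implicit Defensive.
Import Order.TTheory GRing.Theory Num.Theory.
Import numFieldNormedType.Exports.
Local Open Scope classical_set_scope.
Local Open Scope ring_scope.

(* Class C^k on U; U is an open set in all uses below. *)
Fixpoint Ck (R : realType) (V W : normedModType R) (k : nat)
    (U : set V) (f : V -> W) : Prop :=
  match k with
  | 0 => forall x, U x -> {for x, continuous f}
  | k'.+1 => (forall x, U x -> differentiable f x) /\
             (forall v, Ck k' U ('D_v f))
  end.

Definition smooth (R : realType) (V W : normedModType R)
    (U : set V) (f : V -> W) : Prop := forall k, Ck k U f.

(* The maps of a chart are total functions; only their values on chart_dom and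
   chart_cod are meaningful. *)
Record chart (R : realType) (n : nat) (T : topologicalType) := Chart {
  chart_dom : set T;
  chart_cod : set 'cV[R]_n;
  chart_map : T -> 'cV[R]_n;
  chart_inv : 'cV[R]_n -> T;
  chart_dom_open : open chart_dom;
  chart_cod_open : open chart_cod;
  chart_map_cod : forall p, chart_dom p -> chart_cod (chart_map p);
  chart_inv_dom : forall x, chart_cod x -> chart_dom (chart_inv x);
  chart_mapK : forall p, chart_dom p -> chart_inv (chart_map p) = p;
  chart_invK : forall x, chart_cod x -> chart_map (chart_inv x) = x;
  chart_map_continuous :
    forall p, chart_dom p -> {for p, continuous chart_map};
  chart_inv_continuous :
    forall x, chart_cod x -> {for x, continuous chart_inv}
}.

(* An n-dimensional real Lie group with a fixed basis of its Lie algebra: the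
   Lie algebra, i.e. the tangent space at 1, is represented by 'cV[R]_n through
   the coordinate basis of id_chart. Every basis arises in this way, since
   composing id_chart with a linear automorphism of 'cV[R]_n (and adding the
   result to the atlas) does not change the smooth structure. *)
HB.mixin Record isLieGroup (R : realType) (n : nat) G
    of Group G & Topological G := {
  lie_hausdorff : hausdorff_space G;
  lie_second_countable : @second_countable G;
  lie_atlas : set (chart R n G);
  lie_atlas_cover : forall p : G, exists2 c, lie_atlas c & chart_dom c p;
  lie_atlas_compat : forall a b, lie_atlas a -> lie_atlas b ->
    smooth [set x | chart_cod a x /\ chart_dom b (chart_inv a x)]
           (fun x => chart_map b (chart_inv a x));
  id_chart : chart R n G;
  id_chart_atlas : lie_atlas id_chart;
  id_chart_dom : chart_dom id_chart (1%g : G);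
  lie_mul_continuous : continuous (fun z : G * G => (z.1 * z.2)%g);
  lie_inv_continuous : continuous (fun p : G => (p^-1)%g);
  lie_mul_smooth : forall a b c, lie_atlas a -> lie_atlas b -> lie_atlas c ->
    smooth [set z : 'cV[R]_n * 'cV[R]_n | [/\ chart_cod a z.1, chart_cod b z.2 &
              chart_dom c (chart_inv a z.1 * chart_inv b z.2)%g]]
           (fun z => chart_map c (chart_inv a z.1 * chart_inv b z.2)%g);
  lie_inv_smooth : forall a b, lie_atlas a -> lie_atlas b ->
    smooth [set x | chart_cod a x /\ chart_dom b ((chart_inv a x)^-1)%g]
           (fun x => chart_map b ((chart_inv a x)^-1)%g)
}.

#[short(type="lieGroupType")]
HB.structure Definition LieGroup (R : realType) (n : nat) :=
  { G of Group G & Topological G & isLieGroup R n G }.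

Arguments lie_atlas {R n} G : rename.
Arguments id_chart {R n} G : rename.

Section LieGroupCalculus.
Context {R : realType} {n : nat} {G : lieGroupType R n}.

Implicit Types (p : G) (xi eta : 'cV[R]_n).

Definition Ck_on (W : normedModType R) (k : nat) (U : set G) (F : G -> W) :=
  forall c, lie_atlas G c ->
    Ck k [set x | chart_cod c x /\ U (chart_inv c x)] (F \o chart_inv c).

Definition smooth_on (W : normedModType R) (U : set G) (F : G -> W) :=
  forall k, Ck_on k U F.

Definition C1 (W : normedModType R) (F : G -> W) := Ck_on 1 setT F.

Definition C1_time_on (W : normedModType R) (U : set (G * R)) (F : G * R -> W) :=
  forall c, lie_atlas G c ->
    Ck 1 [set z : 'cV[R]_n * R | chart_cod c z.1 /\ U (chart_inv c z.1, z.2)]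
         (fun z : 'cV[R]_n * R => F (chart_inv c z.1, z.2)).

(* Class C^1 on G x [0, +oo[, which has a boundary: f is the restriction of a
   C^1 map defined on an open neighbourhood. *)
Definition C1_time (W : normedModType R) (f : G -> R -> W) :=
  exists (U : set (G * R)) (F : G * R -> W),
    [/\ open U,
        forall p t, 0 <= t -> U (p, t),
        forall p t, 0 <= t -> F (p, t) = f p t &
        C1_time_on U F].

(* The left translate of xi to the tangent space at p, read in the chart c. *)
Definition left_translate (c : chart R n G) p xi : 'cV[R]_n :=
  'D_xi (fun x => chart_map c (p * chart_inv (id_chart G) x)%g)
        (chart_map (id_chart G) 1%g).

(* The derivative of the curve g at t is the left translate g(t) xi; continuity
   at t keeps g in the domain of the chart near t. *)
Definition has_velocity (g : R -> G) (t : R) xi :=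
  {for t, continuous g} /\
  forall c, lie_atlas G c -> chart_dom c (g t) ->
    is_derive t 1 (chart_map c \o g) (left_translate c (g t) xi).

Definition one_param_subgroup xi (gamma : R -> G) :=
  (forall s t, gamma (s + t) = (gamma s * gamma t)%g) /\
  has_velocity gamma 0 xi.

Definition lie_exp xi : G :=
  xget 1%g [set p | exists2 gamma, one_param_subgroup xi gamma & p = gamma 1].

Definition lieD (W : normedModType R) (F : G -> W) p eta : W :=
  'D_1 (fun s : R => F (p * lie_exp (s *: eta))%g) 0.

(* The bracket of left-invariant vector fields: F |-> (p |-> lieD F p xi) is the
   action on functions of the left-invariant vector field generated by xi. *)
Definition lie_bracket xi eta : 'cV[R]_n :=
  xget 0 [set zeta | forall (U : set G) (F : G -> R), open U -> smooth_on U F ->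
    forall p, U p ->
      lieD F p zeta = lieD (fun q => lieD F q eta) p xi
                    - lieD (fun q => lieD F q xi) p eta].

Definition ad_mx xi : 'M[R]_n :=
  \matrix_(i, j) (lie_bracket xi (delta_mx j 0)) i 0.

Definition lieD_row (F : G -> R) p : 'rV[R]_n :=
  \row_j lieD F p (delta_mx j 0).

Definition lieD_mx (F : G -> 'cV[R]_n) p : 'M[R]_n :=
  \matrix_(i, j) (lieD F p (delta_mx j 0)) i 0.

Definition switched (f1 f2 : G -> R -> 'cV[R]_n) (tau0 lam : R) p t :=
  if tau0 <= t < tau0 + lam then f2 p t else f1 p t.

Definition is_trajectory (T0 TN tau0 : R) (f1 f2 : G -> R -> 'cV[R]_n)
    (g0 : G) (lam : R) (g : R -> G) :=
  [/\ {within `[T0, TN], continuous g},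
      g T0 = g0 &
      forall t, T0 < t < TN -> t != tau0 -> t != tau0 + lam ->
        has_velocity g t (switched f1 f2 tau0 lam (g t) t)].

Definition objective (T0 TN : R) (L phi : G -> R) (g : R -> G) : R :=
  Rintegral lebesgue_measure `[T0, TN] (L \o g) + phi (g TN).

Definition is_costate (T0 TN : R) (f1 : G -> R -> 'cV[R]_n) (L phi : G -> R)
    (g : R -> G) (rho : R -> 'rV[R]_n) :=
  [/\ {within `[T0, TN], continuous rho},
      rho TN = lieD_row phi (g TN) &
      forall s : R, T0 < s < TN ->
        is_derive s 1 rho
          (- (rho s *m (lieD_mx (f1^~ s) (g s) - ad_mx (f1 (g s) s)))
           - lieD_row L (g s))].

End LieGroupCalculus.

(* Main.v *)
Require Import Defs.
From HB Require Import structures.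
From mathcomp Require Import all_boot all_order all_algebra.
From mathcomp Require Import all_classical all_reals all_analysis.
From mathcomp Require Import ring lra.
Set Implicit Arguments.
Unset Strict Implicit.
Unset Printing Implicit Defensive.
Import Order.TTheory GRing.Theory Num.Theory.
Import numFieldNormedType.Exports.
Local Open Scope classical_set_scope.
Local Open Scope ring_scope.

(* Let gb be the trajectory for the duration 0, and write the trajectory for a
   small duration lam as gb(t) psi(x(t)), where psi inverts the chart at the
   identity. Then x solves the equation x' = E(t, x) with E(t, x0) = 0 at the
   coordinate x0 of the identity, and the derivative of E(t, .) at x0 is
   D f1 - ad_{f1}: the first term is the variation of f1, and ad comes from the
   difference between the left and the right translation by psi(x). Since x = x0
   up to tau0 and x moves with velocity f2 - f1 at tau0, the deviation is O(lam)
   and x(tau0 + lam) - x0 = lam (f2 - f1) + o(lam). Along the rest of the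
   trajectory the costate equation makes rho (x - x0) plus the accumulated change
   of the running cost constant up to o(lam); its value at TN is the change of
   the objective and its value at tau0 + lam is lam rho(tau0) (f2 - f1).

   E is merely strictly differentiable at x0, uniformly in t, which is enough. *)

(** * One-variable calculus *)

(** Writing the deviation as a right factor [psi(x)] keeps the whole comparison in the single chart
    at the identity, although [gb] itself may cross many charts; only velocities have to be
    translated back to the identity.

    The regularity at hand decides the notions used. The multiplication is smooth, but [f1] and [f2]
    are only C^1, and [gb] is only known to be continuous at [tau0], so no more than continuity of
    [E] in [t] is used. Strict differentiability is a condition at the one point [x0] and is stable
    under composition, yet it gives both a Lipschitz constant, for Picard iteration, and the first
    order expansion; compactness of [[T0, TN]] makes both uniform in time.

    Two further obligations come from the statement. The exponential and the bracket are obtained by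
    choice, so one-parameter subgroups must be constructed and the bracket characterized before
    [lieD] and [ad_mx] can be computed. And [g lam] is an arbitrary trajectory, so the one that is
    constructed has to be shown to be the only one. *)

Lemma real_induction (R : realType) (a b : R) (P : R -> Prop) : P a ->
  (forall t, a <= t < b -> (forall s, a <= s <= t -> P s) ->
     \forall s \near t^'+, P s) ->
  (forall t, a < t <= b -> (forall s, a <= s < t -> P s) -> P t) ->
  forall t, a <= t <= b -> P t.
Proof.
move=> Pa Pright Pleft t tab; apply: contrapT => nPt.
(* The infimum of the failures satisfies [P] by the hypothesis on left limits, and then [P] holds a
   little beyond it, which contradicts its being the infimum. *)
pose E := [set s | a <= s <= b /\ ~ P s].
have Et : E t by [].
have hE : has_inf E by split; [exists t | exists a => s [/andP[]]].
have am : a <= inf E by apply: lb_le_inf; [exists t | move=> s [/andP[]]].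
have mt : inf E <= t by exact: ge_inf hE.2 _ Et.
have Plt s : a <= s < inf E -> P s.
  move=> /andP[as_ sm]; apply: contrapT => nPs.
  have : inf E <= s.
    apply: ge_inf hE.2 _ _; split => //.
    by rewrite as_ (le_trans (ltW sm)) // (le_trans mt) //; case/andP: tab.
  by rewrite leNgt sm.
have Pm : P (inf E).
  move: am; rewrite le_eqVlt => /orP[/eqP <- //|am].
  by apply: Pleft => //; rewrite am (le_trans mt) //; case/andP: tab.
have mb : inf E < b.
  rewrite lt_neqAle (le_trans mt) ?andbT; last by case/andP: tab.
  apply/eqP => mb; apply: nPt; suff -> : t = inf E by [].
  by apply/eqP; rewrite eq_le mt andbT mb; case/andP: tab.
have /Pright : a <= inf E < b by rewrite am mb.
have Ple s : a <= s <= inf E -> P s.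
  by rewrite [s <= _]le_eqVlt => /andP[as_ /orP[/eqP -> //|sm]]; apply: Plt; rewrite as_.
move=> /(_ Ple)[d /= d0 dP].
have [s [/andP[as_ sb] nPs] sd] := inf_adherent d0 hE.
apply: nPs; have [sm|ms] := leP s (inf E); first by apply: Ple; rewrite as_.
by apply: dP => //=; rewrite ltr_distlC; apply/andP; split; lra.
Qed.

Lemma continuous_pair (T U V : topologicalType) (f : T -> U) (g : T -> V) (t : T) :
  {for t, continuous f} -> {for t, continuous g} ->
  {for t, continuous (fun s => (f s, g s))}.
Proof. by move=> ft gt; apply: cvg_pair. Qed.

Lemma near_at_right (R : realType) (t : R) (P : R -> Prop) :
  (\forall s \near t, P s) -> \forall s \near t^'+, P s.
Proof. by move=> [r r0 H]; exists r => //= s st _; exact: H. Qed.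

Lemma near_at_left (R : realType) (t : R) (P : R -> Prop) :
  (\forall s \near t, P s) -> \forall s \near t^'-, P s.
Proof. by move=> [r r0 H]; exists r => //= s st _; exact: H. Qed.

Lemma is_derive_near (R : realType) (V : normedModType R) (u : R -> V) (t : R)
  (d : V) : is_derive t 1 u d -> forall e, 0 < e ->
  \forall s \near t, `|u s - u t - (s - t) *: d| <= e * `|s - t|.
Proof.
move=> [dif ud] e e0; have /eqaddoP/(_ _ e0) := derivable_nbhs dif.
rewrite ud => -[r /= r0 H]; exists r => //= s st.
have /= := H (s - t); rewrite sub0r normrN distrC => /(_ st).
rewrite !fctE /= (_ : (s - t)%:A = s - t :> R); last by rewrite /GRing.scale /= mulr1.
by rewrite subrK opprD addrA distrC.
Qed.

(** Rolle's theorem has no vector-valued form, so the bound is propagated from [a] to [b] by real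
    induction, with an arbitrary slack [e]. *)
Lemma mean_value_ineq (R : realType) (V : normedModType R) (u u' : R -> V)
    (v v' : R -> R) (a b : R) : a <= b ->
  {within `[a, b], continuous u} -> {within `[a, b], continuous v} ->
  (forall t, a < t < b -> is_derive t 1 u (u' t)) ->
  (forall t, a < t < b -> is_derive t 1 v (v' t)) ->
  (forall t, a < t < b -> `|u' t| <= v' t) ->
  `|u b - u a| <= v b - v a.
Proof.
move=> ab uc vc du dv u'v'.
have [<-|anb] := eqVneq a b; first by rewrite !subrr normr0.
have {anb} ab' : a < b by rewrite lt_neqAle anb.
have [_ ua ub] := (continuous_within_itvP _ ab').1 uc.
have [_ va vb] := (continuous_within_itvP _ ab').1 vc.
apply/ler_addgt0Pr => e e0.
pose e1 := e / 2 / (b - a); have e10 : 0 < e1 by rewrite !divr_gt0 // subr_gt0.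
(* The constant [e / 2] is needed at [a], where only continuity is known. The slope [e1] pays for
   the first order errors of [u] and [v] at each step and adds up to the other [e / 2] at [b]. *)
pose g t := v t - v a + e1 * (t - a) + e / 2.
suff : forall t, a <= t <= b -> `|u t - u a| <= g t.
  move=> /(_ b); rewrite lexx ab => /(_ isT) /le_trans; apply.
  rewrite /g /e1 divfK ?subr_eq0 ?gt_eqF //; lra.
have cvu t : a < t <= b -> u s @[s --> t^'-] --> u t.
  move=> /andP[at_]; rewrite le_eqVlt => /orP[/eqP -> //|tb].
  apply: cvg_at_left_filter; apply: differentiable_continuous.
  by apply/derivable1_diffP; case: (du t _) => //; rewrite at_.
have cvv t : a < t <= b -> v s @[s --> t^'-] --> v t.
  move=> /andP[at_]; rewrite le_eqVlt => /orP[/eqP -> //|tb].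
  apply: cvg_at_left_filter; apply: differentiable_continuous.
  by apply/derivable1_diffP; case: (dv t _) => //; rewrite at_.
apply: real_induction.
- by rewrite /g !subrr normr0; lra.
- move=> t /andP[at_ tb] /(_ t); rewrite at_ lexx => /(_ isT).
  move: at_; rewrite le_eqVlt => /orP[/eqP <-|at_].
    move=> _; near=> s.
    have us : `|u a - u s| < e / 4.
      by near: s; apply: cvgr_dist_lt => //; rewrite divr_gt0.
    have vs : `|v a - v s| < e / 4.
      by near: s; apply: cvgr_dist_lt => //; rewrite divr_gt0.
    have as_ : a < s by near: s; exact: nbhs_right_gt.
    have : 0 <= e1 * (s - a) by rewrite mulr_ge0 // ?subr_ge0 ltW.
    by rewrite distrC in us; move: vs; rewrite /g ltr_distlC => /andP[]; lra.
  move=> Ht; have /is_derive_near/(_ (e1 / 2)) : is_derive t 1 u (u' t) by apply: du; rewrite at_.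
  rewrite divr_gt0 // => /(_ isT) Hu.
  have /is_derive_near/(_ (e1 / 2)) : is_derive t 1 v (v' t) by apply: dv; rewrite at_.
  rewrite divr_gt0 // => /(_ isT) Hv.
  near=> s.
  have ts : t < s by near: s; exact: nbhs_right_gt.
  have us : `|u s - u t - (s - t) *: u' t| <= e1 / 2 * `|s - t|.
    by near: s; exact: near_at_right Hu.
  have vs : `|v s - v t - (s - t) *: v' t| <= e1 / 2 * `|s - t|.
    by near: s; exact: near_at_right Hv.
  have st0 : 0 < s - t by rewrite subr_gt0.
  have -> : u s - u a = (u s - u t - (s - t) *: u' t) + (s - t) *: u' t + (u t - u a).
    by rewrite subrK addrA subrK.
  apply: le_trans (ler_normD _ _) _; apply: le_trans (lerD (ler_normD _ _) Ht) _.
  rewrite normrZ (gtr0_norm st0); rewrite (gtr0_norm st0) in us vs.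
  have := u'v' t; rewrite at_ tb => /(_ isT) h.
  have : (s - t) * `|u' t| <= (s - t) * v' t by rewrite ler_pM2l.
  by move: vs us; rewrite ler_norml /g => /andP[]; rewrite /GRing.scale /=; lra.
- move=> t tab H.
  have gt : g s @[s --> t^'-] --> g t.
    apply: cvgD; last exact: cvg_cst.
    apply: cvgD; first by apply: cvgB; [exact: cvv|exact: cvg_cst].
    apply: cvgM; first exact: cvg_cst.
    by apply: cvgB; [exact: cvg_at_left_filter|exact: cvg_cst].
  have ut : `|u s - u a| @[s --> t^'-] --> `|u t - u a|.
    by apply: cvg_norm; apply: cvgB; [exact: cvu|exact: cvg_cst].
  apply: ler_cvg_to ut gt _; near=> s; apply: H; apply/andP; split.
    near: s; apply: nbhs_left_ge; by case/andP: tab.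
  by near: s; exact: nbhs_left_lt.
Unshelve. all: by end_near. Qed.

Lemma is_derive_expR_affine (R : realType) (c a t : R) :
  is_derive t 1 (fun s => expR (c * (s - a))) (c * expR (c * (t - a))).
Proof.
have d : is_derive t 1 (fun s : R => c * (s - a)) c.
  have -> : (fun s : R => c * (s - a)) = c *: (id - cst a) by apply/funext.
  by apply: is_derive_eq; rewrite subr0 /GRing.scale /= mulr1.
by rewrite mulrC; exact: (is_derive1_comp (is_derive_expR _) d).
Qed.

Lemma is_derive_continuous (R : realType) (V : normedModType R) (u : R -> V)
  (t : R) (d : V) : is_derive t 1 u d -> {for t, continuous u}.
Proof.
by move=> [/derivable1_diffP ? _]; exact: differentiable_continuous.
Qed.

(* A maximum point of [|u t| exp(-2K(t-a))] bounds [u] by itself through the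
   mean value inequality. *)
Lemma gronwall (R : realType) (V : normedModType R) (u u' : R -> V)
    (a b K : R) : a <= b -> 0 <= K ->
  {within `[a, b], continuous u} ->
  (forall t, a < t < b -> is_derive t 1 u (u' t)) ->
  (forall t, a < t < b -> `|u' t| <= K * `|u t|) ->
  forall t, a <= t <= b -> `|u t| <= 2 * `|u a| * expR (2 * K * (t - a)).
Proof.
move=> ab K0 uc du u'u.
pose E s := expR (2 * K * (s - a)).
have E0 s : 0 < E s by exact: expR_gt0.
have Ec : continuous E by move=> s; exact: is_derive_continuous (is_derive_expR_affine _ _ _).
pose m s := `|u s| / E s.
have mc : {within `[a, b], continuous m}.
  move=> s; apply: cvgM.
    by apply: cvg_norm; exact: uc.
  apply: cvgV; first by rewrite gt_eqF.
  exact: (continuous_subspaceT Ec).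
have [s sab mmax] := EVT_max ab mc.
move: sab; rewrite in_itv /= => /andP[as_ sb].
have um t : a <= t <= b -> `|u t| <= m s * E t.
  by move=> tab; rewrite -ler_pdivrMr //; apply: mmax; rewrite in_itv.
have ms0 : 0 <= m s by rewrite divr_ge0 // ltW.
(* [E] grows at the rate [2 * K], so [K * (m s * E)] is the derivative of only half of [m s * E].
   Half of [|u s| = m s * E s] is thus left over to be bounded by [|u a|]. *)
have : `|u s - u a| <= m s / 2 * E s - m s / 2 * E a.
  apply: (@mean_value_ineq _ _ _ u' (fun t => m s / 2 * E t) (fun t => m s / 2 * (2 * K * E t))) => //.
  - apply: continuous_subspaceW uc => t /=; rewrite !in_itv /= => /andP[-> ts].
    exact: le_trans ts sb.
  - apply: continuous_subspaceT => t; apply: (@continuousM _ _ (cst _) E).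
      exact: cst_continuous.
    exact: Ec.
  - by move=> t /andP[at_ ts]; apply: du; rewrite at_ (lt_le_trans ts).
  - move=> t _; have := is_deriveZ (m s / 2) (is_derive_expR_affine (2 * K) a t).
    by [].
  - move=> t /andP[at_ ts]; apply: le_trans (u'u _ _) _.
      by rewrite at_ (lt_le_trans ts).
    apply: le_trans (ler_wpM2l K0 (um t _)) _.
      by rewrite (ltW at_) (le_trans (ltW ts)).
    by rewrite le_eqVlt; apply/orP; left; apply/eqP; field.
have us : `|u s| = m s * E s by rewrite divfK // gt_eqF.
have := ler_normD (u s - u a) (u a); rewrite subrK us => h1 h2.
have Es1 : 1 <= E s by rewrite -expR0 ler_expR mulr_ge0 ?mulr_ge0 ?subr_ge0.
have msE : m s <= m s * E s by rewrite ler_peMr.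
have mE0 : 0 <= m s * E a by rewrite mulr_ge0 // ltW.
move=> t tab; apply: le_trans (um t tab) _; apply: ler_wpM2r; first exact/ltW.
lra.
Qed.

Lemma antiderivative1 (R : realType) (f : R -> R) (c : R) : continuous f ->
  exists P : R -> R, forall t, c < t -> is_derive t 1 P (f t).
Proof.
move=> fc.
exists (fun x => (\int[lebesgue_measure]_(t in `[c, x]) f t)%R) => t ct.
have t1 : t < t + 1 by rewrite ltrDl.
have fi : lebesgue_measure.-integrable `[c, t + 1] (EFin \o f).
  apply: continuous_compact_integrable; first exact: segment_compact.
  exact: continuous_subspaceT.
have [|d1 d2] := @continuous_FTC1 R f (BLeft c) t (t + 1) t1 fi _ (fc t).
  by rewrite /= lte_fin.
apply: DeriveDef; first exact: d1.
by apply: etrans d2; rewrite derive1E.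
Qed.

Lemma derive0_cst (R : realType) (V : normedModType R) (u : R -> V) (a b : R) :
  (forall t, a <= t <= b -> is_derive t 1 u 0) -> a <= b -> u a = u b.
Proof.
move=> du ab; apply/eqP; rewrite eq_sym -subr_eq0 -normr_le0.
have := @mean_value_ineq _ _ u (fun=> 0) (cst 0) (fun=> 0) a b ab.
rewrite /cst subrr; apply.
- apply: derivable_within_continuous => t; rewrite in_itv => tab.
  by case: (du t tab).
- exact/continuous_subspaceT/cst_continuous.
- by move=> t /andP[at_ tb]; apply: du; rewrite !ltW.
- by move=> t _; rewrite normr0.
Qed.

(** Each [Q c] is an antiderivative only to the right of [c]. After normalization at 0 two of them
    agree where both are valid, so the base point may be chosen as a function of [t]. *)
Lemma antiderivative_line (R : realType) (f : R -> R) : continuous f ->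
  exists P : R -> R, forall t : R, is_derive t 1 P (f t).
Proof.
move=> fc; have /choice[Q dQ] c := antiderivative1 c fc.
have QE c c' t : c <= c' -> c' < t -> c' < 0 -> Q c t - Q c 0 = Q c' t - Q c' 0.
  move=> cc' ct c0; have d s : c' < s -> is_derive s 1 (Q c \- Q c') 0.
    move=> cs; have := is_deriveB (dQ c s (le_lt_trans cc' cs)) (dQ c' s cs).
    by rewrite subrr.
  suff : (Q c \- Q c') 0 = (Q c \- Q c') t by rewrite /=; lra.
  have [t0|t0] := leP 0 t.
    by apply: derive0_cst t0 => s /andP[s0 _]; apply: d; exact: lt_le_trans s0.
  apply/esym; apply: derive0_cst (ltW t0) => s /andP[s0 _]; apply: d.
  exact: lt_le_trans s0.
pose c (t : R) : R := - (`|t| + 1).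
have ct t : c t < t by rewrite /c; have := ler_norm (- t); rewrite normrN; lra.
have c0 t : c t < 0 by rewrite /c; have := normr_ge0 t; lra.
exists (fun t => Q (c t) t - Q (c t) 0) => t.
(* The base [c t - 1] lies to the left of [c s] for all [s] within distance 1 of [t], so one fixed
   antiderivative serves the whole neighbourhood. *)
have dt : is_derive t 1 (fun s => Q (c t - 1) s - Q (c t - 1) 0) (f t).
  have := is_deriveB (dQ (c t - 1) t _) (is_derive_cst (Q (c t - 1) 0) t 1).
  by rewrite subr0; apply; have := ct t; lra.
apply: near_eq_is_derive dt; near=> s.
have st : `|t - s| < 1 by near: s; apply: cvgr_dist_lt.
have := ler_normB t (t - s); rewrite subKr => ns.
apply: QE => //; rewrite /c; have := ler_norm s; lra.
Unshelve. all: by end_near. Qed.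

Lemma is_derive_mx (R : realType) (V : normedModType R) (m n : nat)
    (M : V -> 'M[R]_(m, n)) (t v : V) (D : 'M[R]_(m, n)) :
  (forall i j, is_derive t v (fun x => M x i j) (D i j)) <-> is_derive t v M D.
Proof.
split=> [H|[dM <-] i j].
  have dM : derivable M t v by apply/derivable_mxP => i j; case: (H i j).
  split => //; rewrite derive_mx //; apply/matrixP => i j; rewrite mxE.
  by case: (H i j).
split; first by move: i j; apply/derivable_mxP.
by rewrite derive_mx // mxE.
Qed.

Lemma antiderivative (R : realType) (m n : nat) (f : R -> 'M[R]_(m, n)) :
  continuous f -> exists P : R -> _, forall t : R, is_derive t 1 P (f t).
Proof.
move=> fc.
have /choice[P dP] (ij : 'I_m * 'I_n) := @antiderivative_line R (fun t => f t ij.1 ij.2)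
  (fun t => continuous_comp (fc t) (@coord_continuous _ _ _ ij.1 ij.2 _)).
exists (fun t => \matrix_(i, j) P (i, j) t) => t; apply/is_derive_mx => i j.
by under eq_fun do rewrite mxE; exact: (dP (i, j)).
Qed.

Lemma geometric_limit (R : realType) (m n : nat)
    (x : nat -> 'M[R]_(m, n)) (C : R) : 0 <= C ->
  (forall k, `|x k.+1 - x k| <= C / 2 ^+ k) ->
  exists l, forall k, `|l - x k| <= 2 * C / 2 ^+ k.
Proof.
move=> C0 xC.
have P0 k : 0 < 2 ^+ k :> R by rewrite exprn_gt0.
have xD k p : `|x (k + p)%N - x k| <= 2 * C / 2 ^+ k.
  (* The exact geometric partial sum is what makes the induction on [p] close. *)
  have : `|x (k + p)%N - x k| <= 2 * C / 2 ^+ k * (1 - 2 ^- p).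
    elim: p => [|p IH]; first by rewrite addn0 subrr normr0 expr0 invr1 subrr mulr0.
    rewrite addnS -(subrK (x (k + p)%N) (x _.+1)) -addrA.
    apply: le_trans (ler_normD _ _) _; apply: le_trans (lerD (xC _) IH) _.
    rewrite exprD exprS !invfM le_eqVlt; apply/orP; left; apply/eqP; field.
    by rewrite !gt_eqF.
  have h : 0 <= 2 * C / 2 ^+ k by rewrite divr_ge0 ?mulr_ge0 // ltW.
  have h' : 0 < 2 ^- p :> R by rewrite invr_gt0.
  by move=> /le_trans; apply; apply: ler_piMr => //; rewrite gerBl ltW.
have small e : 0 < e -> exists k, 2 * C / 2 ^+ k < e.
  move=> e0; have := @cvg_geometric R (2 * C) (2^-1).
  rewrite gtr0_norm ?invr_gt0 // => /(_ _)/cvgr0_norm_lt/(_ e e0) [|k _ /(_ k)].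
    by rewrite invf_lt1 // ltr1n.
  rewrite /= exprVn leqnn => /(_ isT) H; exists k; apply: le_lt_trans H.
  exact: ler_norm.
have cx : cvgn x.
  apply: cauchy_cvg; apply: cauchy_exP => e e0.
  have [k ke] := small e e0; exists (x k); exists k => // p /= kp.
  rewrite -ball_normE /= distrC -(subnKC kp); exact: le_lt_trans (xD _ _) ke.
exists (limn x) => k.
have cxk : `|x m - x k| @[m --> \oo] --> `|limn x - x k|.
  by apply: cvg_norm; apply: cvgB; [exact: cx|exact: cvg_cst].
apply: (closed_cvg (fun y => y <= 2 * C / 2 ^+ k)) cxk; first exact: closed_le.
by exists k => // p /= kp; rewrite -(subnKC kp); exact: xD.
Qed.

(** * Ordinary differential equations *)

(* The weight [exp(2K|t-a|)] makes the Picard map a contraction on all of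
   [alpha, beta], however long. *)
Lemma weighted_primitive_bound (R : realType) (V : normedModType R)
    (u u' : R -> V) (a alpha beta K C : R) :
  0 < K -> alpha <= a <= beta -> u a = 0 ->
  (forall t : R, is_derive t 1 u (u' t)) ->
  (forall t, alpha <= t <= beta ->
     `|u' t| <= 2 * K * C * expR (2 * K * `|t - a|)) ->
  0 <= C ->
  forall t, alpha <= t <= beta -> `|u t| <= C * expR (2 * K * `|t - a|).
Proof.
move=> K0 /andP[al be] ua du u'C C0 t /andP[alt tbe].
have uc : continuous u by move=> s; exact: is_derive_continuous (du s).
have dE (c D s : R) : is_derive s 1 (fun s => D * expR (c * (s - a))) (D * (c * expR (c * (s - a)))).
  by have := is_deriveZ D (is_derive_expR_affine c a s).
have [at_|ta] := leP a t.
  have := @mean_value_ineq _ _ u u' _ _ a t at_ (continuous_subspaceT uc) _ _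
    (fun s _ => dE (2 * K) C s) _.
  rewrite ua !subr0 subrr mulr0 expR0 mulr1 ger0_norm ?subr_ge0 // => h.
  have : `|u t| <= C * expR (2 * K * (t - a)) - C.
    apply: h => //.
      by apply: continuous_subspaceT => s; exact: is_derive_continuous (dE _ _ _).
    move=> s /andP[as_ st]; apply: le_trans (u'C _ _) _.
      by rewrite (le_trans al (ltW as_)) (le_trans (ltW st) tbe).
    rewrite ger0_norm; last by rewrite subr_ge0 ltW.
    rewrite le_eqVlt; apply/orP; left; apply/eqP.
    by ring.
  by move/le_trans; apply; lra.
have := @mean_value_ineq _ _ u u' _ _ t a (ltW ta) (continuous_subspaceT uc) _ _
  (fun s _ => dE (- (2 * K)) (- C) s) _.
rewrite ua sub0r normrN subrr mulr0 expR0 mulr1 ltr0_norm ?subr_lt0 // => h.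
have : `|u t| <= - C - (- C * expR (- (2 * K) * (t - a))).
  apply: h => //.
    by apply: continuous_subspaceT => s; exact: is_derive_continuous (dE _ _ _).
  move=> s /andP[ts sa]; apply: le_trans (u'C _ _) _.
    by rewrite (le_trans alt (ltW ts)) (le_trans (ltW sa) be).
  rewrite ltr0_norm ?subr_lt0 // (_ : 2 * K * - (s - a) = - (2 * K) * (s - a)); last by ring.
  by rewrite le_eqVlt; apply/orP; left; apply/eqP; ring.
move/le_trans; apply; rewrite (_ : 2 * K * - (t - a) = - (2 * K) * (t - a)); last by ring.
by lra.
Qed.

Section Picard.
Context {R : realType} {n : nat}.
Variables (F : R -> 'cV[R]_n -> 'cV[R]_n) (K a alpha beta : R) (xa : 'cV[R]_n).
Hypotheses (K0 : 0 < K) (al : alpha <= a) (be : a <= beta).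
Hypothesis Fc : continuous (fun z : R * 'cV[R]_n => F z.1 z.2).
Hypothesis FK : forall t x y, `|F t x - F t y| <= K * `|x - y|.

Let Fcomp (x : R -> 'cV[R]_n) : continuous x -> continuous (fun t => F t (x t)).
Proof.
move=> xc t; apply: (@continuous_comp _ _ _ (fun t => (t, x t)) (fun z => F z.1 z.2)).
  by apply: continuous_pair => //; exact: xc.
exact: Fc.
Qed.

Let primitive (x : R -> 'cV[R]_n) : continuous x ->
  exists2 y : R -> 'cV[R]_n, y a = xa &
    forall t : R, is_derive t 1 y (F t (x t)).
Proof.
move=> /Fcomp/antiderivative[P dP].
exists (fun t => xa + (P t - P a)); first by rewrite subrr addr0.
move=> t; have := is_deriveD (is_derive_cst xa t 1) (is_deriveB (dP t) (is_derive_cst (P a) t 1)).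
by rewrite subr0 add0r.
Qed.

(** The Lipschitz bound is global in space, so the solution lives on the whole interval. Fields that
    are Lipschitz only near a point are composed with a retraction beforehand. *)
Lemma picard_lindelof : exists2 x : R -> 'cV[R]_n, x a = xa &
  continuous x /\ forall t : R, alpha < t < beta -> is_derive t 1 x (F t (x t)).
Proof.
pose T := {x : R -> 'cV[R]_n | continuous x}.
have step (x : T) : {y : T | sval y a = xa /\ forall t : R, is_derive t 1 (sval y) (F t (sval x t))}.
  apply: cid; have [y ya dy] := primitive (svalP x).
  have yc : continuous y by move=> t; exact: is_derive_continuous (dy t).
  by exists (exist _ y yc).
pose X k : T := iter k (fun x => sval (step x)) (exist _ (cst xa) (@cst_continuous _ _ _)).
pose x k := sval (X k).
have xc k : continuous (x k) by exact: (svalP (X k)).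
have x_a k : x k a = xa by case: k => // k; exact: (svalP (step (X k))).1.
have dx k (t : R) : is_derive t 1 (x k.+1) (F t (x k t)) by exact: (svalP (step (X k))).2.
have ab : alpha <= beta by exact: le_trans be.
have [M M0 FM] : exists2 M, 0 <= M & forall t, alpha <= t <= beta -> `|F t xa| <= M.
  have Fxa : continuous (fun t => `|F t xa|).
    by move=> t; apply: cvg_norm; apply: (@Fcomp (cst xa)); exact: cst_continuous.
  have [c _ cmax] := EVT_max ab (continuous_subspaceT Fxa).
  by exists `|F c xa| => // t tab; apply: cmax; rewrite in_itv.
pose E t := expR (2 * K * `|t - a|).
have E1 t : 1 <= E t by rewrite -expR0 ler_expR !mulr_ge0 // ltW.
pose C := M / (2 * K).
have C0 : 0 <= C by rewrite divr_ge0 ?mulr_ge0 // ltW.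
have P0 k : 0 < 2 ^+ k :> R by rewrite exprn_gt0.
(* In the norm weighted by [E] the Picard map contracts by 1/2: a derivative bounded by [K * c * E]
   has a primitive bounded by [c / 2 * E]. *)
have xS k t : alpha <= t <= beta -> `|x k.+1 t - x k t| <= C / 2 ^+ k * E t.
  elim: k t => [|k IH] t.
    apply: (@weighted_primitive_bound _ _ (x 1 \- x 0) (fun t => F t xa - 0) a) => //.
    - by rewrite al.
    - by rewrite /= !x_a subrr.
    - move=> s /FM sM; rewrite subr0 expr0 divr1 /C; apply: le_trans sM _.
      have -> : 2 * K * (M / (2 * K)) = M by field; rewrite gt_eqF.
      by rewrite ler_peMr //; exact: E1.
    - by rewrite divr_ge0 // ltW.
  apply: (@weighted_primitive_bound _ _ (x k.+2 \- x k.+1) (fun t => F t (x k.+1 t) - F t (x k t)) a) => //.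
  - by rewrite al.
  - by rewrite /= !x_a subrr.
  - move=> s /IH sM; apply: le_trans (FK _ _ _) _.
    apply: le_trans (ler_wpM2l (ltW K0) sM) _.
    rewrite exprS le_eqVlt; apply/orP; left; apply/eqP; rewrite /E; field.
    by rewrite gt_eqF.
  - by rewrite divr_ge0 // ltW.
have [B B0 EB] : exists2 B, 0 <= B & forall t, alpha <= t <= beta -> C * E t <= B.
  exists (C * expR (2 * K * (beta - alpha))); first by rewrite mulr_ge0 // expR_ge0.
  move=> t /andP[alt tb]; apply: ler_wpM2l => //; rewrite ler_expR.
  apply: ler_wpM2l; first by rewrite mulr_ge0 // ltW.
  by have := al; have := be; rewrite ler_norml; lra.
(* The iterates are controlled only on [[alpha, beta]]. Freezing time outside makes the limit [y]
   continuous on the whole line, as [primitive] requires. *)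
pose cl t := Num.max alpha (Num.min t beta).
have clc : continuous cl.
  move=> t; apply: (@continuous_max _ _ (cst alpha) (fun t => Num.min t beta)).
    exact: cst_continuous.
  by apply: (@continuous_min _ _ id (cst beta)) => //; exact: cst_continuous.
have clab t : alpha <= cl t <= beta.
  by rewrite /cl le_max lexx /= ge_max ab ge_min lexx orbT.
have clE t : alpha <= t <= beta -> cl t = t.
  by move=> /andP[alt tb]; rewrite /cl min_l // max_r.
have /choice[y yx] t : exists l, forall k, `|l - x k (cl t)| <= 2 * B / 2 ^+ k.
  have xSB k : `|x k.+1 (cl t) - x k (cl t)| <= B / 2 ^+ k.
    apply: le_trans (xS k _ (clab t)) _.
    by rewrite mulrAC ler_wpM2r ?invr_ge0 ?(ltW (P0 _)) // EB.
  have [l lx] := @geometric_limit R n 1 (fun k => x k (cl t)) B B0 xSB.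
  by exists l.
have small e : 0 < e -> exists k, 2 * B / 2 ^+ k < e.
  move=> e0; have := @cvg_geometric R (2 * B) (2^-1).
  rewrite gtr0_norm ?invr_gt0 // => /(_ _)/cvgr0_norm_lt/(_ e e0) [|k _ /(_ k)].
    by rewrite invf_lt1 // ltr1n.
  rewrite /= exprVn leqnn => /(_ isT) H; exists k; apply: le_lt_trans H.
  exact: ler_norm.
have yc : continuous y.
  move=> t; apply/cvgrPdist_lt => e e0.
  have [k ke] := small (e / 3) (divr_gt0 e0 (ltr0Sn _ _)).
  have xk : continuous (fun s => x k (cl s)).
    by move=> s; apply: (@continuous_comp _ _ _ cl (x k)); [exact: clc|exact: xc].
  have /cvgrPdist_lt/(_ (e / 3) (divr_gt0 e0 (ltr0Sn _ _))) := xk t.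
  apply: filterS => s xts.
  have -> : y t - y s = (y t - x k (cl t)) + (x k (cl t) - x k (cl s)) - (y s - x k (cl s)).
    by rewrite opprB !addrA !subrK.
  apply: le_lt_trans (ler_normB _ _) _.
  have := ler_normD (y t - x k (cl t)) (x k (cl t) - x k (cl s)).
  by have := yx t k; have := yx s k; lra.
(* Nothing is known of the derivative of the limit [y]. Its Picard image [z] is differentiable by
   construction, and it equals [y] on [[alpha, beta]] because both are limits of the iterates
   there. *)
have [z za dz] := primitive yc.
have zc : continuous z by move=> t; exact: is_derive_continuous (dz t).
have zy t : alpha <= t <= beta -> z t = y t.
  move=> tab; have zx k : `|z t - x k.+1 t| <= B / 2 ^+ k * E t.
    apply: (@weighted_primitive_bound _ _ (z \- x k.+1) (fun t => F t (y t) - F t (x k t)) a alpha beta) => //.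
    - by rewrite al.
    - by rewrite /= za x_a subrr.
    - move=> s sab; apply: le_trans (FK _ _ _) _.
      have := yx s k; rewrite clE // => ys.
      apply: le_trans (ler_wpM2l (ltW K0) ys) _.
      have -> : K * (2 * B / 2 ^+ k) = 2 * K * (B / 2 ^+ k) by ring.
      apply: ler_peMr; last exact: E1.
      by rewrite mulr_ge0 ?divr_ge0 ?(ltW (P0 _)) // mulr_ge0 // ltW.
    - by rewrite divr_ge0 // ltW.
  apply/eqP; rewrite -subr_eq0 -normr_le0; apply/ler_addgt0Pr => e e0; rewrite add0r.
  have Et : 0 < E t + 1 by have := E1 t; lra.
  have [k ke] := small (e / (E t + 1)) (divr_gt0 e0 Et).
  have -> : z t - y t = (z t - x k.+1 t) - (y t - x k.+1 t).
    by rewrite opprB addrA subrK.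
  apply: le_trans (ler_normB _ _) _.
  have := yx t k.+1; rewrite clE // => ys.
  move: ke; rewrite ltr_pdivlMr // => ke.
  apply/ltW; apply: le_lt_trans ke; apply: le_trans (lerD (zx k) ys) _.
  have -> : 2 * B / 2 ^+ k.+1 = B / 2 ^+ k by rewrite exprS; field; rewrite gt_eqF.
  have : 0 <= B / 2 ^+ k * E t by rewrite mulr_ge0 ?divr_ge0 ?(ltW (P0 _)) // (le_trans _ (E1 t)).
  have : 0 <= B / 2 ^+ k by rewrite divr_ge0 // ltW.
  rewrite (_ : 2 * B / 2 ^+ k * (E t + 1) = 2 * (B / 2 ^+ k * E t) + 2 * (B / 2 ^+ k)); last by ring.
  by lra.
exists z => //; split => // t /andP[alt tb].
by rewrite zy; [exact: dz|rewrite !ltW].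
Qed.
End Picard.

(** * Strict differentiability *)

Section StrictDiff.
Context {R : realType}.
Implicit Types U V W : normedModType R.

Lemma near_normP V (x : V) (P : V -> Prop) :
  (\forall y \near x, P y) <->
  exists2 d : R, 0 < d & forall y, `|y - x| < d -> P y.
Proof.
split=> [/nbhs_normP[d d0 H]|[d d0 H]].
  by exists d => // y yx; apply: H; rewrite /ball_/= distrC.
by apply/nbhs_normP; exists d => // y; rewrite /ball_/= distrC; exact: H.
Qed.

Lemma differentiable_near V W (f : V -> W) (x : V) : differentiable f x ->
  forall e, 0 < e ->
  \forall y \near x, `|f y - f x - 'd f x (y - x)| <= e * `|y - x|.
Proof.
move=> df e e0; have /eqaddoP/(_ _ e0) := diff_locally df.
move=> /near_normP[d d0 H]; apply/near_normP; exists d => // y yx.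
by have := H (y - x); rewrite subr0 => /(_ yx); rewrite !fctE /= subrK opprD addrA.
Qed.

Lemma near_differentiable V W (f : V -> W) (A : {linear V -> W}) (x : V) :
  continuous A ->
  (forall e, 0 < e ->
   \forall y \near x, `|f y - f x - A (y - x)| <= e * `|y - x|) ->
  differentiable f x /\ forall h, 'd f x h = A h.
Proof.
move=> Ac H; have o : f \o shift x = cst (f x) + A +o_ (0 : V) id.
  apply/eqaddoP => e e0; have /near_normP[d d0 {}H] := H e e0.
  apply/near_normP; exists d => // y; rewrite subr0 => yd.
  by have := H (y + x); rewrite addrK !fctE /= opprD addrA; exact.
have dE := diff_unique Ac o.
split=> [|h]; last exact: (congr1 (fun B : V -> W => B h) dE).
by apply/diff_locallyP; rewrite dE.
Qed.

Lemma diff_bound V W (f : V -> W) (x : V) : differentiable f x ->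
  exists2 K : R, 0 < K & forall v, `|'d f x v| <= K * `|v|.
Proof. by move=> df; apply: linear_lipschitz; exact: diff_continuous. Qed.

(* Strict (Peano) differentiability: unlike differentiability at [x], it makes [f]
   Lipschitz near [x]. *)
Definition sdiff V W (f : V -> W) (x : V) :=
  differentiable f x /\
  forall e : R, 0 < e -> exists2 d : R, 0 < d &
    forall y z, `|y - x| < d -> `|z - x| < d ->
      `|f y - f z - 'd f x (y - z)| <= e * `|y - z|.

Lemma sdiff_linear V W (f : {linear V -> W}) (x : V) : continuous f -> sdiff f x.
Proof.
move=> fc; split=> [|e e0]; first exact: linear_differentiable.
exists 1 => // y z _ _; rewrite (diff_lin _ fc) -linearB subrr normr0.
by rewrite mulr_ge0 // ltW.
Qed.

Lemma sdiff_cst V W (w : W) (x : V) : sdiff (cst w) x.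
Proof.
split=> [|e e0]; first exact: differentiable_cst.
by exists 1 => // y z _ _; rewrite diff_cst /cst subrr subr0 normr0 mulr_ge0 // ltW.
Qed.

Lemma sdiff_id V (x : V) : sdiff (fun y => y) x.
Proof. by apply: (@sdiff_linear _ _ idfun) => ?; exact: cvg_id. Qed.

Lemma sdiff_lipschitz V W (f : V -> W) (x : V) : sdiff f x ->
  exists2 K : R, 0 < K & exists2 d : R, 0 < d &
    forall y z, `|y - x| < d -> `|z - x| < d -> `|f y - f z| <= K * `|y - z|.
Proof.
move=> [df /(_ 1 ltr01)[d d0 H]]; have [K K0 AK] := diff_bound df.
exists (K + 1); first by rewrite addr_gt0.
exists d => // y z yd zd; rewrite -(subrK ('d f x (y - z)) (f y - f z)).
apply: le_trans (ler_normD _ _) _; rewrite mulrDl addrC.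
by apply: lerD; [exact: AK|exact: H].
Qed.

Lemma lipschitz_continuous V W (f : V -> W) (K : R) : 0 < K ->
  (forall x y, `|f x - f y| <= K * `|x - y|) -> continuous f.
Proof.
move=> K0 H x; apply/cvgrPdist_le => e e0; apply/near_normP.
exists (e / K); first by rewrite divr_gt0.
move=> y ye; apply: le_trans (H _ _) _.
by rewrite mulrC -ler_pdivlMr // distrC ltW.
Qed.

(** The Lipschitz bound concerns pairs of points near [x], so it yields continuity at the neighbours
    of [x], where no differentiability is assumed. *)
Lemma sdiff_near_continuous V W (f : V -> W) (x : V) : sdiff f x ->
  \forall y \near x, {for y, continuous f}.
Proof.
move=> /sdiff_lipschitz[K K0 [d d0 H]]; apply/near_normP; exists d => // y yd.
apply/cvgrPdist_le => e e0; apply/near_normP.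
exists (Num.min (d - `|y - x|) (e / K)).
  by rewrite lt_min subr_gt0 yd divr_gt0.
move=> z; rewrite lt_min => /andP[zd ze].
apply: le_trans (H y z yd _) _.
  by rewrite -(subrK y z) -addrA (le_lt_trans (ler_normD _ _)) // -ltrBrDr.
by rewrite mulrC -ler_pdivlMr // distrC ltW.
Qed.

Lemma diff_near_eq V W (f g : V -> W) (x : V) :
  (\forall y \near x, f y = g y) -> differentiable f x ->
  differentiable g x /\ forall h, 'd g x h = 'd f x h.
Proof.
move=> fg df; have gx := nbhs_singleton fg.
apply: near_differentiable; first exact: diff_continuous.
move=> e e0; near=> y; rewrite -gx -(near fg y) //.
by near: y; exact: differentiable_near.
Unshelve. all: by end_near. Qed.

Lemma sdiff_near_eq V W (f g : V -> W) (x : V) :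
  (\forall y \near x, f y = g y) -> sdiff f x -> sdiff g x.
Proof.
move=> fg [df fs]; have [dg dE] := diff_near_eq fg df.
split=> [|e /fs[d d0 H]]; first exact: dg.
have /near_normP[d' d'0 H'] := fg.
exists (Num.min d d') => [|y z]; first by rewrite lt_min d0.
rewrite !lt_min => /andP[yd yd'] /andP[zd zd'].
rewrite dE -(H' y yd') -(H' z zd'); exact: H.
Qed.

Lemma diffDE V W (f g : V -> W) (x h : V) :
  differentiable f x -> differentiable g x ->
  'd (fun y => f y + g y) x h = 'd f x h + 'd g x h.
Proof. by move=> df dg; exact: (congr1 (fun A : V -> W => A h) (diffD df dg)). Qed.

Lemma diffBE V W (f g : V -> W) (x h : V) :
  differentiable f x -> differentiable g x ->
  'd (fun y => f y - g y) x h = 'd f x h - 'd g x h.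
Proof. by move=> df dg; exact: (congr1 (fun A : V -> W => A h) (diffB df dg)). Qed.

Lemma sdiff_comp U V W (f : V -> W) (g : U -> V) (x : U) :
  sdiff g x -> sdiff f (g x) -> sdiff (fun y => f (g y)) x.
Proof.
move=> sg sf; have [dg gs] := sg; have [df fs] := sf.
split=> [|e e0]; first exact: (@differentiable_comp _ _ _ _ g f).
have [K K0 [d1 d10 gK]] := sdiff_lipschitz sg.
have [M M0 fM] := diff_bound df.
have [d2 d20 f2] := fs (e / 2 / K) (divr_gt0 (divr_gt0 e0 (ltr0Sn _ 1)) K0).
have [d3 d30 g3] := gs (e / 2 / M) (divr_gt0 (divr_gt0 e0 (ltr0Sn _ 1)) M0).
exists (Num.min (Num.min d1 (d2 / K)) d3) => [|y z].
  by rewrite !lt_min d10 d30 divr_gt0.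
rewrite !lt_min => /andP[/andP[y1 y2] y3] /andP[/andP[z1 z2] z3].
rewrite (@diff_comp _ _ _ _ g f) //=.
have -> : f (g y) - f (g z) - 'd f (g x) ('d g x (y - z)) =
  (f (g y) - f (g z) - 'd f (g x) (g y - g z)) +
   'd f (g x) (g y - g z - 'd g x (y - z)).
  by rewrite (linearB ('d f (g x)) (g y - g z)) addrA subrK.
apply: le_trans (ler_normD _ _) _.
have x1 : `|x - x| < d1 by rewrite subrr normr0.
have gd w : `|w - x| < d1 -> `|w - x| < d2 / K -> `|g w - g x| < d2.
  move=> w1 w2; apply: le_lt_trans (gK _ _ w1 x1) _.
  by rewrite mulrC -ltr_pdivlMr.
apply: le_trans (lerD (f2 _ _ (gd y y1 y2) (gd z z1 z2)) (fM _)) _.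
have h1 : e / 2 / K * `|g y - g z| <= e / 2 * `|y - z|.
  rewrite -mulrA ler_wpM2l ?divr_ge0 ?(ltW e0) // ler_pdivrMl // ; exact: gK.
have h2 : M * `|g y - g z - 'd g x (y - z)| <= e / 2 * `|y - z|.
  apply: le_trans (ler_wpM2l (ltW M0) (g3 _ _ y3 z3)) _.
  by rewrite mulrA (mulrC M) divfK // gt_eqF.
by apply: le_trans (lerD h1 h2) _; rewrite -mulrDl -splitr.
Qed.

Lemma sdiff_pair U V W (f : U -> V) (g : U -> W) (x : U) :
  sdiff f x -> sdiff g x -> sdiff (fun y => (f y, g y)) x.
Proof.
move=> [df fs] [dg gs]; split=> [|e e0]; first exact: differentiable_pair.
have [d1 d10 f1] := fs e e0; have [d2 d20 g2] := gs e e0.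
exists (Num.min d1 d2) => [|y z]; first by rewrite lt_min d10.
rewrite !lt_min => /andP[y1 y2] /andP[z1 z2].
by rewrite diff_pair // prod_normE /= ge_max f1 // g2.
Qed.

Lemma sdiffD V W (f g : V -> W) (x : V) :
  sdiff f x -> sdiff g x -> sdiff (fun y => f y + g y) x.
Proof.
move=> [df fs] [dg gs]; split=> [|e e0]; first exact: differentiableD.
have [d1 d10 f1] := fs (e / 2) (divr_gt0 e0 (ltr0Sn _ 1)).
have [d2 d20 g2] := gs (e / 2) (divr_gt0 e0 (ltr0Sn _ 1)).
exists (Num.min d1 d2) => [|y z]; first by rewrite lt_min d10.
rewrite !lt_min => /andP[y1 y2] /andP[z1 z2].
rewrite (diffDE _ df dg).
rewrite !opprD (addrACA (f y)) (addrACA (f y - f z)).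
apply: le_trans (ler_normD _ _) _; rewrite (splitr e) mulrDl.
by apply: lerD; [exact: f1|exact: g2].
Qed.

Lemma sdiffN V W (f : V -> W) (x : V) : sdiff f x -> sdiff (fun y => - f y) x.
Proof.
move=> [df fs]; split=> [|e e0]; first exact: differentiableN.
have [d d0 f1] := fs e e0; exists d; first exact: d0.
move=> y z yd zd; rewrite (congr1 (fun A : V -> W => A (y - z)) (diffN df) : 'd (fun y => - f y) x (y - z) = - 'd f x (y - z)).
rewrite -!opprD normrN; exact: f1.
Qed.

Lemma sdiffB V W (f g : V -> W) (x : V) :
  sdiff f x -> sdiff g x -> sdiff (fun y => f y - g y) x.
Proof. by move=> sf sg; exact: (sdiffD sf (sdiffN sg)). Qed.

Lemma sdiff_sum V W (I : Type) (r : seq I) (f : I -> V -> W) (x : V) :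
  (forall i, sdiff (f i) x) -> sdiff (fun y => \sum_(i <- r) f i y) x.
Proof.
move=> sf; elim: r => [|i r IH].
  by under eq_fun do rewrite big_nil; exact: sdiff_cst.
under eq_fun do rewrite big_cons; exact: (sdiffD (sf i) IH).
Qed.

Lemma sdiff_fst V W (z : V * W) : sdiff (fun w : V * W => w.1) z.
Proof. by apply: (@sdiff_linear _ _ fst) => w; exact: cvg_fst. Qed.

Lemma sdiff_snd V W (z : V * W) : sdiff (fun w : V * W => w.2) z.
Proof. by apply: (@sdiff_linear _ _ snd) => w; exact: cvg_snd. Qed.

Lemma scale_sdiff W (z : R * W) : sdiff (fun w : R * W => w.1 *: w.2) z /\
  forall h, 'd (fun w : R * W => w.1 *: w.2) z h = h.1 *: z.2 + z.1 *: h.2.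
Proof.
(* In this form of the remainder of the bilinear map, each product has one factor that is small near
   [z] and one that is bounded by the distance of the two points. *)
have key (a b : R) (w u : W) : a *: w - b *: u - ((a - b) *: z.2 + z.1 *: (w - u)) =
    (a - b) *: (w - z.2) + (b - z.1) *: (w - u).
  rewrite (scalerBr (a - b) w) (scalerBl b z.1 (w - u)) (addrACA ((a - b) *: w)) opprD.
  by congr +%R; rewrite scalerBl scalerBr addrA subrK.
have [d1 E1] : differentiable (fun w : R * W => w.1 *: z.2) z /\
    'd (fun w : R * W => w.1 *: z.2) z = (fun h => h.1 *: z.2) :> (R * W -> W).
  have c : continuous (@fst R W) by move=> w; exact: cvg_fst.
  have df : differentiable (fst : R * W -> R) z by exact: linear_differentiable.
  by split; [exact: differentiableZl|rewrite diffZl // (diff_lin _ c)].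
have [d2 E2] : differentiable (fun w : R * W => z.1 *: w.2) z /\
    'd (fun w : R * W => z.1 *: w.2) z = (fun h => z.1 *: h.2) :> (R * W -> W).
  have c : continuous (@snd R W) by move=> w; exact: cvg_snd.
  have df : differentiable (snd : R * W -> W) z by exact: linear_differentiable.
  by split; [exact: differentiableZ|rewrite (diffZ z.1 df) (diff_lin _ c)].
pose L := (fun w : R * W => w.1 *: z.2) + (fun w : R * W => z.1 *: w.2).
have dL : differentiable L z by exact: differentiableD.
have LE h : 'd L z h = h.1 *: z.2 + z.1 *: h.2 by rewrite diffD //= E1 E2.
have est e : 0 < e -> exists2 d : R, 0 < d & forall y y' : R * W,
    `|y - z| < d -> `|y' - z| < d ->
    `|y.1 *: y.2 - y'.1 *: y'.2 - 'd L z (y - y')| <= e * `|y - y'|.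
  move=> e0; exists (e / 2); first by rewrite divr_gt0.
  move=> [a w] [b u]; rewrite LE !prod_normE /= key !gt_max => /andP[_ wz] /andP[bz _].
  apply: le_trans (ler_normD _ _) _; rewrite !normrZ (splitr e) mulrDl.
  apply: lerD.
    rewrite mulrC; apply: ler_pM => //; first exact: ltW.
    by rewrite le_max lexx.
  by apply: ler_pM => //; [exact: ltW|rewrite le_max lexx orbT].
have [dm dmE] : differentiable (fun w : R * W => w.1 *: w.2) z /\
    forall h, 'd (fun w : R * W => w.1 *: w.2) z h = 'd L z h.
  apply: near_differentiable; first exact: diff_continuous.
  move=> e /est[d d0 H]; apply/near_normP; exists d => // y yd.
  by apply: H; rewrite // subrr normr0.
split=> [|h]; last by rewrite dmE LE.
split=> [|e /est[d d0 H]]; first exact: dm.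
exists d => [|y y' yd y'd]; first exact: d0.
rewrite dmE; exact: H.
Qed.

Lemma sdiff_scale V W (k : V -> R) (f : V -> W) (x : V) :
  sdiff k x -> sdiff f x -> sdiff (fun y => k y *: f y) x.
Proof.
move=> sk sf.
exact: (sdiff_comp (sdiff_pair sk sf) (scale_sdiff (k x, f x)).1).
Qed.

Lemma diff_scale V W (k : V -> R) (f : V -> W) (x h : V) :
  differentiable k x -> differentiable f x ->
  'd (fun y => k y *: f y) x h = 'd k x h *: f x + k x *: 'd f x h.
Proof.
move=> dk df; have [[ds _] dE] := scale_sdiff (k x, f x).
have := @diff_comp _ _ _ _ (fun y => (k y, f y)) (fun w => w.1 *: w.2) x
  (differentiable_pair dk df) ds.
by move=> ->; rewrite /= dE /= diff_pair.
Qed.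

Lemma sdiff_coord V m n (f : V -> 'M[R]_(m, n)) (x : V) i j :
  sdiff f x -> sdiff (fun y => f y i j) x.
Proof.
move=> sf; apply: (@sdiff_comp _ _ _ (fun M : 'M[R]_(m, n) => M i j) f) => //.
have lin : linear (fun M : 'M[R]_(m, n) => M i j) by move=> a M N; rewrite !mxE.
pose c := GRing.isLinear.Build _ _ _ _ _ lin.
pose C : {linear 'M[R]_(m, n) -> R} := HB.pack (fun M : 'M[R]_(m, n) => M i j) c.
by apply: (@sdiff_linear _ _ C); exact: coord_continuous.
Qed.

Lemma diff_fun_comp U V W (f : V -> W) (g : U -> V) (x : U) :
  differentiable g x -> differentiable f (g x) ->
  differentiable (fun y => f (g y)) x /\
  forall h, 'd (fun y => f (g y)) x h = 'd f (g x) ('d g x h).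
Proof.
move=> dg df; split=> [|h]; first exact: (@differentiable_comp _ _ _ _ g f).
by rewrite (@diff_comp _ _ _ _ g f).
Qed.

Lemma is_derive_diff V W (f : V -> W) (y : R -> V) (t : R) (v : V) :
  is_derive t 1 y v -> differentiable f (y t) ->
  is_derive t 1 (fun s => f (y s)) ('d f (y t) v).
Proof.
move=> [dy yE] df; have dy' : differentiable y t by apply/derivable1_diffP.
have dfy : differentiable (f \o y) t by exact: differentiable_comp.
split; first exact/derivable1_diffP.
by rewrite deriveE // diff_comp //= -(deriveE _ dy') yE.
Qed.

Lemma is_derive_pair V W (f : R -> V) (g : R -> W) (t : R) (v : V) (w : W) :
  is_derive t 1 f v -> is_derive t 1 g w ->
  is_derive t 1 (fun s => (f s, g s)) (v, w).
Proof.
move=> [/derivable1_diffP df fE] [/derivable1_diffP dg gE].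
have dfg := differentiable_pair df dg.
split; first exact/derivable1_diffP.
by rewrite deriveE // diff_pair // -(deriveE _ df) -(deriveE _ dg) fE gE.
Qed.

Lemma is_derive_line V (z h : V) (t : R) :
  is_derive t 1 (fun s : R => z + s *: h) h.
Proof.
have di : differentiable (id : R -> R) t by case: (is_diff_id t).
have := @differentiableZl _ _ _ id h t di; have := @diffZl _ _ _ id h t di.
rewrite (@diff_val _ _ _ _ _ _ _ (is_diff_id t)) => E d; have := is_deriveD (is_derive_cst z t 1)
  (@DeriveDef _ _ _ t 1 (fun s : R => s *: h) h ((derivable1_diffP _ _).2 d) _).
rewrite add0r; apply; rewrite deriveE // E /=; exact: scale1r.
Qed.

End StrictDiff.

(** * Maps of class C^2 *)

Section C2.
Context {R : realType}.
Implicit Types U V W : normedModType R.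

(** Finite dimension, in the form needed to bound a linear map by its values on a spanning family.
    The constant 1 in the coordinate bound is that of a sup norm, and it survives products. *)
Definition fin_coord V := exists (I : finType) (e : I -> V), forall v,
  exists2 c : I -> R, v = \sum_i c i *: e i & forall i, `|c i| <= `|v|.

Lemma fin_coord_R : fin_coord R.
Proof.
exists 'I_1, (fun=> 1) => v; exists (fun=> v) => //.
by rewrite big_ord1 /GRing.scale /= mulr1.
Qed.

Lemma cV_norm_le n (v : 'cV[R]_n) (C : R) : 0 <= C ->
  (forall i, `|v i 0| <= C) -> `|v| <= C.
Proof.
move=> C0 H; rewrite [`|v|]mx_normrE; apply: bigmax_le => // -[i j] _ /=.
by rewrite ord1.
Qed.

Lemma norm_cV_coord n (v : 'cV[R]_n) i : `|v i 0| <= `|v|.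
Proof.
rewrite [`|v|]mx_normrE.
exact: (@le_bigmax _ _ _ _ (fun ij : 'I_n * 'I_1 => `|v ij.1 ij.2|) (i, 0)).
Qed.

Lemma cV_sum_delta n (v : 'cV[R]_n) : v = \sum_i v i 0 *: delta_mx i 0.
Proof.
by rewrite {1}[v]matrix_sum_delta; apply: eq_bigr => i _; rewrite big_ord1.
Qed.

Lemma fin_coord_cV n : fin_coord 'cV[R]_n.
Proof.
exists 'I_n, (fun i => delta_mx i 0) => v; exists (fun i => v i 0).
  exact: cV_sum_delta.
exact: norm_cV_coord.
Qed.

Lemma fin_coord_prod V W : fin_coord V -> fin_coord W -> fin_coord (V * W)%type.
Proof.
move=> [I [e He]] [J [f Hf]].
exists (I + J)%type, (fun k => match k with inl i => (e i, 0) | inr j => (0, f j) end).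
move=> [v w]; have [c vE cv] := He v; have [d wE dw] := Hf w.
exists (fun k => match k with inl i => c i | inr j => d j end) => [|[i|j]].
- rewrite big_sumType /=.
  have -> : \sum_i c i *: ((e i, 0) : V * W) = (v, 0).
    rewrite vE; elim/big_rec2: _ => // i v' z _ ->.
    by apply: injective_projections; rewrite /= ?scaler0 ?addr0.
  have -> : \sum_j d j *: ((0, f j) : V * W) = (0, w).
    rewrite wE; elim/big_rec2: _ => // i v' z _ ->.
    by apply: injective_projections; rewrite /= ?scaler0 ?addr0.
  by apply: injective_projections; rewrite /= ?addr0 ?add0r.
- by rewrite prod_normE le_max /= cv.
- by rewrite prod_normE le_max /= dw orbT.
Qed.

(** On the segment from [z] to [y] the derivative of [f] minus its linear part at [x] is small,
    because all directional derivatives are close to those at [x]; the mean value inequality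
    integrates this. *)
Lemma C1_sdiff V W (f : V -> W) (x : V) : fin_coord V ->
  (\forall y \near x, differentiable f y) ->
  (forall v, {for x, continuous ('D_v f)}) -> sdiff f x.
Proof.
move=> [I [e He]] df cf; have dfx := nbhs_singleton df; split => // eps eps0.
(* Each of the [#|I|] coordinates may contribute [eps / N]; the added 1 keeps [N] positive when the
   space is trivial. *)
pose N : R := #|I|%:R + 1; have N0 : 0 < N by rewrite ltr_wpDl.
have : \forall w \near x, forall i, `|'D_(e i) f w - 'D_(e i) f x| <= eps / N.
  apply: filter_forall => i; have /cvgrPdist_le/(_ (eps / N) (divr_gt0 eps0 N0)) := cf (e i).
  by apply: filterS => w; rewrite distrC.
move=> /(filterI df)/near_normP[d d0 H]; exists d => // y z yd zd.
pose p (s : R) := z + s *: (y - z).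
have pd s : 0 <= s <= 1 -> `|p s - x| < d.
  move=> /andP[s0 s1]; have -> : p s - x = s *: (y - x) + (1 - s) *: (z - x).
    rewrite /p addrAC (_ : y - z = (y - x) - (z - x)); last by rewrite opprB addrA subrK.
    by rewrite scalerBr scalerBl scale1r addrCA.
  apply: le_lt_trans (ler_normD _ _) _; rewrite !normrZ !ger0_norm ?subr_ge0 //.
  have [->|sn0] := eqVneq s 0; first by rewrite mul0r add0r subr0 mul1r.
  have s0' : 0 < s by rewrite lt_neqAle eq_sym sn0.
  have h1 : s * `|y - x| < s * d by rewrite ltr_pM2l.
  have h2 : (1 - s) * `|z - x| <= (1 - s) * d by rewrite ler_wpM2l ?subr_ge0 // ltW.
  by lra.
pose h := y - z.
have dp (s : R) : is_derive s 1 p h.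
  exact: is_derive_line.
have AE w v : differentiable f w -> (forall i, `|'D_(e i) f w - 'D_(e i) f x| <= eps / N) ->
    `|'d f w v - 'd f x v| <= eps * `|v|.
  move=> dw wN; have [c vE cv] := He v.
  have dv u : 'd f u v = \sum_i c i *: 'd f u (e i).
    by rewrite {1}vE linear_sum; apply: eq_bigr => i _; rewrite linearZ.
  rewrite !dv -sumrB.
  apply: le_trans (ler_norm_sum _ _ _) _.
  have : \sum_i `|c i *: 'd f w (e i) - c i *: 'd f x (e i)| <= \sum_(i : I) `|v| * (eps / N).
    apply: ler_sum => i _; rewrite -scalerBr normrZ.
    by apply: ler_pM => //; rewrite -!deriveE.
  have NI : eps / N * #|I|%:R <= eps.
    by rewrite mulrAC ler_pdivrMr // ler_wpM2l ?(ltW eps0) // lerDl.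
  move=> /le_trans; apply; rewrite sumr_const -mulr_natr -mulrA [leRHS]mulrC.
  by rewrite ler_wpM2l // (@eq_card _ _ I).
have pN s : 0 <= s <= 1 -> differentiable f (p s) /\ forall i, `|'D_(e i) f (p s) - 'D_(e i) f x| <= eps / N.
  by move=> /pd/H.
have dfp (s : R) : 0 <= s <= 1 ->
    is_derive s 1 (fun s => f (p s) - s *: 'd f x h) ('d f (p s) h - 'd f x h).
  move=> /pN[dfs _]; have L := is_derive_line 0 ('d f x h) s.
  have := is_deriveB (is_derive_diff (dp s) dfs) L.
  by under [X in is_derive _ _ (_ - X)]eq_fun do rewrite add0r.
have := @mean_value_ineq _ _ (fun s => f (p s) - s *: 'd f x h)
    (fun s => 'd f (p s) h - 'd f x h) (fun s => eps * `|h| * s) (fun s => eps * `|h|) 0 1 ler01.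
have -> : p 1 = y by rewrite /p scale1r addrC subrK.
have -> : p 0 = z by rewrite /p scale0r addr0.
rewrite scale0r scale1r subr0 mulr0 mulr1 subr0 addrAC; apply.
- apply: derivable_within_continuous => s; rewrite in_itv => s01.
  by case: (dfp s s01).
- by apply: continuous_subspaceT => s; exact: mulrl_continuous.
- by move=> s /andP[s0 s1]; apply: dfp; rewrite !ltW.
- move=> s _; have := is_deriveZ (eps * `|h|) (is_derive_id s 1).
  by rewrite /GRing.scale /= mulr1.
- move=> s /andP[s0 s1]; have [|dps psN] := pN s; first by rewrite !ltW.
  exact: AE.
Qed.

(* Young's form of second order differentiability, with strict derivatives. *)
Definition C2_at V W (f : V -> W) (x : V) :=
  (\forall y \near x, differentiable f y) /\ forall v, sdiff ('D_v f) x.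

Lemma C2_at_sdiff V W (f : V -> W) (x : V) : fin_coord V ->
  C2_at f x -> sdiff f x.
Proof.
move=> fV [df sf]; apply: C1_sdiff => // v.
by case: (sf v) => dv _; exact: differentiable_continuous.
Qed.

Lemma C2_at_near_eq V W (f g : V -> W) (x : V) :
  (\forall y \near x, f y = g y) -> C2_at f x -> C2_at g x.
Proof.
move=> /near_join fg [df sf].
have key : \forall y \near x, differentiable g y /\ forall h, 'd g y h = 'd f y h.
  by near=> y; apply: diff_near_eq; near: y.
split=> [|v]; first by apply: filterS key => y [].
apply: sdiff_near_eq (sf v); near=> y.
have [dg gE] : differentiable g y /\ forall h, 'd g y h = 'd f y h by near: y.
have dfy : differentiable f y by near: y.
exact: etrans (deriveE v dfy) (etrans (esym (gE v)) (esym (deriveE v dg))).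
Unshelve. all: by end_near. Qed.

(** The mean value inequality is applied in the direction [u] to the increment of [f] along
    [s *: v]. The derivative of that increment compares ['D_u f] at two points of which neither need
    be [x], and strictness handles exactly such pairs. *)
Lemma schwarz_bound V W (f : V -> W) (x u v : V) : C2_at f x ->
  forall e : R, 0 < e -> \forall s \near 0^'+,
   `|f (x + s *: u + s *: v) - f (x + s *: u) - f (x + s *: v) + f x -
     (s * s) *: 'D_v ('D_u f) x| <= e * `|v| * (s * s).
Proof.
move=> [df sf] e e0; have [du H] := sf u.
have [d d0 {}H] := H e e0; have /near_normP[d' d'0 df'] := df.
pose m := Num.min d d'; have m0 : 0 < m by rewrite lt_min d0.
pose r := m / (`|u| + `|v| + 1).
have N0 : 0 < `|u| + `|v| + 1 by rewrite ltr_wpDl // addr_ge0.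
have r0 : 0 < r by rewrite divr_gt0.
near=> s.
have s0 : 0 < s by near: s; exact: nbhs_right_gt.
have sr : s < r by near: s; exact: nbhs_right_lt.
have small a b : 0 <= a <= s -> 0 <= b <= s -> `|x + a *: u + b *: v - x| < m.
  move=> /andP[a0 as_] /andP[b0 bs].
  rewrite (_ : x + a *: u + b *: v - x = a *: u + b *: v); last first.
    by rewrite -(addrA x) addrAC subrr add0r.
  apply: le_lt_trans (ler_normD _ _) _; rewrite !normrZ !ger0_norm //.
  have h1 : a * `|u| <= s * `|u| by rewrite ler_wpM2r.
  have h2 : b * `|v| <= s * `|v| by rewrite ler_wpM2r.
  have : s * (`|u| + `|v| + 1) < m by rewrite -ltr_pdivlMr.
  by lra.
have s_s : 0 <= s <= s by rewrite lexx ltW.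
have zs : (0 : R) <= 0 <= s by rewrite lexx ltW.
have in1 a : 0 <= a <= s -> `|x + a *: u + s *: v - x| < m by move=> /small; exact.
have in2 a : 0 <= a <= s -> `|x + a *: u - x| < m.
  by move=> /small/(_ zs); rewrite scale0r addr0.
have md : m <= d by rewrite ge_min lexx.
have md' : m <= d' by rewrite ge_min lexx orbT.
pose g a := f (x + a *: u + s *: v) - f (x + a *: u) - a *: (s *: 'D_v ('D_u f) x).
pose g' a := 'D_u f (x + a *: u + s *: v) - 'D_u f (x + a *: u) - s *: 'D_v ('D_u f) x.
have dg a : 0 <= a <= s -> is_derive a 1 g (g' a).
  move=> a_s.
  have d1 : differentiable f (x + a *: u + s *: v).
    by apply: df'; apply: lt_le_trans (in1 _ a_s) md'.
  have d2 : differentiable f (x + a *: u).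
    by apply: df'; apply: lt_le_trans (in2 _ a_s) md'.
  have L1 : is_derive a 1 (fun a => x + a *: u + s *: v) u.
    by under eq_fun do rewrite addrAC; exact: is_derive_line.
  have L := is_derive_line 0 (s *: 'D_v ('D_u f) x) a.
  have := is_deriveB (is_deriveB (is_derive_diff L1 d1) (is_derive_diff (is_derive_line x u a) d2)) L.
  rewrite /g' -!deriveE //.
  by under [X in is_derive _ _ (_ - X)]eq_fun do rewrite add0r.
have := @mean_value_ineq _ _ g g' (fun a => e * `|s *: v| * a) (fun a => e * `|s *: v|) 0 s (ltW s0).
rewrite mulr0 subr0.
rewrite (_ : g s - g 0 = f (x + s *: u + s *: v) - f (x + s *: u) - (s * s) *: 'D_v ('D_u f) x - (f (x + s *: v) - f x)); last first.
  by rewrite /g !scale0r !addr0 subr0 scalerA.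
rewrite (_ : e * `|s *: v| * s = e * `|v| * (s * s)); last first.
  by rewrite normrZ gtr0_norm //; ring.
move=> h.
have shuffle (a b c z : W) : a - b + c - z = a - z - (b - c).
  by rewrite opprB addrAC (addrAC a) (addrAC (a - z)) -addrA.
rewrite shuffle; apply: h.
- apply: derivable_within_continuous => a; rewrite in_itv => a_s.
  by case: (dg a a_s).
- by apply: continuous_subspaceT => a; exact: mulrl_continuous.
- by move=> a /andP[a0 as_]; apply: dg; rewrite !ltW.
- move=> a _; have := is_deriveZ (e * `|s *: v|) (is_derive_id a 1).
  by rewrite /GRing.scale /= mulr1.
- move=> a /andP[a0 as_]; rewrite /g'.
  have a_s : 0 <= a <= s by rewrite !ltW.
  have := H (x + a *: u + s *: v) (x + a *: u).
  rewrite (_ : x + a *: u + s *: v - (x + a *: u) = s *: v); last first.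
    by rewrite addrC addKr.
  rewrite linearZ -deriveE //; apply.
    by apply: lt_le_trans (in1 _ a_s) md.
  by apply: lt_le_trans (in2 _ a_s) md.
Unshelve. all: by end_near. Qed.

(** The second difference is symmetric in [u] and [v], and both mixed derivatives approximate it
    after division by [s * s]. *)
Lemma schwarz V W (f : V -> W) (x u v : V) : C2_at f x ->
  'D_v ('D_u f) x = 'D_u ('D_v f) x.
Proof.
move=> cf; apply/eqP; rewrite -subr_eq0 -normr_le0; apply/ler_addgt0Pr => e e0.
rewrite add0r; pose N := `|u| + `|v| + 1.
have N0 : 0 < N by rewrite ltr_wpDl // addr_ge0.
have eN : 0 < e / N by rewrite divr_gt0.
near (0 : R)^'+ => s.
have s0 : 0 < s by near: s; exact: nbhs_right_gt.
have h1 : `|f (x + s *: u + s *: v) - f (x + s *: u) - f (x + s *: v) + f x -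
     (s * s) *: 'D_v ('D_u f) x| <= e / N * `|v| * (s * s).
  by near: s; exact: schwarz_bound.
have : `|f (x + s *: v + s *: u) - f (x + s *: v) - f (x + s *: u) + f x -
     (s * s) *: 'D_u ('D_v f) x| <= e / N * `|u| * (s * s).
  by near: s; exact: schwarz_bound.
rewrite (addrAC x) (addrAC (f _) (- f (x + s *: v))) => h2.
have ss : 0 < s * s by rewrite mulr_gt0.
set X := _ - f (x + s *: v) + f x in h1 h2.
have : `|(s * s) *: ('D_v ('D_u f) x - 'D_u ('D_v f) x)| <= e / N * (`|u| + `|v|) * (s * s).
  have := ler_normB (X - (s * s) *: 'D_u ('D_v f) x) (X - (s * s) *: 'D_v ('D_u f) x).
  rewrite opprB addrC addrA subrK -scalerBr => /le_trans; apply.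
  by apply: le_trans (lerD h2 h1) _; rewrite -!mulrDl -!mulrDr.
rewrite normrZ gtr0_norm // mulrC ler_pM2r // => /le_trans; apply.
by rewrite mulrAC ler_pdivrMr // ler_wpM2l ?(ltW e0) // /N lerDl.
Unshelve. all: by end_near. Qed.

Lemma diff_cV_coord n W (f : 'cV[R]_n -> W) (y v : 'cV[R]_n) :
  differentiable f y -> 'd f y v = \sum_i v i 0 *: 'D_(delta_mx i 0) f y.
Proof.
move=> df; rewrite {1}(cV_sum_delta v) linear_sum; apply: eq_bigr => i _.
by rewrite linearZ deriveE.
Qed.

(** By the chain rule a directional derivative of the composite is a sum of products of coordinates
    of ['D_v g] with partial derivatives of [f] along [g], all of them strictly differentiable. *)
Lemma C2_at_comp n U W (f : 'cV[R]_n -> W) (g : U -> 'cV[R]_n) (x : U) :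
  fin_coord U -> C2_at g x -> C2_at f (g x) -> C2_at (fun y => f (g y)) x.
Proof.
move=> fU cg cf; have sg := C2_at_sdiff fU cg.
have [dg sg'] := cg; have [df sf'] := cf.
have gc : {for x, continuous g} by apply: differentiable_continuous; case: sg.
have dfg : \forall y \near x, differentiable f (g y) := gc _ df.
split=> [|v].
  near=> y.
  have dgy : differentiable g y by near: y.
  have dfy : differentiable f (g y) by near: y.
  exact: (diff_fun_comp dgy dfy).1.
have E : \forall y \near x, \sum_i ('D_v g y) i 0 *: 'D_(delta_mx i 0) f (g y) = 'D_v (fun y => f (g y)) y.
  near=> y.
  have dgy : differentiable g y by near: y.
  have dfy : differentiable f (g y) by near: y.
  have [dfg1 dfgE] := diff_fun_comp dgy dfy.
  by rewrite (deriveE v dfg1) dfgE diff_cV_coord // (deriveE v dgy).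
apply: sdiff_near_eq E _; apply: sdiff_sum => i; apply: sdiff_scale.
  by apply: sdiff_coord; exact: sg'.
by apply: (@sdiff_comp _ _ _ _ ('D_(delta_mx i 0) f) g).
Unshelve. all: by end_near. Qed.

Lemma Ck_continuous V W k (A : set V) (f : V -> W) (x : V) : Ck k A f -> A x ->
  {for x, continuous f}.
Proof.
by case: k => [|k] /= H Ax; [exact: H|apply: differentiable_continuous; exact: H.1].
Qed.

Lemma Ck_sdiff V W k (A : set V) (f : V -> W) (x : V) : fin_coord V ->
  nbhs x A -> Ck k.+1 A f -> sdiff f x.
Proof.
move=> fV Ax [df cf]; have Axx := nbhs_singleton Ax.
apply: C1_sdiff => //; first by apply: filterS Ax.
by move=> v; exact: Ck_continuous (cf v) Axx.
Qed.

Lemma Ck_C2_at V W k (A : set V) (f : V -> W) (x : V) : fin_coord V ->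
  nbhs x A -> Ck k.+2 A f -> C2_at f x.
Proof.
move=> fV Ax [df cf]; split; first by apply: filterS Ax.
by move=> v; exact: Ck_sdiff (cf v).
Qed.

Lemma Ck_ext V W k (A : set V) (f g : V -> W) : open A ->
  (forall x, A x -> f x = g x) -> Ck k A f -> Ck k A g.
Proof.
move=> oA; elim: k f g => [|k IH] f g fg /=.
  move=> cf x Ax; have near_fg : \forall y \near x, f y = g y.
    by apply: filterS (open_nbhs_nbhs (conj oA Ax)).
  have := cf x Ax; rewrite /prop_for /continuous_at (fg _ Ax) => h.
  by apply: cvg_trans h; exact: near_eq_cvg.
move=> [df cf].
have near_fg x : A x -> \forall y \near x, f y = g y.
  by move=> Ax; apply: filterS (open_nbhs_nbhs (conj oA Ax)).
split=> [x Ax|v]; first by have [] := diff_near_eq (near_fg x Ax) (df x Ax).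
apply: IH (cf v) => x Ax.
have [dg dE] := diff_near_eq (near_fg x Ax) (df x Ax).
exact: etrans (deriveE v (df x Ax)) (etrans (esym (dE v)) (esym (deriveE v dg))).
Qed.

Lemma Ck_coord V m n k (A : set V) (f : V -> 'M[R]_(m, n)) i j :
  open A -> Ck k A f -> Ck k A (fun x => f x i j : R^o).
Proof.
move=> oA; elim: k f => [|k IH] f /=.
  move=> cf x /cf fx.
  exact: (@continuous_comp _ _ _ f (fun M : 'M[R]_(m, n) => M i j) x fx (@coord_continuous _ _ _ _ _ _)).
move=> [df cf]; split=> [x Ax|v].
  have dc : differentiable (fun M : 'M[R]_(m, n) => M i j : R^o) (f x) by exact: differentiable_coord.
  exact: (diff_fun_comp (df x Ax) dc).1.
apply: Ck_ext (IH _ (cf v)) => // x Ax.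
by rewrite derive_mx ?mxE //; exact: diff_derivable (df x Ax).
Qed.
End C2.

(** * Charts and velocities *)

Section Partial.
Context {R : realType}.
Implicit Types U V W : normedModType R.

Lemma sdiff_pairl V W (w : W) (x : V) : sdiff (fun y => (y, w)) x.
Proof. by apply: sdiff_pair; [exact: sdiff_id|exact: sdiff_cst]. Qed.

Lemma sdiff_pairr V W (v : V) (x : W) : sdiff (fun y => (v, y)) x.
Proof. by apply: sdiff_pair; [exact: sdiff_cst|exact: sdiff_id]. Qed.

Lemma derive_pairl U V W (f : U * V -> W) (u : U) (v : V) (h : U) :
  'D_h (fun y => f (y, v)) u = 'D_(h, 0) f (u, v).
Proof.
suff E : (fun a : R => a^-1 *: (f (a *: h + u, v) - f (u, v))) =
    (fun a : R => a^-1 *: (f (a *: ((h, 0) : U * V) + (u, v)) - f (u, v))).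
  by rewrite /derive /= E.
apply/funext => a; have -> // : a *: ((h, 0) : U * V) + (u, v) = (a *: h + u, v).
by apply: injective_projections; rewrite /= ?scaler0 ?add0r.
Qed.

Lemma derive_pairr U V W (f : U * V -> W) (u : U) (v : V) (h : V) :
  'D_h (fun y => f (u, y)) v = 'D_(0, h) f (u, v).
Proof.
suff E : (fun a : R => a^-1 *: (f (u, a *: h + v) - f (u, v))) =
    (fun a : R => a^-1 *: (f (a *: ((0, h) : U * V) + (u, v)) - f (u, v))).
  by rewrite /derive /= E.
apply/funext => a; have -> // : a *: ((0, h) : U * V) + (u, v) = (u, a *: h + v).
by apply: injective_projections; rewrite /= ?scaler0 ?add0r.
Qed.

Lemma C2_at_pairr U V W (f : U * V -> W) (u : U) (v : V) :
  C2_at f (u, v) -> C2_at (fun y => f (u, y)) v.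
Proof.
move=> [df sf]; have [dp _] := sdiff_pairr u v.
split=> [|h].
  have pc : {for v, continuous (pair u)} by exact: differentiable_continuous.
  have near_df : \forall y \near v, differentiable f (u, y) := pc _ df.
  apply: filterS near_df => y dfy.
  by have [dpy _] := sdiff_pairr u y; have [] := diff_fun_comp dpy dfy.
under eq_fun do rewrite derive_pairr.
exact: (sdiff_comp (sdiff_pairr u v) (sf _)).
Qed.
End Partial.

Section Charts.
Context {R : realType} {n : nat} {G : lieGroupType R n}.
Implicit Types (p q : G) (a b c : chart R n G).

Lemma nbhs_chart_cod c p : chart_dom c p -> nbhs (chart_map c p) (chart_cod c).
Proof.
move=> cp; apply: open_nbhs_nbhs; split; first exact: chart_cod_open.
exact: chart_map_cod.
Qed.

Lemma nbhs_chart_dom c p : chart_dom c p -> nbhs p (chart_dom c).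
Proof. by move=> cp; apply: open_nbhs_nbhs; split; first exact: chart_dom_open. Qed.

Lemma mul_continuous (T : topologicalType) (f g : T -> G) (t : T) :
  {for t, continuous f} -> {for t, continuous g} ->
  {for t, continuous (fun s => f s * g s)%g}.
Proof.
move=> cf cg; apply: (@continuous_comp _ _ _ (fun s => (f s, g s)) (fun z => z.1 * z.2)%g).
  exact: continuous_pair.
exact: lie_mul_continuous.
Qed.

Lemma mull_cvg (T : Type) (F : set_system T) p q (e : T -> G) : Filter F ->
  e s @[s --> F] --> q -> (p * e s)%g @[s --> F] --> (p * q)%g.
Proof.
move=> FF; apply: (@continuous2_cvg _ _ _ _ _ _ (fun=> p) e (fun x y => x * y)%g).
  exact: (@lie_mul_continuous _ _ G (p, q)).
exact: cvg_cst.
Qed.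

Lemma chart_mul_C2 a b c (z : 'cV[R]_n * 'cV[R]_n) :
  lie_atlas G a -> lie_atlas G b -> lie_atlas G c ->
  chart_cod a z.1 -> chart_cod b z.2 ->
  chart_dom c (chart_inv a z.1 * chart_inv b z.2)%g ->
  C2_at (fun z : 'cV[R]_n * 'cV[R]_n =>
    chart_map c (chart_inv a z.1 * chart_inv b z.2)%g) z.
Proof.
move=> aG bG cG az bz cz.
have := lie_mul_smooth _ _ _ aG bG cG 2.
apply: Ck_C2_at; first by apply: fin_coord_prod; exact: fin_coord_cV.
have a_near : \forall w \near z, chart_cod a w.1.
  have fc : {for z, continuous (@fst 'cV[R]_n 'cV[R]_n)} by exact: cvg_fst.
  exact: fc _ (open_nbhs_nbhs (conj (@chart_cod_open _ _ _ a) az)).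
have b_near : \forall w \near z, chart_cod b w.2.
  have fc : {for z, continuous (@snd 'cV[R]_n 'cV[R]_n)} by exact: cvg_snd.
  exact: fc _ (open_nbhs_nbhs (conj (@chart_cod_open _ _ _ b) bz)).
have c_near : \forall w \near z, chart_dom c (chart_inv a w.1 * chart_inv b w.2)%g.
  have mc : {for z, continuous (fun w : 'cV[R]_n * 'cV[R]_n => chart_inv a w.1 * chart_inv b w.2)%g}.
    apply: mul_continuous.
      apply: (@continuous_comp _ _ _ fst (chart_inv a)); first exact: cvg_fst.
      exact: chart_inv_continuous.
    apply: (@continuous_comp _ _ _ snd (chart_inv b)); first exact: cvg_snd.
    exact: chart_inv_continuous.
  exact: mc _ (nbhs_chart_dom cz).
by near=> w; split; near: w.
Unshelve. all: by end_near. Qed.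

(** Smoothness is given for the multiplication as a map of two variables. Reading [p] in a chart of
    the atlas turns left translation into a partial map of it. *)
Lemma chart_mull_C2 p b c (y : 'cV[R]_n) :
  lie_atlas G b -> lie_atlas G c -> chart_cod b y ->
  chart_dom c (p * chart_inv b y)%g ->
  C2_at (fun y => chart_map c (p * chart_inv b y)%g) y.
Proof.
move=> bG cG bx cx; have [a aG ap] := lie_atlas_cover p.
have pE := chart_mapK ap; rewrite -pE in cx.
have := chart_mul_C2 (z := (chart_map a p, y)) aG bG cG (chart_map_cod ap) bx cx.
by move=> /C2_at_pairr; rewrite /= pE.
Qed.

Local Notation phi := (chart_map (id_chart G)).
Local Notation psi := (chart_inv (id_chart G)).
Local Notation x0 := (phi 1%g).

Lemma psi_x0 : psi x0 = 1%g.
Proof. exact: chart_mapK id_chart_dom. Qed.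

Lemma x0_cod : chart_cod (id_chart G) x0.
Proof. exact: chart_map_cod id_chart_dom. Qed.

Lemma near_phiK : \forall x \near x0, phi (psi x) = x.
Proof.
have := nbhs_chart_cod (@id_chart_dom _ _ G); apply: filterS => x.
exact: chart_invK.
Qed.

Lemma chart_mull_sdiff p b c (y : 'cV[R]_n) :
  lie_atlas G b -> lie_atlas G c -> chart_cod b y ->
  chart_dom c (p * chart_inv b y)%g ->
  sdiff (fun y => chart_map c (p * chart_inv b y)%g) y.
Proof.
by move=> bG cG bx cx; apply: C2_at_sdiff (chart_mull_C2 bG cG bx cx); exact: fin_coord_cV.
Qed.

Lemma left_chart_sdiff p c : lie_atlas G c -> chart_dom c p ->
  sdiff (fun x => chart_map c (p * psi x)%g) x0.
Proof.
move=> cG cp; apply: chart_mull_sdiff => //; [exact: id_chart_atlas|exact: x0_cod|].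
by rewrite psi_x0 mulg1.
Qed.

Lemma near_left_dom c p : chart_dom c p ->
  \forall x \near x0, chart_dom c (p * psi x)%g.
Proof.
move=> cp; have lc : {for x0, continuous (fun x => p * psi x)%g}.
  apply: mul_continuous; first exact: cst_continuous.
  by apply: chart_inv_continuous; exact: x0_cod.
by apply: (lc _); rewrite /= psi_x0 mulg1; exact: nbhs_chart_dom.
Qed.

(** In charts, left translation by [h t] is the map [K], with local inverse [M]; hence the
    differential of [M] undoes [left_translate]. *)
Lemma chart_derive_left a (h : R -> G) (t : R) (xi : 'cV[R]_n) :
  lie_atlas G a -> chart_dom a (h t) -> {for t, continuous h} ->
  is_derive t 1 (chart_map a \o h) (left_translate a (h t) xi) ->
  is_derive t 1 (fun s => phi ((h t)^-1 * h s)%g) xi.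
Proof.
move=> aG ap hc hv.
pose M y := phi ((h t)^-1 * chart_inv a y)%g.
have sM : sdiff M (chart_map a (h t)).
  apply: chart_mull_sdiff => //; [exact: id_chart_atlas|exact: chart_map_cod|].
  by rewrite chart_mapK // mulVg; exact: id_chart_dom.
have [dK _] := left_chart_sdiff aG ap; set K := (fun x => _) in dK.
have Kx0 : K x0 = chart_map a (h t) by rewrite /K psi_x0 mulg1.
have dMh := is_derive_diff hv sM.1.
have ME : 'd M ((chart_map a \o h) t) (left_translate a (h t) xi) = xi.
  rewrite /left_translate -/K deriveE // -[_ t]Kx0.
  have dMK : differentiable M (K x0) by rewrite Kx0; case: sM.
  have [_ MKE] := diff_fun_comp dK dMK; rewrite -MKE.
  have near_id : \forall x \near x0, id x = M (K x).
    near=> x; rewrite /M /K chart_mapK; last by near: x; exact: near_left_dom.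
    by rewrite mulKg; apply/esym; near: x; exact: near_phiK.
  have [di dE] := is_diff_id x0.
  by have [_ ->] := diff_near_eq near_id di; rewrite dE.
rewrite ME in dMh; apply: near_eq_is_derive dMh; near=> s.
rewrite /M /= chart_mapK //; near: s; apply: (hc _); exact: nbhs_chart_dom.
Unshelve. all: by end_near. Qed.

Lemma left_derive_velocity (h : R -> G) (t : R) (xi : 'cV[R]_n) :
  {for t, continuous h} -> is_derive t 1 (fun s => phi ((h t)^-1 * h s)%g) xi ->
  has_velocity h t xi.
Proof.
move=> hc hd; split=> [|c cG cp]; first exact: hc.
have [dK _] := left_chart_sdiff cG cp; set K := (fun x => _) in dK.
have dK' : differentiable K (phi ((h t)^-1 * h t)%g) by rewrite mulVg.
have := is_derive_diff hd dK'; rewrite mulVg -deriveE //.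
apply: near_eq_is_derive; near=> s.
have hs : chart_dom (id_chart G) ((h t)^-1 * h s)%g.
  near: s; have c1 : {for t, continuous (fun s => (h t)^-1 * h s)%g}.
    by apply: mul_continuous => //; exact: cst_continuous.
  by apply: (c1 _); rewrite mulVg; apply: nbhs_chart_dom; exact: id_chart_dom.
by rewrite /K /= chart_mapK // mulVKg.
Unshelve. all: by end_near. Qed.

Lemma has_velocity_chart a (h : R -> G) (t : R) (xi : 'cV[R]_n) :
  lie_atlas G a -> chart_dom a (h t) -> {for t, continuous h} ->
  is_derive t 1 (chart_map a \o h) (left_translate a (h t) xi) ->
  has_velocity h t xi.
Proof.
by move=> aG ap hc hd; exact: left_derive_velocity hc (chart_derive_left aG ap hc hd).
Qed.

(** A velocity can be tested in one chart once the curve is translated to the identity. Invariance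
    under left translation then becomes a mere cancellation of group elements. *)
Lemma has_velocity_left (h : R -> G) (t : R) (xi : 'cV[R]_n) :
  has_velocity h t xi <->
  {for t, continuous h} /\ is_derive t 1 (fun s => phi ((h t)^-1 * h s)%g) xi.
Proof.
split=> [[hc hv]|[hc hd]]; last exact: left_derive_velocity.
have [a aG ap] := lie_atlas_cover (h t); split; first exact: hc.
exact: chart_derive_left aG ap hc (hv a aG ap).
Qed.

Lemma has_velocity_mull p (h : R -> G) (t : R) (xi : 'cV[R]_n) :
  has_velocity h t xi -> has_velocity (fun s => p * h s)%g t xi.
Proof.
move=> /has_velocity_left[hc hd]; apply/has_velocity_left; split.
  by apply: mul_continuous => //; exact: cst_continuous.
by under eq_fun do rewrite invgM -mulgA mulKg.
Qed.

Lemma near_eq_has_velocity (h k : R -> G) (t : R) (xi : 'cV[R]_n) :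
  (\forall s \near t, h s = k s) -> has_velocity h t xi -> has_velocity k t xi.
Proof.
move=> hk [hc hv]; have hkt := nbhs_singleton hk; split.
  move: hc; rewrite /prop_for /continuous_at hkt => hc.
  by apply: cvg_trans hc; exact: near_eq_cvg.
move=> c cG; rewrite -hkt => /(hv c cG); apply: near_eq_is_derive.
by apply: filterS hk => s /= ->.
Qed.

Lemma left_translate1 (xi : 'cV[R]_n) : left_translate (id_chart G) 1%g xi = xi.
Proof.
have [di dE] := is_diff_id x0.
have near_id : \forall x \near x0, id x = phi (1 * psi x)%g.
  by apply: filterS near_phiK => x; rewrite mul1g => ->.
have [d1 d1E] := diff_near_eq near_id di.
by rewrite /left_translate deriveE // d1E dE.
Qed.

Lemma left_translateE c p (xi : 'cV[R]_n) : lie_atlas G c -> chart_dom c p ->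
  left_translate c p xi = \sum_i xi i 0 *: left_translate c p (delta_mx i 0).
Proof.
move=> cG cp; have [dK _] := left_chart_sdiff cG cp.
exact: etrans (deriveE xi dK) (diff_cV_coord xi dK).
Qed.

Lemma mul_chart_C2 (x y : 'cV[R]_n) : chart_cod (id_chart G) x ->
  chart_cod (id_chart G) y -> chart_dom (id_chart G) (psi x * psi y)%g ->
  C2_at (fun z : 'cV[R]_n * 'cV[R]_n => phi (psi z.1 * psi z.2)%g) (x, y).
Proof. by move=> xc yc xyc; apply: (chart_mul_C2 (z := (x, y)) id_chart_atlas id_chart_atlas id_chart_atlas). Qed.

(** The translate is a partial derivative of the multiplication read in charts; as the latter is
    C^2, one strict derivative in the base point remains. *)
Lemma left_translate_sdiff (i : 'I_n) :
  sdiff (fun x => left_translate (id_chart G) (psi x) (delta_mx i 0)) x0.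
Proof.
have [|||_ /(_ (0, delta_mx i 0))] := @mul_chart_C2 x0 x0; try exact: x0_cod.
  by rewrite psi_x0 mul1g; exact: id_chart_dom.
move=> H; have := sdiff_comp (sdiff_pairl x0 x0) H.
by under eq_fun do rewrite -derive_pairr.
Qed.
End Charts.

(** * Continuity on a closed interval and one-sided limits *)

Lemma within_cvg_right (R : realType) (T : topologicalType) (h : R -> T)
  (a b t : R) : {within `[a, b], continuous h} -> a <= t < b ->
  h s @[s --> t^'+] --> h t.
Proof.
move=> /subspace_continuousP hc /andP[at_ tb].
have : h s @[s --> within `[a, b] (nbhs t)] --> h t.
  by apply: hc; rewrite /= in_itv /= at_ ltW.
move=> ht P /ht /near_at_right H; change (\forall s \near t^'+, P (h s)).
near=> s; have : `[a, b]%classic s -> P (h s) by near: s; exact: H.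
apply; rewrite /= in_itv /=; apply/andP; split.
  by apply: (le_trans at_); near: s; exact: nbhs_right_ge.
by near: s; exact: nbhs_right_ltW.
Unshelve. all: by end_near. Qed.

Lemma within_cvg_left (R : realType) (T : topologicalType) (h : R -> T)
  (a b t : R) : {within `[a, b], continuous h} -> a < t <= b ->
  h s @[s --> t^'-] --> h t.
Proof.
move=> /subspace_continuousP hc /andP[at_ tb].
have : h s @[s --> within `[a, b] (nbhs t)] --> h t.
  by apply: hc; rewrite /= in_itv /= tb ltW.
move=> ht P /ht /near_at_left H; change (\forall s \near t^'-, P (h s)).
near=> s; have : `[a, b]%classic s -> P (h s) by near: s; exact: H.
apply; rewrite /= in_itv /=; apply/andP; split.
  by near: s; exact: near_at_left (lt_le_nbhsr at_).
by apply: le_trans tb; near: s; exact: nbhs_left_le.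
Unshelve. all: by end_near. Qed.

Lemma within_continuous_itv (R : realType) (T : topologicalType) (h : R -> T)
  (a b : R) : a < b -> (forall t, a < t < b -> {for t, continuous h}) ->
  h s @[s --> a^'+] --> h a -> h s @[s --> b^'-] --> h b ->
  {within `[a, b], continuous h}.
Proof.
move=> ab hi ha hb; apply/subspace_continuousP => t /=; rewrite in_itv /=.
move=> /andP[]; rewrite !le_eqVlt => /orP[/eqP <- _|at_ /orP[/eqP ->|tb]].
- move=> P /= Pa; have [d /= d0 H] := ha P Pa; exists d => //= s sd; rewrite in_itv /=.
  move=> /andP[]; rewrite le_eqVlt => /orP[/eqP <- _|as_ _]; last exact: H.
  exact: nbhs_singleton.
- move=> P /= Pb; have [d /= d0 H] := hb P Pb; exists d => //= s sd; rewrite in_itv /=.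
  move=> /andP[_]; rewrite le_eqVlt => /orP[/eqP ->|sb]; last exact: H.
  exact: nbhs_singleton.
have := hi t; rewrite at_ tb => /(_ isT) ht P /= /ht [d d0 H].
by exists d => // s sd _; exact: H.
Qed.

(** * Velocity of a product, and regularity in left-translated coordinates *)

Section Velocity.
Context {R : realType} {n : nat} {G : lieGroupType R n}.
Implicit Types (p q : G) (a b c : chart R n G).

Local Notation phi := (chart_map (id_chart G)).
Local Notation psi := (chart_inv (id_chart G)).
Local Notation x0 := (phi 1%g).

Definition right_translate (x xi : 'cV[R]_n) : 'cV[R]_n :=
  'D_xi (fun y => phi (psi y * psi x)%g) x0.

Lemma psi_dom x : chart_cod (id_chart G) x -> chart_dom (id_chart G) (psi x).
Proof. exact: chart_inv_dom. Qed.

Lemma right_translate0 (x : 'cV[R]_n) : right_translate x 0 = 0.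
Proof. exact: derive0. Qed.

Lemma has_velocity_cst p (t : R) : has_velocity (fun=> p) t (0 : 'cV[R]_n).
Proof.
apply/has_velocity_left; split; first exact: cst_continuous.
exact: is_derive_cst.
Qed.

(* Differentiating [(g t)^-1 g(s) psi(x s)] at [s = t]: the [g] factor
   contributes the right translate of [xi']. *)
Lemma has_velocity_mul_psi (g : R -> G) (x : R -> 'cV[R]_n) (t : R)
    (xi xi' : 'cV[R]_n) : has_velocity g t xi' -> chart_cod (id_chart G) (x t) ->
  is_derive t 1 x (left_translate (id_chart G) (psi (x t)) xi -
                   right_translate (x t) xi') ->
  has_velocity (fun s => g s * psi (x s))%g t xi.
Proof.
move=> /has_velocity_left[gc dg] xt dx.
have xc : {for t, continuous x} by exact: is_derive_continuous dx.
have pxc : {for t, continuous (fun s => psi (x s))}.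
  apply: (@continuous_comp _ _ _ x psi) => //; exact: chart_inv_continuous.
pose e s := ((g t)^-1 * g s * psi (x s))%g.
have ggc : {for t, continuous (fun s => (g t)^-1 * g s)%g}.
  by apply: mul_continuous => //; exact: cst_continuous.
have ec : {for t, continuous e} by exact: mul_continuous.
have et : e t = psi (x t) by rewrite /e mulVg mul1g.
suff ev : has_velocity e t xi.
  have := has_velocity_mull (g t) ev; apply: near_eq_has_velocity.
  near=> s; by rewrite /e -mulgA mulVKg.
apply: (@has_velocity_chart _ _ _ (id_chart G) e t xi id_chart_atlas) => //.
  by rewrite et; exact: psi_dom.
rewrite et; pose w s := phi ((g t)^-1 * g s)%g.
have wt : w t = x0 by rewrite /w mulVg.
pose m := fun z : 'cV[R]_n * 'cV[R]_n => phi (psi z.1 * psi z.2)%g.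
have cm : C2_at m (x0, x t).
  by apply: mul_chart_C2 => //; [exact: x0_cod|rewrite psi_x0 mul1g; exact: psi_dom].
have [dm _] : sdiff m (x0, x t).
  by apply: C2_at_sdiff cm; apply: fin_coord_prod; exact: fin_coord_cV.
set v := left_translate _ _ _ - _ in dx.
have dm' : differentiable m (w t, x t) by rewrite wt.
have := is_derive_diff (is_derive_pair dg dx) dm'; rewrite -/(w t) wt.
(* The first partial derivative of [m] gives the right translate of [xi'] and the second is the
   identity, so the term subtracted in [v] cancels the former. *)
have -> : 'd m (x0, x t) (xi', v) = left_translate (id_chart G) (psi (x t)) xi.
  have -> : (xi', v) = (xi', 0) + (0, v) :> 'cV[R]_n * 'cV[R]_n.
    by apply: injective_projections; rewrite /= ?addr0 ?add0r.
  rewrite linearD -!deriveE // -derive_pairl -derive_pairr /m /= psi_x0.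
  have near_id : \forall y \near x t, id y = phi (1 * psi y)%g.
    have : nbhs (x t) (chart_cod (id_chart G)).
      by apply: open_nbhs_nbhs; split; first exact: (@chart_cod_open _ _ _ (id_chart G)).
    by apply: filterS => y yc; rewrite mul1g chart_invK.
  have [di dE] := is_diff_id (x t).
  have [dj djE] := diff_near_eq near_id di.
  by rewrite (deriveE v dj) djE dE /v addrC subrK.
apply: near_eq_is_derive; near=> s; rewrite /m /w /e /= chart_mapK //.
near: s; apply: (ggc _); rewrite mulVg; apply: nbhs_chart_dom.
exact: id_chart_dom.
Unshelve. all: by end_near. Qed.

Lemma nbhs_chart_set c p (U : set G) : chart_dom c p -> nbhs p U ->
  nbhs (chart_map c p) [set x | chart_cod c x /\ U (chart_inv c x)].
Proof.
move=> cp pU; have cc := chart_map_cod cp.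
have ic : {for chart_map c p, continuous (chart_inv c)} by exact: chart_inv_continuous.
have near_U : \forall x \near chart_map c p, U (chart_inv c x).
  by apply: (ic _); rewrite chart_mapK.
near=> x; split; near: x; last exact: near_U.
exact: nbhs_chart_cod.
Unshelve. all: by end_near. Qed.

Lemma near_left_chart (W : normedModType R) c p (F : G -> W) : chart_dom c p ->
  \forall x \near x0, (F \o chart_inv c) (chart_map c (p * psi x)%g) = F (p * psi x)%g.
Proof.
by move=> cp; have := near_left_dom cp; apply: filterS => x xd; rewrite /= chart_mapK.
Qed.

Lemma Ck_on_left_sdiff (W : normedModType R) k (U : set G) (F : G -> W) p :
  open U -> U p -> Ck_on k.+1 U F -> sdiff (fun x => F (p * psi x)%g) x0.
Proof.
move=> oU Up cF; have [c cG cp] := lie_atlas_cover p.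
apply: sdiff_near_eq (near_left_chart F cp) _.
apply: sdiff_comp; first exact: left_chart_sdiff.
rewrite psi_x0 mulg1; apply: Ck_sdiff (cF c cG); first exact: fin_coord_cV.
by apply: nbhs_chart_set => //; exact: open_nbhs_nbhs.
Qed.

Lemma Ck_on_left_C2 (W : normedModType R) k (U : set G) (F : G -> W) p :
  open U -> U p -> Ck_on k.+2 U F -> C2_at (fun x => F (p * psi x)%g) x0.
Proof.
move=> oU Up cF; have [c cG cp] := lie_atlas_cover p.
apply: C2_at_near_eq (near_left_chart F cp) _.
apply: C2_at_comp.
- exact: fin_coord_cV.
- apply: chart_mull_C2 => //; [exact: id_chart_atlas|exact: x0_cod|].
  by rewrite psi_x0 mulg1.
rewrite psi_x0 mulg1; apply: Ck_C2_at (cF c cG); first exact: fin_coord_cV.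
by apply: nbhs_chart_set => //; exact: open_nbhs_nbhs.
Qed.

Lemma C1_left_sdiff (W : normedModType R) (F : G -> W) p :
  C1 F -> sdiff (fun x => F (p * psi x)%g) x0.
Proof. by move=> cF; apply: Ck_on_left_sdiff cF => //; exact: openT. Qed.

(** The extension [F] supplies a two-sided time derivative also at [t = 0]. Regularity is therefore
    stated for [F] from here on, while values are taken from [f]. *)
Lemma C1_time_left_sdiff (W : normedModType R) (f : G -> R -> W) : C1_time f ->
  exists2 F : G * R -> W, (forall p t, 0 <= t -> F (p, t) = f p t) &
    forall p t, 0 <= t ->
      sdiff (fun z : 'cV[R]_n * R => F (p * psi z.1, z.2)%g) (x0, t).
Proof.
move=> [U [F [oU UF Ff cF]]]; exists F => [p t /Ff //|p t t0].
have [c cG cp] := lie_atlas_cover p.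
pose P := fun z : 'cV[R]_n * R => (chart_map c (p * psi z.1)%g, z.2).
have nearP : \forall z \near (x0, t), (fun w : 'cV[R]_n * R => F (chart_inv c w.1, w.2)) (P z) = F (p * psi z.1, z.2)%g.
  have fc : {for (x0, t), continuous (@fst 'cV[R]_n R)} by exact: cvg_fst.
  have dom1 : \forall z \near (x0, t), chart_dom c (p * psi z.1)%g := fc _ (near_left_dom cp).
  apply: filterS dom1 => z zd.
  by rewrite /P /= chart_mapK.
apply: sdiff_near_eq nearP _; apply: (@sdiff_comp _ _ _ _ (fun w : 'cV[R]_n * R => F (chart_inv c w.1, w.2)) P).
  apply: sdiff_pair; last exact: sdiff_snd.
  by apply: (@sdiff_comp _ _ _ _ (fun x => chart_map c (p * psi x)%g) fst); [exact: sdiff_fst|exact: left_chart_sdiff].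
rewrite /P /= psi_x0 mulg1; apply: Ck_sdiff (cF c cG).
  by apply: fin_coord_prod; [exact: fin_coord_cV|exact: fin_coord_R].
have fc : {for (chart_map c p, t), continuous (@fst 'cV[R]_n R)} by exact: cvg_fst.
have sc : {for (chart_map c p, t), continuous (@snd 'cV[R]_n R)} by exact: cvg_snd.
have ic : {for (chart_map c p, t), continuous (fun z : 'cV[R]_n * R => (chart_inv c z.1, z.2))}.
  apply: continuous_pair => //.
  apply: (@continuous_comp _ _ _ fst (chart_inv c)) => //=.
  by apply: chart_inv_continuous; exact: chart_map_cod.
have near1 : \forall z \near (chart_map c p, t), chart_cod c z.1.
  exact: fc _ (nbhs_chart_cod cp).
have near2 : \forall z \near (chart_map c p, t), U (chart_inv c z.1, z.2).
  by apply: (ic _); rewrite /= chart_mapK //; apply: open_nbhs_nbhs; split => //; exact: UF.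
by near=> z; split; near: z.
Unshelve. all: by end_near. Qed.
End Velocity.

(** * Uniqueness of trajectories *)

Section Flow.
Context {R : realType} {n : nat} {G : lieGroupType R n}.
Implicit Types (p q : G) (a b c : chart R n G).

Local Notation phi := (chart_map (id_chart G)).
Local Notation psi := (chart_inv (id_chart G)).
Local Notation x0 := (phi 1%g).
Local Notation LT x := (left_translate (id_chart G) (psi x)).
Local Notation RT := (@right_translate R n G).

Lemma near_x0_cod : \forall x \near x0, chart_cod (id_chart G) x.
Proof. exact: nbhs_chart_cod id_chart_dom. Qed.

(** Linearity in the translated vector reduces the claim to basis vectors, where
    [left_translate_sdiff] applies; that lemma concerns the base point [x0], hence the condition on
    [X v]. *)
Lemma left_translate_comp_sdiff (V : normedModType R) (X xi : V -> 'cV[R]_n)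
    (v : V) : X v = x0 -> sdiff X v -> sdiff xi v ->
  sdiff (fun z => LT (X z) (xi z)) v.
Proof.
move=> Xv sX sxi; have [dX _] := sX.
have near_E : \forall z \near v, \sum_i xi z i 0 *: LT (X z) (delta_mx i 0) = LT (X z) (xi z).
  have Xc : {for v, continuous X} by exact: differentiable_continuous.
  have near_cod : \forall z \near v, chart_cod (id_chart G) (X z).
    by apply: (Xc _); rewrite Xv; exact: near_x0_cod.
  apply: filterS near_cod => z Xz; rewrite -left_translateE //.
    exact: id_chart_atlas.
  exact: psi_dom.
apply: sdiff_near_eq near_E _; apply: sdiff_sum => i; apply: sdiff_scale.
  exact: sdiff_coord.
apply: (@sdiff_comp _ _ _ _ (fun x => LT x (delta_mx i 0)) X) => //.
by rewrite Xv; exact: left_translate_sdiff.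
Qed.

Lemma mul_chart1_C2 : C2_at (fun z : 'cV[R]_n * 'cV[R]_n => phi (psi z.1 * psi z.2)%g) (x0, x0).
Proof.
apply: mul_chart_C2; try exact: x0_cod.
by rewrite psi_x0 mul1g; exact: id_chart_dom.
Qed.

Lemma right_chart_sdiff x : chart_cod (id_chart G) x ->
  sdiff (fun y => phi (psi y * psi x)%g) x0.
Proof.
move=> xc; have cm : C2_at (fun z : 'cV[R]_n * 'cV[R]_n => phi (psi z.1 * psi z.2)%g) (x0, x).
  apply: mul_chart_C2 => //; first exact: x0_cod.
  by rewrite psi_x0 mul1g; exact: psi_dom.
have sm : sdiff (fun z : 'cV[R]_n * 'cV[R]_n => phi (psi z.1 * psi z.2)%g) (x0, x).
  by apply: C2_at_sdiff cm; apply: fin_coord_prod; exact: fin_coord_cV.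
exact: (sdiff_comp (sdiff_pairl x x0) sm).
Qed.

Lemma right_translate_sdiff xi : sdiff (fun x => RT x xi) x0.
Proof.
have [_ /(_ (xi, 0)) sm] := mul_chart1_C2.
have := sdiff_comp (sdiff_pairr x0 x0) sm.
by under eq_fun do rewrite -derive_pairl.
Qed.

Lemma right_translate_comp_sdiff (V : normedModType R) (X xi : V -> 'cV[R]_n)
    (v : V) : X v = x0 -> sdiff X v -> sdiff xi v ->
  sdiff (fun z => RT (X z) (xi z)) v.
Proof.
move=> Xv sX sxi; have [dX _] := sX.
have near_E : \forall z \near v, \sum_i xi z i 0 *: RT (X z) (delta_mx i 0) = RT (X z) (xi z).
  have Xc : {for v, continuous X} by exact: differentiable_continuous.
  have near_cod : \forall z \near v, chart_cod (id_chart G) (X z).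
    by apply: (Xc _); rewrite Xv; exact: near_x0_cod.
  apply: filterS near_cod => z /right_chart_sdiff[dz _].
  by rewrite /right_translate deriveE // diff_cV_coord.
apply: sdiff_near_eq near_E _; apply: sdiff_sum => i; apply: sdiff_scale.
  exact: sdiff_coord.
apply: (@sdiff_comp _ _ _ _ (fun x => RT x (delta_mx i 0)) X) => //.
by rewrite Xv; exact: right_translate_sdiff.
Qed.

(** By real induction. Agreement passes to left limits since the group is Hausdorff. It extends
    beyond a time [t] of agreement since both curves, translated by the inverse of [h t], solve one
    Lipschitz equation in the chart at the identity. *)
Lemma trajectory_unique (F : G * R -> 'cV[R]_n) (a b : R) (h k : R -> G) :
  (forall p t, a <= t <= b ->
     sdiff (fun z : 'cV[R]_n * R => F (p * psi z.1, z.2)%g) (x0, t)) ->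
  {within `[a, b], continuous h} -> {within `[a, b], continuous k} ->
  h a = k a ->
  (forall t, a < t < b -> has_velocity h t (F (h t, t))) ->
  (forall t, a < t < b -> has_velocity k t (F (k t, t))) ->
  forall t, a <= t <= b -> h t = k t.
Proof.
move=> sF hc kc hka hv kv; apply: real_induction => //; last first.
  move=> t atb hk; have hl := within_cvg_left hc atb; have kl := within_cvg_left kc atb.
  apply: (cvg_unique lie_hausdorff hl); apply: cvg_trans kl.
  case/andP: (atb) => at_ tb; apply: near_eq_cvg; near=> s; apply/esym/hk.
  by apply/andP; split; near: s; [exact: near_at_left (lt_le_nbhsr at_)|exact: nbhs_left_lt].
move=> t atb /(_ t); rewrite lexx; case/andP: (atb) => at_ tb; rewrite at_ => /(_ isT) hkt.
pose p := h t; have pd : chart_dom (id_chart G) (p^-1 * p)%g.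
  by rewrite mulVg; exact: id_chart_dom.
pose Phi (z : 'cV[R]_n * R) := LT z.1 (F (p * psi z.1, z.2)%g).
have /sdiff_lipschitz[K K0 [d d0 PhiK]] : sdiff Phi (x0, t).
  apply: left_translate_comp_sdiff => //; first exact: sdiff_fst.
  by apply: sF; rewrite at_ ltW.
have near_good (e : R -> G) : {within `[a, b], continuous e} -> e t = p ->
    \forall s \near t^'+, chart_dom (id_chart G) (p^-1 * e s)%g /\
      `|phi (p^-1 * e s)%g - x0| < d.
  move=> ec et; have er := within_cvg_right ec atb.
  have c1 : (p^-1 * e s)%g @[s --> t^'+] --> 1%g.
    by rewrite -(mulVg p); apply: mull_cvg; rewrite -et.
  have c2 : phi (p^-1 * e s)%g @[s --> t^'+] --> x0.
    have := chart_map_continuous (@id_chart_dom _ _ G); exact: cvg_comp c1.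
  have near1 : \forall s \near t^'+, chart_dom (id_chart G) (p^-1 * e s)%g.
    by apply: (c1 _); apply: nbhs_chart_dom; exact: id_chart_dom.
  have near2 : \forall s \near t^'+, `|x0 - phi (p^-1 * e s)%g| < d by exact: cvgr_dist_lt.
  by near=> s; split; [near: s|rewrite distrC; near: s].
have := filterI (near_good h hc erefl) (near_good k kc (esym hkt)).
move=> [r /= r0 H]; pose rd := Num.min r d; have rd0 : 0 < rd by rewrite lt_min r0.
have rdr : rd <= r by rewrite ge_min lexx.
have rdd : rd <= d by rewrite ge_min lexx orbT.
(* Up to [t'] both translated curves stay in the chart and in the ball where [Phi] is Lipschitz, the
   time stays within [d] of [t], and [t'] is still below [b]. *)
pose t' := Num.min (t + rd / 2) ((t + b) / 2).
have tt' : t < t' by rewrite lt_min; apply/andP; split; lra.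
have t'b : t' < b.
  by have : t' <= (t + b) / 2 by [rewrite /t' ge_min lexx orbT]; lra.
have t'r : t' <= t + rd / 2 by rewrite /t' ge_min lexx.
have good s : t < s <= t' -> (chart_dom (id_chart G) (p^-1 * h s)%g /\
      `|phi (p^-1 * h s)%g - x0| < d) /\ (chart_dom (id_chart G) (p^-1 * k s)%g /\
      `|phi (p^-1 * k s)%g - x0| < d).
  move=> /andP[ts st']; apply: H => //=.
  by rewrite distrC gtr0_norm ?subr_gt0 //; lra.
suff hk : forall s, t <= s <= t' -> h s = k s.
  near=> s; apply: hk; apply/andP; split; first by near: s; exact: nbhs_right_ge.
  by near: s; exact: nbhs_right_ltW.
pose u s := phi (p^-1 * h s)%g - phi (p^-1 * k s)%g.
pose u' s := Phi (phi (p^-1 * h s)%g, s) - Phi (phi (p^-1 * k s)%g, s).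
have dphi (e : R -> G) s : has_velocity e s (F (e s, s)) ->
    chart_dom (id_chart G) (p^-1 * e s)%g ->
    is_derive s 1 (fun s => phi (p^-1 * e s)%g) (Phi (phi (p^-1 * e s)%g, s)).
  move=> /(has_velocity_mull p^-1%g)[_ /(_ _ id_chart_atlas) H1] ed.
  by rewrite /Phi /= chart_mapK // mulVKg; exact: H1.
have du s : t < s <= t' -> is_derive s 1 u (u' s).
  move=> /[dup] /good[[hd _] [kd _]] /andP[ts st'].
  have sab : a < s < b by rewrite (le_lt_trans at_) // (le_lt_trans st').
  exact: is_deriveB (dphi h s (hv s sab) hd) (dphi k s (kv s sab) kd).
have uc : {within `[t, t'], continuous u}.
  apply: within_continuous_itv => //.
  - by move=> s /andP[ts st']; apply: is_derive_continuous (du s _); rewrite ts ltW.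
  - have cvge (e : R -> G) : {within `[a, b], continuous e} -> e t = p ->
        phi (p^-1 * e s)%g @[s --> t^'+] --> phi (p^-1 * e t)%g.
      move=> ec et; have er := within_cvg_right ec atb.
      have c1 : (p^-1 * e s)%g @[s --> t^'+] --> (p^-1 * e t)%g.
        exact: mull_cvg.
      have : {for (p^-1 * e t)%g, continuous phi} by apply: chart_map_continuous; rewrite et.
      exact: cvg_comp c1.
    by apply: cvgB; apply: cvge.
  - apply: cvg_at_left_filter; apply: is_derive_continuous (du t' _).
    by rewrite tt' lexx.
have du' r1 : t < r1 < t' -> is_derive r1 1 u (u' r1).
  by move=> /andP[tr1 r1t']; apply: du; rewrite tr1 ltW.
have ub r1 : t < r1 < t' -> `|u' r1| <= K * `|u r1|.
  move=> /andP[tr1 r1t']; have [|[_ hd1] [_ kd1]] := good r1; first by rewrite tr1 ltW.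
  have r1d : `|r1 - t| < d by rewrite gtr0_norm ?subr_gt0 //; lra.
  apply: le_trans (PhiK _ _ _ _) _; try by rewrite prod_normE gt_max /= ?hd1 ?kd1.
  by rewrite prod_normE /= subrr normr0 (max_l (normr_ge0 _)).
move=> s tst'; have := gronwall (ltW tt') (ltW K0) uc du' ub tst'.
have -> : u t = 0 by rewrite /u -hkt subrr.
rewrite normr0 mulr0 mul0r normr_le0 subr_eq0 => /eqP uE.
move: tst' => /andP[]; rewrite le_eqVlt => /orP[/eqP <- //|ts st'].
have [|[hd _] [kd _]] := good s; first by rewrite ts.
by apply: (mulgI p^-1%g); rewrite -(chart_mapK hd) -(chart_mapK kd) uE.
Unshelve. all: by end_near. Qed.
End Flow.

(** * One-parameter subgroups *)

(** Clamping each coordinate is 1-Lipschitz for the sup norm. Composed with it, a field that is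
    Lipschitz on a ball becomes globally Lipschitz. *)
Lemma box_retraction (R : realType) n (c : 'cV[R]_n) (r : R) : 0 <= r ->
  exists pi : 'cV[R]_n -> 'cV[R]_n,
    [/\ forall x y, `|pi x - pi y| <= `|x - y|, forall x, `|pi x - c| <= r &
        forall x, `|x - c| <= r -> pi x = x].
Proof.
move=> r0; pose cl (a t : R) := Num.max (a - r) (Num.min t (a + r)).
have cl1 a s t : `|cl a s - cl a t| <= `|s - t|.
  have h1 := ler_norm (s - t); have h2 := ler_norm (t - s); rewrite distrC in h2.
  rewrite /cl; case: (leP s (a + r)) => ?; case: (leP t (a + r)) => ?;
  do 2?[case: (leP (a - r) _) => ?]; rewrite ler_norml; lra.
have cl2 a t : `|cl a t - a| <= r.
  rewrite /cl; case: (leP t (a + r)) => ?; case: (leP (a - r) _) => ?; rewrite ler_norml; lra.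
have cl3 a t : `|t - a| <= r -> cl a t = t.
  rewrite ler_norml => /andP[? ?]; rewrite /cl min_l; last by lra.
  by rewrite max_r //; lra.
exists (fun x => \col_i cl (c i 0) (x i 0)); split=> [x y|x|x xr].
- apply: cV_norm_le => // i; rewrite !mxE; apply: le_trans (cl1 _ _ _) _.
  by have := norm_cV_coord (x - y) i; rewrite !mxE.
- by apply: cV_norm_le => // i; rewrite !mxE.
apply/colP => i; rewrite mxE cl3 //; apply: le_trans xr.
by have := norm_cV_coord (x - c) i; rewrite !mxE.
Qed.

Lemma continuous_near_dist (R : realType) (V W : normedModType R) (f : V -> W)
  (x : V) : {for x, continuous f} ->
  forall e : R, 0 < e -> \forall y \near x, `|f y - f x| < e.
Proof.
move=> /cvgrPdist_lt fc e /fc; apply: filterS => y; by rewrite distrC.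
Qed.

Section OneParameter.
Context {R : realType} {n : nat} {G : lieGroupType R n}.
Implicit Types (p q : G) (a b c : chart R n G).

Local Notation phi := (chart_map (id_chart G)).
Local Notation psi := (chart_inv (id_chart G)).
Local Notation x0 := (phi 1%g).
Local Notation LT x := (left_translate (id_chart G) (psi x)).

Lemma has_velocity_shift (h : R -> G) (s t : R) (xi : 'cV[R]_n) :
  has_velocity h (s + t) xi -> has_velocity (fun r => h (s + r)) t xi.
Proof.
move=> [hc hv]; have dl : is_derive t 1 (fun r : R => s + r) 1.
  have := is_deriveD (is_derive_cst s t 1) (is_derive_id t 1).
  by rewrite add0r.
split.
  apply: (@continuous_comp _ _ _ (fun r => s + r) h) => //.
  exact: is_derive_continuous dl.
move=> c cG cp; have [/derivable1_diffP dh hE] := hv c cG cp.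
exact: is_derive_eq (is_derive_diff dl dh) (etrans (esym (deriveE _ dh)) hE).
Qed.

Lemma has_velocity_scale (h : R -> G) (a : R) (xi : 'cV[R]_n) :
  has_velocity h 0 xi -> has_velocity (fun r => h (a * r)) 0 (a *: xi).
Proof.
move=> /has_velocity_left[hc hv].
have dl : is_derive (0 : R) 1 (fun r : R => a * r) a.
  have := is_deriveZ a (is_derive_id (0 : R) 1).
  by rewrite /GRing.scale /= mulr1.
apply/has_velocity_left; split.
  apply: (@continuous_comp _ _ _ (fun r => a * r) h); last by rewrite mulr0.
  exact: is_derive_continuous dl.
move: hv => [/derivable1_diffP dh hE]; rewrite mulr0.
have dh' : differentiable (fun s => phi ((h 0)^-1 * h s)%g) (a * 0) by rewrite mulr0.
have := is_derive_diff dl dh'; rewrite mulr0.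
have -> // : 'd (fun s => phi ((h 0)^-1 * h s)%g) (0 : R) a = a *: xi.
by rewrite -{1}[a]mulr1 -[a * 1]/(a *: 1) linearZ -deriveE // hE.
Qed.

(** The curve is [psi] of a solution of [x' = LT x xi]. The equation is solved with a retraction
    onto a ball, which the solution may leave, so only short times are obtained. *)
Lemma local_flow (xi : 'cV[R]_n) : exists2 e : R, 0 < e &
  exists gamma : R -> G, gamma 0 = 1%g /\
    forall t, `|t| < e -> has_velocity gamma t xi.
Proof.
pose Phi x := LT x xi.
have sPhi : sdiff Phi x0.
  by apply: left_translate_comp_sdiff => //; [exact: sdiff_id|exact: sdiff_cst].
have [K K0 [d d0 PhiK]] := sdiff_lipschitz sPhi.
have /near_normP[d' d'0 cod] := @near_x0_cod _ _ G.
pose r := Num.min d d' / 2; have m0 : 0 < Num.min d d' by rewrite lt_min d0.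
have r0 : 0 < r by rewrite divr_gt0.
have rd : r < d.
  have : Num.min d d' <= d by rewrite ge_min lexx.
  by rewrite /r; lra.
have rd' : r < d'.
  have : Num.min d d' <= d' by rewrite ge_min lexx orbT.
  by rewrite /r; lra.
have [pi [pi1 pi2 pi3]] := box_retraction x0 (ltW r0).
have FK (t : R) x y : `|Phi (pi x) - Phi (pi y)| <= K * `|x - y|.
  apply: le_trans (PhiK _ _ _ _) _; try exact: le_lt_trans (pi2 _) rd.
  by rewrite ler_wpM2l // ltW.
have Fc : continuous (fun z : R * 'cV[R]_n => Phi (pi z.2)).
  move=> z; have sc : {for z, continuous (@snd R 'cV[R]_n)} by exact: cvg_snd.
  apply: (@continuous_comp _ _ _ snd (fun x => Phi (pi x))) => //.
  exact: (lipschitz_continuous K0 (FK 0)).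
have [||x xx0 [xc dx]] := @picard_lindelof R n (fun _ x => Phi (pi x)) K 0 (-1) 1 x0 K0 _ _ Fc FK.
- by rewrite lerN10.
- exact: ler01.
have near_r : \forall t \near (0 : R), `|x t - x0| < r.
  by have := continuous_near_dist (xc 0) r0; rewrite xx0.
have /near_normP[e e0 He] := near_r.
exists (Num.min e 1); first by rewrite lt_min e0 ltr01.
exists (fun t => psi (x t)); split=> [|t]; first by rewrite xx0 psi_x0.
rewrite lt_min => /andP[te t1].
have xtr : `|x t - x0| < r by apply: He; rewrite subr0.
have := @has_velocity_mul_psi _ _ G (fun=> 1%g) x t xi 0 (has_velocity_cst 1%g t).
rewrite right_translate0 subr0 => H.
have : has_velocity (fun s => 1 * psi (x s))%g t xi.
  apply: H; first by apply: cod; exact: lt_trans rd'.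
  by have := dx t; rewrite pi3 ?ltW //; apply; rewrite -ltr_norml.
by under eq_fun do rewrite mul1g.
Qed.

Lemma velocity_unique (h k : R -> G) (xi : 'cV[R]_n) (T : R) : 0 <= T ->
  (forall t, 0 <= t <= T -> has_velocity h t xi) ->
  (forall t, 0 <= t <= T -> has_velocity k t xi) ->
  h 0 = k 0 -> h T = k T.
Proof.
move=> T0 hv kv hk0.
have vc (e : R -> G) : (forall t, 0 <= t <= T -> has_velocity e t xi) ->
    {within `[0, T], continuous e}.
  move=> ev; apply: continuous_in_subspaceT => t; rewrite inE /= in_itv /=.
  by move=> /ev[].
apply: (@trajectory_unique _ _ _ (fun=> xi) 0 T).
- by move=> p t _; exact: sdiff_cst.
- exact: vc.
- exact: vc.
- exact: hk0.
- by move=> t /andP[t0 tT]; apply: hv; rewrite !ltW.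
- by move=> t /andP[t0 tT]; apply: kv; rewrite !ltW.
- by rewrite T0 lexx.
Qed.

(** For fixed [s] the curves [gamma (s + r)] and [gamma s * gamma r] in [r] have the same velocity
    [xi] and the same start, so uniqueness gives the law for [t >= 0]. *)
Lemma local_flow_morph (xi : 'cV[R]_n) : exists2 e : R, 0 < e &
  exists2 gamma : R -> G, has_velocity gamma 0 xi &
    forall s t, `|s| + `|t| < e -> gamma (s + t) = (gamma s * gamma t)%g.
Proof.
have [e e0 [gamma [g1 gv]]] := local_flow xi.
exists (e / 2); first by rewrite divr_gt0.
exists gamma; first by apply: gv; rewrite normr0.
have pos s t : 0 <= t -> `|s| + t < e -> gamma (s + t) = (gamma s * gamma t)%g.
  move=> t0 ste; apply: (@velocity_unique (fun r => gamma (s + r)) (fun r => gamma s * gamma r)%g xi t t0).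
  - move=> r /andP[r0 rt]; apply: has_velocity_shift; apply: gv.
    by apply: le_lt_trans (ler_normD _ _) _; rewrite (ger0_norm r0); lra.
  - move=> r /andP[r0 rt]; apply: has_velocity_mull; apply: gv.
    by rewrite (ger0_norm r0); have := normr_ge0 s; lra.
  - by rewrite addr0 g1 mulg1.
move=> s t ste; have [t0|t0] := leP 0 t.
  by apply: pos => //; move: ste; rewrite (ger0_norm t0); have := normr_ge0 s; lra.
(* For [t < 0] the law is applied to [s + t] and [- t]. This requires [|s + t| + |t| < e], whence
   the radius [e / 2]. *)
move: ste; rewrite (ltr0_norm t0) => ste; have s0 := normr_ge0 s.
have h1 : gamma s = (gamma (s + t)%R * gamma (- t)%R)%g.
  rewrite -pos ?addrK //; first by lra.
  by have := ler_normD s t; rewrite (ltr0_norm t0); lra.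
have h2 : gamma 0 = (gamma t * gamma (- t)%R)%g.
  by rewrite -pos ?subrr //; [lra|rewrite ltr0_norm //; lra].
move: h2; rewrite g1 => /esym h2; rewrite h1 -mulgA.
have -> : gamma t = (gamma (- t)%R)^-1%g by apply: (mulIg (gamma (- t)%R)); rewrite h2 mulVg.
by rewrite mulgV mulg1.
Qed.
End OneParameter.

(** The extension is [g (t / N) ^+ N] for any [N] that makes [t / N] small; two choices of [N] both
    agree with their product. Additivity follows because the values of [g] at the small arguments
    [s / M] and [t / M] commute. *)
Lemma local_morph_extend (R : realType) (H : groupType) (e : R) (g : R -> H) :
  0 < e ->
  (forall s t, `|s| + `|t| < e -> g (s + t) = (g s * g t)%g) ->
  exists2 h : R -> H, (forall s t, h (s + t) = (h s * h t)%g) &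
    forall t, `|t| < e -> h t = g t.
Proof.
move=> e0 gD.
have g0 : g 0 = 1%g.
  by apply: (mulgI (g 0)); rewrite -gD ?addr0 ?mulg1 // normr0 addr0.
have gX m s : `|s| * m%:R < e -> g (s *+ m) = (g s ^+ m)%g.
  elim: m => [|m IH] sm; first by rewrite mulr0n.
  have sm' : `|s| * m%:R + `|s| < e by move: sm; rewrite -natr1; lra.
  rewrite mulrSr gD; last by rewrite normrMn -mulr_natr.
  by rewrite IH ?expgSr //; have := normr_ge0 s; lra.
have gdiv (t : R) N M : (0 < N)%N -> (0 < M)%N -> `|t| < N%:R * e ->
    (g (t / N%:R)%R ^+ N)%g = (g (t / (N * M)%:R)%R ^+ (N * M))%g.
  move=> N0 M0 tN; have N0' : 0 < N%:R :> R by rewrite ltr0n.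
  have M0' : 0 < M%:R :> R by rewrite ltr0n.
  have tE : t / N%:R = (t / (N * M)%:R) *+ M.
    by rewrite -mulr_natr natrM; field; rewrite !gt_eqF.
  have small : `|t / (N * M)%:R| * M%:R < e.
    rewrite normrM normfV (ger0_norm (ler0n _ _)) natrM.
    rewrite (_ : `|t| / (N%:R * M%:R) * M%:R = `|t| / N%:R); last by field; rewrite !gt_eqF.
    by rewrite ltr_pdivrMr // mulrC.
  by rewrite {1}tE gX // -expgnA mulnC.
pose N (t : R) := (Num.bound (`|t| / e)).+1.
have NP t : `|t| < (N t)%:R * e.
  rewrite -ltr_pdivrMr // /N -natr1; apply: lt_trans (archi_boundP _) _.
    by rewrite divr_ge0 // ltW.
  by rewrite ltrDl.
pose h t := (g (t / (N t)%:R)%R ^+ (N t))%g.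
have hE t M : (0 < M)%N -> `|t| < M%:R * e -> h t = (g (t / M%:R)%R ^+ M)%g.
  by move=> M0 tM; rewrite /h (gdiv t (N t) M) // (gdiv t M (N t)) // mulnC.
exists h => [s t|t te]; last first.
  by rewrite (hE t 1%N) ?mul1r // divr1 expg1.
pose M := N (`|s| + `|t|).
have M0 : 0 < M%:R :> R by rewrite ltr0n.
have stM : `|s| + `|t| < M%:R * e.
  by have := NP (`|s| + `|t|); rewrite ger0_norm // addr_ge0.
have sM : `|s| < M%:R * e by have := normr_ge0 t; lra.
have tM : `|t| < M%:R * e by have := normr_ge0 s; lra.
have st : `|s / M%:R| + `|t / M%:R| < e.
  by rewrite !normrM normfV (gtr0_norm M0) -mulrDl ltr_pdivrMr // mulrC.
rewrite (hE (s + t) M) // ?(hE s M) // ?(hE t M) //; last first.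
  exact: le_lt_trans (ler_normD _ _) stM.
rewrite mulrDl gD // expgMn // /commute -gD // addrC gD //.
by rewrite addrC.
Qed.

Section Exponential.
Context {R : realType} {n : nat} {G : lieGroupType R n}.
Implicit Types (p q : G) (a b c : chart R n G).

Local Notation phi := (chart_map (id_chart G)).
Local Notation psi := (chart_inv (id_chart G)).
Local Notation x0 := (phi 1%g).

Lemma one_param_subgroup_exists (xi : 'cV[R]_n) :
  exists gamma : R -> G, one_param_subgroup xi gamma.
Proof.
have [e e0 [g gv gD]] := @local_flow_morph _ _ G xi.
have [h hD hg] := local_morph_extend e0 gD.
exists h; split => //; apply: near_eq_has_velocity gv.
by apply/near_normP; exists e => // t; rewrite subr0 => /hg.
Qed.

Lemma one_param_subgroup_velocity (xi : 'cV[R]_n) (gamma : R -> G) (t : R) :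
  one_param_subgroup xi gamma -> has_velocity gamma t xi.
Proof.
move=> [gD gv]; have v : has_velocity (fun r => gamma (- t + r)) t xi.
  by apply: has_velocity_shift; rewrite addNr.
have := has_velocity_mull (gamma t) v; apply: near_eq_has_velocity.
by near=> r; rewrite -gD addrA subrr add0r.
Unshelve. all: by end_near. Qed.

Lemma one_param_subgroup0 (xi : 'cV[R]_n) (gamma : R -> G) :
  one_param_subgroup xi gamma -> gamma 0 = 1%g.
Proof. by move=> [gD _]; apply: (mulgI (gamma 0)); rewrite -gD addr0 mulg1. Qed.

(** [lie_exp] selects a one-parameter subgroup by choice. The subgroup with a given velocity is
    unique, so the selection is immaterial and any [gamma] at hand computes it. *)
Lemma lie_exp_scale (xi : 'cV[R]_n) (gamma : R -> G) (s : R) :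
  one_param_subgroup xi gamma -> lie_exp (s *: xi) = gamma s.
Proof.
move=> og; have og' : one_param_subgroup (s *: xi) (fun r => gamma (s * r)).
  split=> [r t|]; first by rewrite mulrDr og.1.
  exact: has_velocity_scale og.2.
have : exists p, [set p | exists2 k : R -> G, one_param_subgroup (s *: xi) k & p = k 1] p.
  by exists (gamma (s * 1)); exists (fun r => gamma (s * r)).
move=> /(xgetPex 1%g)[k ok]; rewrite -/(lie_exp (s *: xi)) => ->.
rewrite -[in RHS](mulr1 s).
apply: (@velocity_unique _ _ _ k (fun r => gamma (s * r)) (s *: xi) 1).
- exact: ler01.
- by move=> t _; exact: one_param_subgroup_velocity.
- by move=> t _; exact: one_param_subgroup_velocity og'.
- by rewrite (one_param_subgroup0 ok) mulr0 (one_param_subgroup0 og).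
Qed.

(** The subgroup generated by [eta] leaves the identity with coordinate velocity [eta]. This makes
    [lieD] an ordinary differential at [x0], and in particular linear in [eta]. *)
Lemma lieDE (W : normedModType R) (F : G -> W) p (eta : 'cV[R]_n) :
  differentiable (fun x => F (p * psi x)%g) x0 ->
  lieD F p eta = 'd (fun x => F (p * psi x)%g) x0 eta.
Proof.
move=> dF; have [gamma og] := @one_param_subgroup_exists eta.
rewrite /lieD; under eq_fun do rewrite (lie_exp_scale _ og).
have g0 := one_param_subgroup0 og.
have [gc /(_ _ id_chart_atlas)] := og.2; rewrite g0 left_translate1 => /(_ id_chart_dom) dg.
have dF' : differentiable (fun x => F (p * psi x)%g) ((phi \o gamma) 0) by rewrite /= g0.
have := is_derive_diff dg dF'; rewrite /= g0 => H.
have : is_derive (0 : R) 1 (fun s => F (p * gamma s)%g) ('d (fun x => F (p * psi x)%g) x0 eta).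
  apply: near_eq_is_derive H.
  have near_dom : \forall s \near (0 : R), chart_dom (id_chart G) (gamma s).
    by apply: (gc _); rewrite g0; apply: nbhs_chart_dom; exact: id_chart_dom.
  by apply: filterS near_dom => s sd; rewrite chart_mapK.
by case.
Qed.
End Exponential.

(** * The Lie bracket *)

Lemma differentiable_scale (R : realType) (V W : normedModType R) (k : V -> R)
    (f : V -> W) (x : V) : differentiable k x -> differentiable f x ->
  differentiable (fun y => k y *: f y) x.
Proof.
move=> dk df; have [[ds _] _] := scale_sdiff (k x, f x).
exact: (diff_fun_comp (differentiable_pair dk df) ds).1.
Qed.

Lemma diff_sum_fun (R : realType) (V W : normedModType R) (I : Type) (r : seq I)
    (f : I -> V -> W) (x : V) : (forall i, differentiable (f i) x) ->
  differentiable (fun y => \sum_(i <- r) f i y) x /\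
  forall h, 'd (fun y => \sum_(i <- r) f i y) x h = \sum_(i <- r) 'd (f i) x h.
Proof.
move=> df; elim: r => [|i r [d IH]].
  under eq_fun do rewrite big_nil; split=> [|h]; first exact: differentiable_cst.
  by rewrite big_nil diff_cst.
under eq_fun do rewrite big_cons; split=> [|h]; first exact: differentiableD.
rewrite big_cons -IH; exact: (diffDE h (df i) d).
Qed.

Lemma diff_coord (R : realType) (V : normedModType R) m n (f : V -> 'M[R]_(m, n))
  (x h : V) i j : differentiable f x ->
  'd (fun y => f y i j) x h = 'd f x h i j.
Proof.
move=> df; have dij : differentiable (fun y => f y i j) x.
  have dc := @differentiable_coord R m n (f x) i j.
  exact: (diff_fun_comp df dc).1.
rewrite -deriveE // -deriveE // derive_mx ?mxE //.
exact: diff_derivable.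
Qed.

Section Bracket.
Context {R : realType} {n : nat} {G : lieGroupType R n}.
Implicit Types (p q : G) (xi eta : 'cV[R]_n).

Local Notation phi := (chart_map (id_chart G)).
Local Notation psi := (chart_inv (id_chart G)).
Local Notation x0 := (phi 1%g).
Local Notation LT x := (left_translate (id_chart G) (psi x)).
Local Notation RT := (@right_translate R n G).

Lemma LT_x0 xi : LT x0 xi = xi.
Proof. by rewrite psi_x0 left_translate1. Qed.

Lemma LT_differentiable eta : differentiable (fun x => LT x eta) x0.
Proof.
by have [] := @left_translate_comp_sdiff _ _ _ _ _ (cst eta) x0 erefl (sdiff_id x0) (sdiff_cst eta x0).
Qed.

(** Left translation by [psi x] carries the direction [eta] at [x0] to a direction at [x], so
    derivatives at all nearby base points are read off one function of coordinates. *)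
Lemma lieD_near (W : normedModType R) (F : G -> W) p eta :
  C2_at (fun x => F (p * psi x)%g) x0 ->
  \forall x \near x0, lieD F (p * psi x)%g eta =
    'd (fun x => F (p * psi x)%g) x (LT x eta).
Proof.
move=> [dF _]; near=> x.
have xc : chart_cod (id_chart G) x by near: x; exact: near_x0_cod.
have dFx : differentiable (fun x => F (p * psi x)%g) x by near: x.
have [dK _] := left_chart_sdiff id_chart_atlas (psi_dom xc).
have Kx0 : phi (psi x * psi x0)%g = x by rewrite psi_x0 mulg1 chart_invK.
have dFK : differentiable (fun x => F (p * psi x)%g) (phi (psi x * psi x0)%g) by rewrite Kx0.
have [dc dcE] := diff_fun_comp dK dFK.
have near_E : \forall y \near x0, F (p * psi (phi (psi x * psi y)))%g = F (p * psi x * psi y)%g.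
  by apply: filterS (near_left_dom (psi_dom xc)) => y yd; rewrite chart_mapK // mulgA.
have [d1 d1E] := diff_near_eq near_E dc.
have LE : LT x eta = 'd (fun y => phi (psi x * psi y)%g) x0 eta := deriveE eta dK.
apply: etrans (lieDE eta d1) (etrans (d1E eta) (etrans (dcE eta) _)).
exact: (f_equal2 (fun z v => 'd (fun x => F (p * psi x)%g) z v) Kx0 (esym LE)).
Unshelve. all: by end_near. Qed.

(** In this product rule one term differentiates the translated direction. The other is a second
    derivative of [F], symmetric in [xi] and [eta], and will cancel in the commutator. *)
Lemma lieD_lieD (W : normedModType R) (F : G -> W) p xi eta :
  C2_at (fun x => F (p * psi x)%g) x0 ->
  lieD (fun q => lieD F q eta) p xi =
    'd (fun x => F (p * psi x)%g) x0 ('D_xi (fun x => LT x eta) x0) +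
    'D_eta ('D_xi (fun x => F (p * psi x)%g)) x0.
Proof.
move=> cF; have [dF sF] := cF; set F1 := (fun x => F _) in cF dF sF *.
pose E (i : 'I_n) x := LT x eta i 0 *: 'D_(delta_mx i 0) F1 x.
have dL := LT_differentiable eta.
have dLi i : differentiable (fun x => LT x eta i 0) x0.
  have dc := @differentiable_coord R n 1 (LT x0 eta) i 0.
  exact: (diff_fun_comp dL dc).1.
have dDi i : differentiable ('D_(delta_mx i 0) F1) x0 by case: (sF (delta_mx i 0)).
have dE i : differentiable (E i) x0.
  exact: differentiable_scale (dLi i) (dDi i).
have [dS dSE] := @diff_sum_fun _ _ _ _ (index_enum 'I_n) E x0 dE.
have near_E : \forall x \near x0, \sum_i E i x = lieD F (p * psi x)%g eta.
  near=> x; have -> : lieD F (p * psi x)%g eta = 'd F1 x (LT x eta) by near: x; exact: lieD_near.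
  have dFx : differentiable F1 x by near: x.
  exact: esym (diff_cV_coord (LT x eta) dFx).
have [dN dNE] := diff_near_eq near_E dS.
apply: etrans (lieDE xi dN) (etrans (dNE xi) (etrans (dSE xi) _)).
have DE i : 'd (E i) x0 xi = ('D_xi (fun x => LT x eta) x0) i 0 *: 'D_(delta_mx i 0) F1 x0 +
    eta i 0 *: 'D_(delta_mx i 0) ('D_xi F1) x0.
  rewrite /E (diff_scale xi (dLi i) (dDi i)) (diff_coord xi i 0 dL) LT_x0.
  by rewrite -(deriveE xi dL) -(deriveE xi (dDi i)) (schwarz (delta_mx i 0) xi cF).
under eq_bigr do rewrite DE.
rewrite big_split /= -(diff_cV_coord _ (nbhs_singleton dF)).
have dxi : differentiable ('D_xi F1) x0 by case: (sF xi).
exact: (f_equal2 +%R erefl (esym (etrans (deriveE eta dxi) (diff_cV_coord eta dxi)))).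
Unshelve. all: by end_near. Qed.

Lemma lie_bracketE xi eta :
  lie_bracket (G := G) xi eta =
  'D_xi (fun x => LT x eta) x0 - 'D_eta (fun x => LT x xi) x0.
Proof.
set zeta := _ - _.
pose P z := forall (U : set G) (F : G -> R), open U -> smooth_on U F ->
  forall p, U p -> lieD F p z = lieD (fun q => lieD F q eta) p xi
                    - lieD (fun q => lieD F q xi) p eta.
have Pz : P zeta.
  move=> U F oU sF p Up.
  have cF : C2_at (fun x => F (p * psi x)%g) x0.
    exact: (@Ck_on_left_C2 _ _ _ R^o 0 U F p oU Up (sF 2)).
  have dF := nbhs_singleton cF.1.
  have e1 := lieD_lieD xi eta cF; have e2 := lieD_lieD eta xi cF.
  rewrite (schwarz xi eta cF) in e1.
  apply: etrans (lieDE zeta dF) (esym (etrans (f_equal2 (fun a b => a - b) e1 e2) _)).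
  have alg (A B : 'cV[R]_n) (C : R) : 'd (fun x => F (p * psi x)%g) x0 A + C -
      ('d (fun x => F (p * psi x)%g) x0 B + C) = 'd (fun x => F (p * psi x)%g) x0 (A - B).
    by rewrite linearB opprD addrACA subrr addr0.
  exact: alg.
(* The choice in [lie_bracket] is pinned down by testing with the coordinates of the chart at the
   identity. They are known to be smooth only on its domain, so the test functions have to be
   local. *)
have Pu z : P z -> z = zeta.
  move=> Pz'; apply/colP => i.
  pose F q : R := phi q i 0.
  have sF : smooth_on (chart_dom (id_chart G)) (F : G -> R^o).
    move=> k c cG; have := lie_atlas_compat _ _ cG id_chart_atlas k.
    apply: Ck_coord.
    rewrite openE => x [xc xd]; apply: filterI.
      by apply: open_nbhs_nbhs; split => //; exact: chart_cod_open.
    have ic : {for x, continuous (chart_inv c)} by exact: chart_inv_continuous.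
    by apply: (ic _); exact: nbhs_chart_dom.
  have := Pz' _ _ (@chart_dom_open _ _ _ _) sF _ id_chart_dom.
  rewrite -(Pz _ _ (@chart_dom_open _ _ _ _) sF _ id_chart_dom).
  have near_id : \forall x \near x0, (x : 'cV[R]_n) i 0 = F (1 * psi x)%g.
    by apply: filterS near_phiK => x xE; rewrite /F mul1g xE.
  have [dF dFE] := diff_near_eq near_id (@differentiable_coord R n 1 x0 i 0).
  have [di diE] := is_diff_id x0.
  have idE v : 'd id x0 v = v := congr1 (fun A : 'cV[R]_n -> 'cV[R]_n => A v) diE.
  have Fv v : lieD F 1%g v = v i 0.
    apply: etrans (@lieDE _ _ _ _ F 1%g v dF) _; apply: etrans (dFE v) _.
    apply: etrans (diff_coord v i 0 di) _; exact: (congr1 (fun w : 'cV[R]_n => w i 0) (idE v)).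
  by move=> E; exact: etrans (esym (Fv z)) (etrans E (Fv zeta)).
by apply: Pu; rewrite /lie_bracket; apply: (xgetPex 0); exists zeta.
Qed.

(** Both sides are mixed second derivatives of the multiplication at the identity, taken in opposite
    orders. *)
Lemma right_translate_derive xi eta :
  'D_eta (fun x => RT x xi) x0 = 'D_xi (fun x => LT x eta) x0.
Proof.
have cm := @mul_chart1_C2 _ _ G.
pose m z := phi (psi z.1 * psi z.2)%g.
have RE : (fun x => RT x xi) = (fun x => 'D_(xi, 0) m (x0, x)).
  by apply/funext => x; exact: (derive_pairl m).
have LE : (fun x => LT x eta) = (fun x => 'D_(0, eta) m (x, x0)).
  by apply/funext => x; exact: (derive_pairr m).
rewrite RE LE; apply: etrans (derive_pairr ('D_(xi, 0) m) x0 x0 eta) _.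
apply: etrans _ (esym (derive_pairl ('D_(0, eta) m) x0 x0 xi)).
exact: schwarz cm.
Qed.
End Bracket.

(** * Strict differentiability uniform in time *)

Section UniformLinearization.
Context {R : realType}.
Implicit Types U V W : normedModType R.

Lemma near_pairI U V (u : U) (v : V) (P : U -> Prop) (Q : V -> Prop) :
  (\forall x \near u, P x) -> (\forall y \near v, Q y) ->
  \forall z \near (u, v), P z.1 /\ Q z.2.
Proof.
move=> Pu Qv.
have fc : {for (u, v), continuous (@fst U V)} by exact: cvg_fst.
have sc : {for (u, v), continuous (@snd U V)} by exact: cvg_snd.
have h1 : \forall z \near (u, v), P z.1 := fc _ Pu.
have h2 : \forall z \near (u, v), Q z.2 := sc _ Qv.
by apply: filterI.
Qed.

Lemma diff_pairr U V (u : U) (x h : V) : 'd (fun y => (u, y)) x h = (0, h).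
Proof.
have [di diE] := is_diff_id x.
have E := congr1 (fun A : V -> U * V => A h) (diff_pair (differentiable_cst u x) di).
apply: etrans E _; rewrite diff_cst.
exact: (congr1 (fun A : V -> V => (0, A h)) diE).
Qed.

(** For all times [s] near [t] the estimate uses the differential at [t]. This replaces a separate
    condition on how the differential varies with time, and asks only for continuity of [E] in
    time. *)
Definition unif_sdiff V W (E : R -> V -> W) (x0 : V) (t : R) :=
  [/\ differentiable (E t) x0,
    forall e : R, 0 < e -> exists2 d : R, 0 < d & \forall s \near t,
      forall x y, `|x - x0| < d -> `|y - x0| < d ->
        `|E s x - E s y - 'd (E t) x0 (x - y)| <= e * `|x - y| &
    exists2 d : R, 0 < d & \forall s \near t, forall x, `|x - x0| < d ->
      {for (s, x), continuous (fun z : R * V => E z.1 z.2)}].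

(** Strictness of [H] is applied to two points with the same first component [y s], so that
    component drops out of the increments and continuity of [y] suffices. *)
Lemma unif_sdiff_param U V W (H : U * V -> W) (y : R -> U) (E : R -> V -> W)
    (x0 : V) (t : R) : (\forall s \near t, {for s, continuous y}) ->
  sdiff H (y t, x0) ->
  (exists2 d : R, 0 < d & \forall s \near t, forall x, `|x - x0| < d ->
     E s x = H (y s, x)) ->
  unif_sdiff E x0 t.
Proof.
move=> yc sH [d d0 EH].
have sHt : sdiff (fun x => H (y t, x)) x0 := sdiff_comp (sdiff_pairr (y t) x0) sH.
have near_E : \forall x \near x0, H (y t, x) = E t x.
  apply/near_normP; exists d => // x xd.
  by rewrite (nbhs_singleton EH).
have [dE dEE] := diff_near_eq near_E sHt.1.
have dEv v : 'd (E t) x0 v = 'd H (y t, x0) (0, v).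
  rewrite dEE; have [dp _] := sdiff_pairr (y t) x0.
  have [_ ->] := diff_fun_comp dp sH.1; congr ('d _ _ _).
  exact: diff_pairr.
have yn (m : R) : 0 < m -> \forall s \near t, `|y s - y t| < m.
  by move=> m0; exact: (continuous_near_dist (nbhs_singleton yc) m0).
split=> // [e e0|].
  have [_ /(_ e e0)[d' d'0 He]] := sH.
  exists (Num.min d d'); first by rewrite lt_min d0.
  near=> s => x z; rewrite !lt_min => /andP[xd xd'] /andP[zd zd'].
  have ys : `|y s - y t| < d' by near: s; exact: yn.
  have EHs : forall x, `|x - x0| < d -> E s x = H (y s, x) by near: s.
  rewrite !EHs // dEv; have := He (y s, x) (y s, z).
  rewrite !prod_normE /= !gt_max ys xd' zd' => /(_ isT isT).
  have -> : (y s, x) - (y s, z) = (0, x - z) :> U * V.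
    by apply: injective_projections; rewrite /= ?subrr.
  by rewrite /= subrr normr0 max_r.
have /near_normP[d' d'0 Hc] := sdiff_near_continuous sH.
exists (Num.min d d'); first by rewrite lt_min d0.
have EH' := near_join EH.
near=> s => x; rewrite lt_min => /andP[xd xd'].
have ys : `|y s - y t| < d' by near: s; exact: yn.
have ycs : {for s, continuous y} by near: s.
have Hcs : {for (y s, x), continuous H}.
  by apply: Hc; rewrite prod_normE /= gt_max ys.
have EHs : \forall s' \near s, forall x, `|x - x0| < d -> E s' x = H (y s', x) by near: s.
have xn : \forall x' \near x, `|x' - x0| < d.
  apply/near_normP; exists (d - `|x - x0|); first by rewrite subr_gt0.
  move=> x' xx'; rewrite -(subrK x x') -addrA; apply: le_lt_trans (ler_normD _ _) _.
  by lra.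
have HC : {for (s, x), continuous (fun z : R * V => H (y z.1, z.2))}.
  apply: (@continuous_comp _ _ _ (fun z : R * V => (y z.1, z.2)) H) => //.
  apply: continuous_pair; last exact: cvg_snd.
  by apply: (@continuous_comp _ _ _ fst y); [exact: cvg_fst|exact: ycs].
move: HC; rewrite /prop_for /continuous_at /= -(nbhs_singleton EHs) // => HC.
apply: cvg_trans HC; apply: near_eq_cvg.
by apply: filterS (near_pairI EHs xn) => z [h1 h2]; rewrite h1.
Unshelve. all: by end_near. Qed.

Lemma compact_uniform (P : R -> R -> Prop) (a b : R) :
  (forall d d' t, 0 < d' -> d' <= d -> P d t -> P d' t) ->
  (forall t, a <= t <= b -> exists2 d : R, 0 < d & \forall s \near t, P d s) ->
  exists2 d : R, 0 < d & forall t, a <= t <= b -> P d t.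
Proof.
move=> Pd Pt.
have /compact_near_coveringP/(_ R (0 : R)^'+ P _) : compact `[a, b]%classic by exact: segment_compact.
move=> []; last first.
  move=> d /= d0 H; exists (d / 2); first by rewrite divr_gt0.
  move=> t tab; apply: (H (d / 2)) => /=.
  - by rewrite sub0r normrN gtr0_norm ?divr_gt0 //; lra.
  - by rewrite divr_gt0.
  - by rewrite in_itv.
move=> t /=; rewrite in_itv /= => /Pt[d d0 H].
exists ([set s | P d s], [set e | 0 < e /\ e <= d]).
  split => //=; near=> e; split; near: e; first exact: nbhs_right_gt.
  exact: nbhs_right_le.
by move=> [s e] /= [Ps [e0 ed]]; exact: Pd Ps.
Unshelve. all: by end_near. Qed.

(** The single number [d] is the radius and, inverted, the Lipschitz constant: both conditions
    weaken as [d] decreases, which is the monotonicity that [compact_uniform] asks for. *)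
Lemma unif_sdiff_lipschitz V W (E : R -> V -> W) (x0 : V) (a b : R) :
  (forall t, a <= t <= b -> unif_sdiff E x0 t) ->
  exists2 d : R, 0 < d & forall t, a <= t <= b ->
    (forall x y, `|x - x0| < d -> `|y - x0| < d ->
      `|E t x - E t y| <= d^-1 * `|x - y|) /\
    (forall x, `|x - x0| < d ->
      {for (t, x), continuous (fun z : R * V => E z.1 z.2)}).
Proof.
move=> HE; apply: (@compact_uniform (fun d t =>
   (forall x y, `|x - x0| < d -> `|y - x0| < d ->
      `|E t x - E t y| <= d^-1 * `|x - y|) /\
    (forall x, `|x - x0| < d ->
      {for (t, x), continuous (fun z : R * V => E z.1 z.2)}))).
  move=> d d' t d'0 d'd [H1 H2]; split=> [x y xd yd|x xd].
    apply: le_trans (H1 x y _ _) _; try exact: lt_le_trans d'd.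
    by rewrite ler_wpM2r // lef_pV2 // posrE // (lt_le_trans d'0).
  by apply: H2; exact: lt_le_trans d'd.
move=> t /HE[dE /(_ 1 ltr01)[d1 d10 H1] [d2 d20 H2]].
have [K K0 EK] := diff_bound dE.
have K1 : 0 < (K + 1)^-1 by rewrite invr_gt0 addr_gt0.
exists (Num.min (Num.min d1 d2) (K + 1)^-1); first by rewrite !lt_min d10 d20.
near=> s; split=> [x y|x].
  rewrite !lt_min => /andP[/andP[x1 _] _] /andP[/andP[y1 _] _].
  have H1s : forall x y, `|x - x0| < d1 -> `|y - x0| < d1 ->
        `|E s x - E s y - 'd (E t) x0 (x - y)| <= 1 * `|x - y| by near: s.
  rewrite -(subrK ('d (E t) x0 (x - y)) (E s x - E s y)).
  apply: le_trans (ler_normD _ _) _; apply: le_trans (lerD (H1s _ _ x1 y1) (EK _)) _.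
  rewrite -mulrDl ler_wpM2r // addrC -{1}[K + 1]invrK lef_pV2 ?posrE //.
    by rewrite ge_min lexx orbT.
  by rewrite !lt_min d10 d20.
rewrite !lt_min => /andP[/andP[_ x2] _].
by move: x x2; near: s.
Unshelve. all: by end_near. Qed.

Lemma unif_sdiff_linearization V W (E : R -> V -> W) (x0 : V) (a b : R) :
  (forall t, a <= t <= b -> unif_sdiff E x0 t) -> forall e : R, 0 < e ->
  exists2 d : R, 0 < d & forall t, a <= t <= b ->
    forall x, `|x - x0| < d ->
      `|E t x - E t x0 - 'd (E t) x0 (x - x0)| <= e * `|x - x0|.
Proof.
move=> HE e e0.
(* Membership in [[a, b]] is repeated inside the predicate, since the neighbours of an endpoint may
   lie outside the interval. *)
have [d d0 Hd] : exists2 d : R, 0 < d & forall t, a <= t <= b -> a <= t <= b ->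
    forall x, `|x - x0| < d ->
      `|E t x - E t x0 - 'd (E t) x0 (x - x0)| <= e * `|x - x0|; last first.
  by exists d => // t tab; exact: Hd.
apply: (@compact_uniform (fun d t => a <= t <= b ->
    forall x, `|x - x0| < d ->
      `|E t x - E t x0 - 'd (E t) x0 (x - x0)| <= e * `|x - x0|)).
  by move=> d d' t d'0 d'd H tab x xd; apply: H => //; exact: lt_le_trans d'd.
(* One third of [e] pays for the expansion with the differential at [t], and two thirds for
   replacing that differential by the one at [s]. *)
move=> t /HE[dE /(_ (e / 3) (divr_gt0 e0 (ltr0Sn _ 2)))[d1 d10 H1] _].
exists d1 => //; near=> s => /HE [dEs /(_ (e / 3) (divr_gt0 e0 (ltr0Sn _ 2)))[d2 d20 /nbhs_singleton H2] _].
have H1s : forall x y, `|x - x0| < d1 -> `|y - x0| < d1 ->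
    `|E s x - E s y - 'd (E t) x0 (x - y)| <= e / 3 * `|x - y| by near: s.
have x00 : `|x0 - x0| < d1 by rewrite subrr normr0.
have x00' : `|x0 - x0| < d2 by rewrite subrr normr0.
(* The two linearizations at [s] and [t] agree on small vectors, hence by
   homogeneity on all of them. *)
have Est v : `|'d (E s) x0 v - 'd (E t) x0 v| <= 2 * (e / 3) * `|v|.
  have [->|v0] := eqVneq v 0; first by rewrite !linear0 addr0 !normr0 mulr0.
  have v0' : 0 < `|v| by rewrite normr_gt0.
  pose m := Num.min d1 d2 / 2 / `|v|.
  have m12 : 0 < Num.min d1 d2 by rewrite lt_min d10.
  have m0 : 0 < m by rewrite !divr_gt0.
  have mv : `|m *: v| < Num.min d1 d2.
    by rewrite normrZ gtr0_norm // /m divfK ?gt_eqF //; lra.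
  move: mv; rewrite lt_min => /andP[mv1 mv2].
  have mE : m *: v = x0 + m *: v - x0 by rewrite addrC addKr.
  rewrite mE in mv1 mv2.
  have h1 := H1s (x0 + m *: v) x0 mv1 x00; have h2 := H2 (x0 + m *: v) x0 mv2 x00'.
  have lt : 'd (E t) x0 (m *: v) = m *: 'd (E t) x0 v by rewrite linearZ.
  have ls : 'd (E s) x0 (m *: v) = m *: 'd (E s) x0 v by rewrite linearZ.
  rewrite -mE lt in h1; rewrite -mE ls in h2.
  have : `|m *: ('d (E s) x0 v - 'd (E t) x0 v)| <= m * (2 * (e / 3) * `|v|).
    rewrite scalerBr.
    have := ler_normB (E s (x0 + m *: v) - E s x0 - m *: 'd (E t) x0 v)
      (E s (x0 + m *: v) - E s x0 - m *: 'd (E s) x0 v).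
    rewrite opprB addrC addrA subrK => /le_trans; apply.
    apply: le_trans (lerD h1 h2) _; rewrite normrZ (gtr0_norm m0).
    by rewrite le_eqVlt; apply/orP; left; apply/eqP; ring.
  by rewrite normrZ gtr0_norm // ler_pM2l.
move=> x xd; have h1 := H1s x x0 xd x00; have h2 := Est (x - x0).
rewrite distrC in h2.
rewrite -(subrK ('d (E t) x0 (x - x0)) (E s x - E s x0)) -addrA.
apply: le_trans (ler_normD _ _) _.
apply: le_trans (lerD h1 h2) _; rewrite -mulrDl; apply: ler_wpM2r => //; clear; lra.
Unshelve. all: by end_near. Qed.

Definition clamp (a b t : R) := Num.max a (Num.min t b).

Lemma clamp_itv (a b t : R) : a <= b -> a <= clamp a b t <= b.
Proof. by move=> ab; rewrite /clamp le_max lexx /= ge_max ab ge_min lexx orbT. Qed.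

Lemma clamp_id (a b t : R) : a <= t <= b -> clamp a b t = t.
Proof. by move=> /andP[at_ tb]; rewrite /clamp min_l // max_r. Qed.

Lemma clamp_continuous (a b : R) : continuous (clamp a b).
Proof.
move=> t; apply: (@continuous_max _ _ (cst a) (fun t => Num.min t b)).
  exact: cst_continuous.
by apply: (@continuous_min _ _ id (cst b)) => //; exact: cst_continuous.
Qed.

Lemma within_clamp_continuous (T : topologicalType) (h : R -> T) (a b : R) :
  a <= b -> {within `[a, b], continuous h} ->
  continuous (fun t => h (clamp a b t)).
Proof.
move=> ab /subspace_continuousP hc t.
have cab := clamp_itv t ab.
have hct : h s @[s --> within `[a, b] (nbhs (clamp a b t))] --> h (clamp a b t).
  by apply: hc; rewrite /= in_itv.
move=> P /hct H.
have H' : \forall s \near clamp a b t, `[a, b]%classic s -> P (h s) := H.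
have H2 : \forall s \near t, `[a, b]%classic (clamp a b s) -> P (h (clamp a b s)).
  exact: (@clamp_continuous a b t) _ H'.
change (\forall s \near t, P (h (clamp a b s))).
by apply: filterS H2 => s; apply; rewrite /= in_itv /= clamp_itv.
Qed.
End UniformLinearization.

(** * The error equation *)

Section ErrorField.
Context {R : realType} {n : nat} {G : lieGroupType R n}.
Variables (gc : R -> G) (a b : R).
Hypothesis gcc : continuous gc.

Local Notation phi := (chart_map (id_chart G)).
Local Notation psi := (chart_inv (id_chart G)).
Local Notation x0 := (phi 1%g).
Local Notation LT x := (left_translate (id_chart G) (psi x)).
Local Notation RT := (@right_translate R n G).
Local Notation cl := (clamp a b).

Let m (z : 'cV[R]_n * 'cV[R]_n) := phi (psi z.1 * psi z.2)%g.

Let m_x0 : m (x0, x0) = x0.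
Proof. by rewrite /m /= psi_x0 mul1g. Qed.

Let m_sdiff : sdiff m (x0, x0).
Proof.
apply: C2_at_sdiff mul_chart1_C2; apply: fin_coord_prod; exact: fin_coord_cV.
Qed.

Let w (t s : R) := phi ((gc t)^-1 * gc s)%g.

Let w_t t : w t t = x0.
Proof. by rewrite /w mulVg. Qed.

Let w_dom t : \forall s \near t, chart_dom (id_chart G) ((gc t)^-1 * gc s)%g.
Proof.
have c : {for t, continuous (fun s => (gc t)^-1 * gc s)%g}.
  by apply: mul_continuous; [exact: cst_continuous|exact: gcc].
by apply: (c _); rewrite mulVg; exact: nbhs_chart_dom id_chart_dom.
Qed.

Let w_continuous t : \forall s \near t, {for s, continuous (w t)}.
Proof.
apply: filterS (w_dom t) => s sd.
apply: (@continuous_comp _ _ _ (fun s => (gc t)^-1 * gc s)%g phi).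
  by apply: mul_continuous; [exact: cst_continuous|exact: gcc].
exact: chart_map_continuous.
Qed.

(** The motion of the base point from [gc t] to [gc s] is absorbed into the coordinate. With the
    base point fixed at [gc t], it enters only through the continuous curve [w t], as
    [unif_sdiff_param] requires. *)
Let w_shift t : exists2 d : R, 0 < d & \forall s \near t, forall x,
  `|x - x0| < d -> gc s = (gc t * psi (w t s))%g /\
    (gc s * psi x)%g = (gc t * psi (m (w t s, x)))%g.
Proof.
have mdom : \forall z \near (x0, x0), chart_dom (id_chart G) (psi z.1 * psi z.2)%g.
  have pc : {for x0, continuous psi} by apply: chart_inv_continuous; exact: x0_cod.
  have c : {for (x0, x0), continuous (fun z => psi z.1 * psi z.2)%g}.
    apply: mul_continuous.
      have fc : {for (x0, x0), continuous (@fst 'cV[R]_n 'cV[R]_n)} by exact: cvg_fst.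
      exact: (@continuous_comp _ _ _ fst psi (x0, x0) fc pc).
    have sc : {for (x0, x0), continuous (@snd 'cV[R]_n 'cV[R]_n)} by exact: cvg_snd.
    exact: (@continuous_comp _ _ _ snd psi (x0, x0) sc pc).
  by apply: (c _); rewrite /= psi_x0 mul1g; exact: nbhs_chart_dom id_chart_dom.
have /near_normP[d d0 H] := mdom; exists d => //.
have wn : \forall s \near t, `|w t s - x0| < d.
  by have := continuous_near_dist (nbhs_singleton (w_continuous t)) d0; rewrite w_t.
near=> s => x xd.
have ws : `|w t s - x0| < d by near: s.
have sd : chart_dom (id_chart G) ((gc t)^-1 * gc s)%g by near: s; exact: w_dom.
have gs : gc s = (gc t * psi (w t s))%g by rewrite /w chart_mapK // mulVKg.
split=> //; rewrite /m /= chart_mapK; first by rewrite mulgA -gs.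
by apply: (H (w t s, x)); rewrite prod_normE /= gt_max ws.
Unshelve. all: by end_near. Qed.

Lemma shift_unif_sdiff (W : normedModType R) (L : G -> W) t :
  (forall p, sdiff (fun x => L (p * psi x)%g) x0) ->
  unif_sdiff (fun s x => L (gc s * psi x)%g) x0 t.
Proof.
move=> sL; pose H z := L (gc t * psi (m z))%g.
apply: (@unif_sdiff_param _ _ _ _ H (w t)); first exact: w_continuous.
  rewrite w_t; apply: (@sdiff_comp _ _ _ _ (fun y => L (gc t * psi y)%g) m) => //.
  by rewrite m_x0.
have [d d0 Hd] := w_shift t; exists d => //.
by apply: filterS Hd => s sd x /sd[_ ->].
Qed.

(* If [gc] has velocity [F1] and [gc psi(x)] has velocity [F], then
   [x' = error_field F F1 t x]. Time is clamped because [F] and [F1] need not be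
   regular outside [a, b]. *)
Definition error_field (F F1 : G * R -> 'cV[R]_n) (t : R) (x : 'cV[R]_n) :=
  LT x (F (gc t * psi x, cl t)%g) - RT x (F1 (gc t, cl t)).

Definition left_sdiff (F : G * R -> 'cV[R]_n) := forall p t, a <= t <= b ->
  sdiff (fun z : 'cV[R]_n * R => F (p * psi z.1, z.2)%g) (x0, t).

Hypothesis ab : a <= b.

Lemma error_field_unif_sdiff (F F1 : G * R -> 'cV[R]_n) t :
  left_sdiff F -> left_sdiff F1 -> unif_sdiff (error_field F F1) x0 t.
Proof.
move=> sF sF1.
have sz1 (z : ('cV[R]_n * R) * 'cV[R]_n) : sdiff (fun z : ('cV[R]_n * R) * 'cV[R]_n => z.1.1) z.
  exact: (sdiff_comp (sdiff_fst z) (sdiff_fst z.1)).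
have sz2 (z : ('cV[R]_n * R) * 'cV[R]_n) : sdiff (fun z : ('cV[R]_n * R) * 'cV[R]_n => z.1.2) z.
  exact: (sdiff_comp (sdiff_fst z) (sdiff_snd z.1)).
have sz3 (z : ('cV[R]_n * R) * 'cV[R]_n) : sdiff (fun z : ('cV[R]_n * R) * 'cV[R]_n => z.2) z.
  exact: sdiff_snd.
pose Fp z := F (gc t * psi z.1, z.2)%g; pose F1p z := F1 (gc t * psi z.1, z.2)%g.
pose xi (z : ('cV[R]_n * R) * 'cV[R]_n) := Fp (m (z.1.1, z.2), z.1.2).
pose xi1 (z : ('cV[R]_n * R) * 'cV[R]_n) := F1p (z.1.1, z.1.2).
(* The parameter of [H] is the coordinate of the moving base point paired with the clamped time; the
   last component is [x]. *)
pose H (z : ('cV[R]_n * R) * 'cV[R]_n) := LT z.2 (xi z) - RT z.2 (xi1 z).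
have ct := clamp_itv t ab.
have sxi : sdiff xi ((x0, cl t), x0).
  have s1 := sdiff_pair (sz1 ((x0, cl t), x0)) (sz3 ((x0, cl t), x0)).
  have s2 := sdiff_comp s1 m_sdiff.
  have s3 := sdiff_pair s2 (sz2 ((x0, cl t), x0)).
  apply: (sdiff_comp s3); rewrite /= m_x0; exact: sF.
have sxi1 : sdiff xi1 ((x0, cl t), x0).
  have s3 := sdiff_pair (sz1 ((x0, cl t), x0)) (sz2 ((x0, cl t), x0)).
  exact: (sdiff_comp s3 (sF1 (gc t) (cl t) ct)).
have sH : sdiff H ((x0, cl t), x0).
  have s1 := @left_translate_comp_sdiff _ _ G _ snd xi ((x0, cl t), x0) erefl (sz3 _) sxi.
  have s2 := @right_translate_comp_sdiff _ _ G _ snd xi1 ((x0, cl t), x0) erefl (sz3 _) sxi1.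
  exact: (sdiffB s1 s2).
apply: (@unif_sdiff_param _ _ _ _ H (fun s => (w t s, cl s))).
- apply: filterS (w_continuous t) => s sc.
  by apply: continuous_pair => //; exact: clamp_continuous.
- by rewrite w_t.
have [d d0 Hd] := w_shift t; exists d => //.
apply: filterS Hd => s sd x xd; have [e1 e2] := sd x xd.
by rewrite /error_field e2 {1}e1.
Qed.

(** At [x0] both translations are the identity, so only the difference of the two velocities
    remains: 0 when the fields are equal, and the initial velocity of the deviation when they are
    those of the two modes. *)
Lemma error_field0 (F : G * R -> 'cV[R]_n) F1 t :
  error_field F F1 t x0 = F (gc t, cl t) - F1 (gc t, cl t).
Proof.
rewrite /error_field LT_x0 psi_x0 mulg1; congr (_ - _).
rewrite /right_translate psi_x0.
have [di dE] := is_diff_id x0.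
have near_id : \forall y \near x0, id y = phi (psi y * 1)%g.
  by apply: filterS near_phiK => y; rewrite mulg1 => ->.
have [d1 d1E] := diff_near_eq near_id di.
apply: etrans (deriveE _ d1) (etrans (d1E _) _).
exact: (congr1 (fun A : 'cV[R]_n -> 'cV[R]_n => A (F1 (gc t, cl t))) dE).
Qed.

Lemma left_translate_comp_diff (h : 'cV[R]_n -> 'cV[R]_n) v : sdiff h x0 ->
  'd (fun x => LT x (h x)) x0 v = 'd h x0 v + 'd (fun x => LT x (h x0)) x0 v.
Proof.
move=> sh; have [dh _] := sh.
have sLi i := @left_translate_sdiff _ _ G i.
have dhi i : differentiable (fun x => h x i 0) x0 by case: (sdiff_coord i 0 sh).
have LTsum (k : 'cV[R]_n -> 'cV[R]_n) : \forall x \near x0,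
    \sum_i k x i 0 *: LT x (delta_mx i 0) = LT x (k x).
  apply: filterS near_x0_cod => x xc; apply/esym.
  by apply: left_translateE; [exact: id_chart_atlas|exact: psi_dom].
have dt i : differentiable (fun x => h x i 0 *: LT x (delta_mx i 0)) x0.
  exact: (differentiable_scale (dhi i) (sLi i).1).
have [d1 d1E] := @diff_sum_fun _ _ _ _ (index_enum 'I_n) _ x0 dt.
have dc i : differentiable (fun x : 'cV[R]_n => h x0 i 0 *: LT x (delta_mx i 0)) x0.
  exact: (differentiableZ (h x0 i 0) (sLi i).1).
have [d2 d2E] := @diff_sum_fun _ _ _ _ (index_enum 'I_n) _ x0 dc.
have [_ E1] := diff_near_eq (LTsum h) d1.
have [_ E2] := diff_near_eq (LTsum (fun=> h x0)) d2.
have e1 := etrans (E1 v) (d1E v).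
have e2 := etrans (E2 v) (d2E v).
have e3 : \sum_i 'd (fun x => h x i 0 *: LT x (delta_mx i 0)) x0 v =
    \sum_i ('d h x0 v) i 0 *: delta_mx i 0 +
    \sum_i 'd (fun x : 'cV[R]_n => h x0 i 0 *: LT x (delta_mx i 0)) x0 v.
  rewrite -big_split; apply: eq_bigr => i _.
  apply: etrans (diff_scale v (dhi i) (sLi i).1) _; apply: f_equal2.
    exact: (f_equal2 (fun (a : R) z => a *: z) (diff_coord v i 0 dh) (LT_x0 _)).
  exact: (esym (congr1 (fun A : 'cV[R]_n -> 'cV[R]_n => A v) (diffZ (h x0 i 0) (sLi i).1))).
exact: etrans e1 (etrans e3 (f_equal2 +%R (esym (cV_sum_delta ('d h x0 v))) (esym e2))).
Qed.

(** The bracket is a difference of two derivatives of left translates. By [right_translate_derive]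
    the one that translates [v] equals the derivative in the direction [v] of the right translate of
    [xi], so both terms become differentials applied to [v]. *)
Lemma ad_mxE xi v :
  ad_mx (G := G) xi *m v = 'd (fun x => RT x xi) x0 v - 'd (fun x => LT x xi) x0 v.
Proof.
have [dRT _] := @right_translate_sdiff _ _ G xi.
have dL := @LT_differentiable _ _ G xi.
have bE j : lie_bracket (G := G) xi (delta_mx j 0) =
    'd (fun x => RT x xi) x0 (delta_mx j 0) - 'd (fun x => LT x xi) x0 (delta_mx j 0).
  rewrite lie_bracketE -right_translate_derive.
  exact: (f_equal2 (fun A B => A - B) (deriveE _ dRT) (deriveE _ dL)).
move: ('d (fun x => RT x xi) x0) ('d (fun x => LT x xi) x0) bE => A B bE.
have lin (C : {linear 'cV[R]_n -> 'cV[R]_n}) : C v = \sum_j v j 0 *: C (delta_mx j 0).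
  by rewrite {1}(cV_sum_delta v) linear_sum; apply: eq_bigr => j _; rewrite linearZ.
rewrite (lin A) (lin B) -sumrB.
apply/colP => i; rewrite mxE summxE; apply: eq_bigr => j _.
by rewrite mxE bE -scalerBr [in RHS]mxE mulrC.
Qed.

Lemma lieD_mxE (f : G -> 'cV[R]_n) p v : differentiable (fun x => f (p * psi x)%g) x0 ->
  lieD_mx f p *m v = 'd (fun x => f (p * psi x)%g) x0 v.
Proof.
move=> df; have lE j := lieDE (delta_mx j 0) df.
move: ('d (fun x => f (p * psi x)%g) x0) lE => A lE.
rewrite [in RHS](cV_sum_delta v) linear_sum.
apply/colP => i; rewrite mxE summxE; apply: eq_bigr => j _.
by rewrite mxE lE linearZ [in RHS]mxE mulrC.
Qed.

Lemma lieD_rowE (F : G -> R) p v : differentiable (fun x => F (p * psi x)%g) x0 ->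
  (lieD_row F p *m v) 0 0 = 'd (fun x => F (p * psi x)%g) x0 v.
Proof.
move=> df; have lE j := lieDE (delta_mx j 0) df.
move: ('d (fun x => F (p * psi x)%g) x0) lE => A lE.
rewrite [in RHS](cV_sum_delta v) linear_sum.
rewrite mxE; apply: eq_bigr => j _.
by rewrite mxE lE linearZ mulrC.
Qed.

(** The product rule separates the variation of [f] from that of the left translation. The latter,
    minus the variation of the right translation, is the opposite of [ad] by [ad_mxE]. *)
Lemma error_field_diff (f : G -> R -> 'cV[R]_n) (F : G * R -> 'cV[R]_n) t v :
  a <= t <= b -> left_sdiff F -> (forall p, F (p, t) = f p t) ->
  'd (error_field F F t) x0 v =
  (lieD_mx (f^~ t) (gc t) - ad_mx (G := G) (f (gc t) t)) *m v.
Proof.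
move=> tab sF Ff; have ct : cl t = t by exact: clamp_id.
pose h x := f (gc t * psi x)%g t.
have sh : sdiff h x0.
  have := sdiff_comp (sdiff_pairl t x0) (sF (gc t) t tab).
  by rewrite /h; under eq_fun do rewrite Ff.
have h0 : h x0 = f (gc t) t by rewrite /h psi_x0 mulg1.
have EE : error_field F F t = (fun x => LT x (h x) - RT x (f (gc t) t)).
  by apply/funext => x; rewrite /error_field ct !Ff.
rewrite EE mulmxBl (@lieD_mxE (f^~ t) (gc t) v sh.1) -/h ad_mxE.
have [dRT _] := @right_translate_sdiff _ _ G (f (gc t) t).
have [dLh _] := @left_translate_comp_sdiff _ _ G _ _ h x0 erefl (sdiff_id x0) sh.
have e2 := left_translate_comp_diff v sh.
have e3 := congr1 (fun z => 'd (fun x => LT x z) x0 v) h0.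
have alg (A B C : 'cV[R]_n) : A + B - C = A - (C - B) by rewrite opprB addrA.
apply: etrans (diffBE v dLh dRT) _.
apply: etrans (f_equal2 (fun A B => A - B) (etrans e2 (f_equal2 +%R erefl e3)) erefl) _.
exact: alg.
Qed.
End ErrorField.

(** * Existence and size of the perturbed trajectories *)

Lemma clamped_picard (R : realType) n (E : R -> 'cV[R]_n -> 'cV[R]_n)
    (x0 xa : 'cV[R]_n) (K r a alpha beta : R) (pi : 'cV[R]_n -> 'cV[R]_n) :
  0 < K -> alpha <= a <= beta ->
  (forall x y, `|pi x - pi y| <= `|x - y|) -> (forall x, `|pi x - x0| <= r) ->
  (forall t x y, `|x - x0| <= r -> `|y - x0| <= r ->
     `|E t x - E t y| <= K * `|x - y|) ->
  (forall t x, `|x - x0| <= r ->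
     {for (t, x), continuous (fun z : R * 'cV[R]_n => E z.1 z.2)}) ->
  exists2 x : R -> 'cV[R]_n, x a = xa & continuous x /\
    forall t : R, alpha < t < beta -> is_derive t 1 x (E t (pi (x t))).
Proof.
move=> K0 /andP[al be] pi1 pir EK Ec.
have pic : continuous pi.
  by apply: (@lipschitz_continuous _ _ _ pi 1 ltr01) => x y; rewrite mul1r.
have Fc : continuous (fun z : R * 'cV[R]_n => E z.1 (pi z.2)).
  move=> z; have fc : {for z, continuous (@fst R 'cV[R]_n)} by exact: cvg_fst.
  have sc : {for z, continuous (@snd R 'cV[R]_n)} by exact: cvg_snd.
  have pc : {for z, continuous (fun z : R * 'cV[R]_n => (z.1, pi z.2))}.
    apply: continuous_pair; first exact: fc.
    exact: (@continuous_comp _ _ _ snd pi z sc (pic z.2)).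
  exact: (@continuous_comp _ _ _ (fun z : R * 'cV[R]_n => (z.1, pi z.2)) (fun z => E z.1 z.2) z pc (Ec z.1 (pi z.2) (pir z.2))).
(* The retraction turns a bound on the ball into a global one. The solution obeys [E] itself only
   where [pi] fixes it, which has to be verified at each use. *)
have FK t x y : `|E t (pi x) - E t (pi y)| <= K * `|x - y|.
  apply: le_trans (EK t _ _ (pir x) (pir y)) _.
  by apply: ler_wpM2l; [exact: ltW|exact: pi1].
exact: (picard_lindelof xa K0 al be Fc FK).
Qed.

Section Regular.
Context {R : realType} {n : nat} {G : lieGroupType R n}.
Variables (gb : R -> G) (a b : R).
Hypotheses (ab : a <= b) (gbc : {within `[a, b], continuous gb}).

Local Notation phi := (chart_map (id_chart G)).
Local Notation psi := (chart_inv (id_chart G)).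
Local Notation x0 := (phi 1%g).
Local Notation gc := (fun t => gb (clamp a b t)).

Lemma clamp_idem t : clamp a b (clamp a b t) = clamp a b t.
Proof. by apply: clamp_id; exact: clamp_itv. Qed.

Lemma error_field_clamp (F F1 : G * R -> 'cV[R]_n) t x :
  error_field gc a b F F1 t x = error_field gc a b F F1 (clamp a b t) x.
Proof. by rewrite /error_field !clamp_idem. Qed.

(** Time enters the field only through the clamp, so bounds on the compact [[a, b]] hold for all
    times, and Picard iteration can run on a larger interval. *)
Lemma error_field_regular (F F1 : G * R -> 'cV[R]_n) :
  left_sdiff a b F -> left_sdiff a b F1 ->
  exists2 d : R, 0 < d &
    (forall t x y, `|x - x0| < d -> `|y - x0| < d ->
       `|error_field gc a b F F1 t x - error_field gc a b F F1 t y| <= d^-1 * `|x - y|) /\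
    (forall t x, `|x - x0| < d -> {for (t, x), continuous
       (fun z : R * 'cV[R]_n => error_field gc a b F F1 z.1 z.2)}).
Proof.
move=> sF sF1; have gcc : continuous gc by exact: within_clamp_continuous.
have us t : a <= t <= b -> unif_sdiff (error_field gc a b F F1) x0 t.
  by move=> _; exact: error_field_unif_sdiff.
have [d d0 H] := unif_sdiff_lipschitz us.
exists d => //; split=> [t x y xd yd|t x xd].
  rewrite (error_field_clamp _ _ t x) (error_field_clamp _ _ t y).
  exact: (H _ (clamp_itv t ab)).1.
have Hc := (H _ (clamp_itv t ab)).2 x xd.
have fc : {for (t, x), continuous (@fst R 'cV[R]_n)} by exact: cvg_fst.
have sc : {for (t, x), continuous (@snd R 'cV[R]_n)} by exact: cvg_snd.
have pc : {for (t, x), continuous (fun z : R * 'cV[R]_n => (clamp a b z.1, z.2))}.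
  apply: continuous_pair; last exact: sc.
  exact: (@continuous_comp _ _ _ fst (clamp a b) (t, x) fc (@clamp_continuous _ a b t)).
have -> : (fun z : R * 'cV[R]_n => error_field gc a b F F1 z.1 z.2) =
    (fun z : R * 'cV[R]_n => error_field gc a b F F1 (clamp a b z.1) z.2).
  by apply/funext => z; exact: error_field_clamp.
exact: (@continuous_comp _ _ _ (fun z : R * 'cV[R]_n => (clamp a b z.1, z.2)) (fun z => error_field gc a b F F1 z.1 z.2) (t, x) pc Hc).
Qed.
End Regular.

Lemma within_mul_continuous (R : realType) n (G : lieGroupType R n) (g k : R -> G)
    (a b : R) : {within `[a, b], continuous g} ->
  (forall t, a <= t <= b -> {for t, continuous k}) ->
  {within `[a, b], continuous (fun t => g t * k t)%g}.
Proof.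
move=> /subspace_continuousP gc kc; apply/subspace_continuousP => t tab.
have gt : g s @[s --> within `[a, b] (nbhs t)] --> g t := gc t tab.
have kt : k s @[s --> within `[a, b] (nbhs t)] --> k t.
  by apply: cvg_within_filter; apply: kc; move: tab; rewrite /= in_itv.
apply: (@continuous2_cvg _ _ _ _ _ _ g k (fun x y => x * y)%g) gt kt.
exact: (@lie_mul_continuous _ _ G (g t, k t)).
Qed.

Section Perturbation.
Context {R : realType} {n : nat} {G : lieGroupType R n}.
Variables (T0 TN tau0 : R) (f1 f2 : G -> R -> 'cV[R]_n) (F1 F2 : G * R -> 'cV[R]_n).
Variables (gb : R -> G).
Hypothesis tau0_in : T0 <= tau0 < TN.
Hypotheses (Ff1 : forall p t, T0 <= t <= TN -> F1 (p, t) = f1 p t).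
Hypotheses (Ff2 : forall p t, T0 <= t <= TN -> F2 (p, t) = f2 p t).
Hypothesis (gb_trajectory : is_trajectory T0 TN tau0 f1 f2 (gb T0) 0 gb).

Local Notation phi := (chart_map (id_chart G)).
Local Notation psi := (chart_inv (id_chart G)).
Local Notation x0 := (phi 1%g).
Local Notation gc := (fun t => gb (clamp T0 TN t)).
Local Notation E1 := (error_field gc T0 TN F1 F1).
Local Notation E2 := (error_field gc T0 TN F2 F1).

Let gb_velocity t : T0 < t < TN -> t != tau0 -> has_velocity gb t (f1 (gb t) t).
Proof.
have [_ _ H] := gb_trajectory; move=> tT tt; have := H t tT tt.
have -> : switched f1 f2 tau0 0 (gb t) t = f1 (gb t) t.
  rewrite /switched addr0; case: ifP; last by [].
  by move=> /andP[h1 h2]; have := le_lt_trans h1 h2; rewrite ltxx.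
by apply; rewrite addr0.
Qed.

(** A gluing that is constant up to [tau0], follows [x2] during the second mode and then [x1].
    Clamping the arguments makes it continuous without a case analysis. *)
Definition perturbation (lam : R) (x2 x1 : R -> 'cV[R]_n) (t : R) :=
  x2 (Num.min (Num.max t tau0) (tau0 + lam)) +
  (x1 (Num.max t (tau0 + lam)) - x1 (tau0 + lam)).

Lemma perturbation_before lam x2 x1 t : 0 < lam -> t <= tau0 ->
  perturbation lam x2 x1 t = x2 tau0.
Proof.
move=> l0 tt; rewrite /perturbation (max_r tt) min_l; last by rewrite lerDl ltW.
by rewrite max_r ?subrr ?addr0 //; apply: le_trans tt _; rewrite lerDl ltW.
Qed.

Lemma perturbation_during lam x2 x1 t : tau0 <= t <= tau0 + lam ->
  perturbation lam x2 x1 t = x2 t.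
Proof.
move=> /andP[t1 t2].
by rewrite /perturbation (max_l t1) (min_l t2) (max_r t2) subrr addr0.
Qed.

Lemma perturbation_after lam x2 x1 t : 0 < lam -> tau0 + lam <= t ->
  x1 (tau0 + lam) = x2 (tau0 + lam) -> perturbation lam x2 x1 t = x1 t.
Proof.
move=> l0 tt x12; have t1 : tau0 <= t by apply: le_trans tt; rewrite lerDl ltW.
by rewrite /perturbation (max_l t1) (min_r tt) (max_l tt) x12 addrC subrK.
Qed.

Lemma perturbation_continuous lam x2 x1 : continuous x2 -> continuous x1 ->
  continuous (perturbation lam x2 x1).
Proof.
move=> c2 c1 t.
have mxc (c : R) : {for t, continuous (fun s => Num.max s c)}.
  by apply: (@continuous_max _ _ id (cst c)) => //; exact: cst_continuous.
have mnc : {for t, continuous (fun s => Num.min (Num.max s tau0) (tau0 + lam))}.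
  by apply: (@continuous_min _ _ (fun s => Num.max s tau0) (cst (tau0 + lam))) => //; exact: cst_continuous.
have k2 := @continuous_comp _ _ _ _ x2 t mnc (c2 _).
have k1 := @continuous_comp _ _ _ _ x1 t (mxc (tau0 + lam)) (c1 _).
by apply: cvgD; [exact: k2|apply: cvgB; [exact: k1|exact: cvg_cst]].
Qed.

Local Notation LT x := (left_translate (id_chart G) (psi x)).
Local Notation RT := (@right_translate R n G).

Lemma error_field_in (F : G * R -> 'cV[R]_n) (f : G -> R -> 'cV[R]_n) t x :
  (forall p, F (p, t) = f p t) -> T0 <= t <= TN ->
  error_field gc T0 TN F F1 t x =
    LT x (f (gb t * psi x)%g t) - RT x (f1 (gb t) t).
Proof.
move=> Ff tT; have ct : clamp T0 TN t = t by exact: clamp_id.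
apply: etrans (congr1 (fun c => LT x (F (gb c * psi x, c)%g) - RT x (F1 (gb c, c))) ct) _.
exact: (f_equal2 (fun u v => LT x u - RT x v) (Ff _) (Ff1 _ tT)).
Qed.

(** No velocity is required at the switching times. Around any other time the glued deviation is
    either constant or a single solution of an error equation, to which [has_velocity_mul_psi]
    applies. *)
Lemma perturbed_trajectory lam x2 x1 :
  0 < lam -> tau0 + lam < TN -> x2 tau0 = x0 -> x1 (tau0 + lam) = x2 (tau0 + lam) ->
  continuous x2 -> continuous x1 ->
  (forall t, tau0 <= t <= tau0 + lam -> chart_cod (id_chart G) (x2 t)) ->
  (forall t, tau0 + lam <= t <= TN -> chart_cod (id_chart G) (x1 t)) ->
  (forall t, tau0 < t < tau0 + lam -> is_derive t 1 x2 (E2 t (x2 t))) ->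
  (forall t, tau0 + lam < t < TN -> is_derive t 1 x1 (E1 t (x1 t))) ->
  is_trajectory T0 TN tau0 f1 f2 (gb T0) lam
    (fun t => gb t * psi (perturbation lam x2 x1 t))%g.
Proof.
move=> l0 lT x2t x12 c2 c1 cod2 cod1 d2 d1.
have [tau1 tau2] := andP tau0_in; have [gbc _ _] := gb_trajectory.
pose X := perturbation lam x2 x1.
have Xcod t : T0 <= t <= TN -> chart_cod (id_chart G) (X t).
  move=> /andP[t1 t2]; have [tt|tt] := leP t tau0.
    by rewrite /X perturbation_before // x2t; exact: x0_cod.
  have [tl|tl] := leP t (tau0 + lam).
    by rewrite /X perturbation_during ?(ltW tt) //; apply: cod2; rewrite (ltW tt).
  by rewrite /X perturbation_after ?(ltW tl) //; apply: cod1; rewrite (ltW tl).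
have Xc := @perturbation_continuous lam _ _ c2 c1.
split.
- apply: within_mul_continuous => // t tT.
  apply: (@continuous_comp _ _ _ X psi t (Xc t)).
  by apply: chart_inv_continuous; exact: Xcod.
- by rewrite perturbation_before // x2t psi_x0 mulg1.
move=> t /andP[t1 t2] tn1 tn2.
have tT : T0 <= t <= TN by rewrite !ltW.
have ct : clamp T0 TN t = t by exact: clamp_id.
have [tt|tt|tt] := ltgtP t tau0; last by rewrite tt eqxx in tn1.
  rewrite /switched leNgt tt /= perturbation_before ?(ltW tt) // x2t psi_x0 mulg1.
  apply: near_eq_has_velocity (gb_velocity _ tn1); last by rewrite t1.
  near=> s; have st : s < tau0 by near: s; exact: lt_nbhsl.
  by rewrite perturbation_before ?(ltW st) // x2t psi_x0 mulg1.
have gv : has_velocity gb t (f1 (gb t) t) by apply: gb_velocity => //; rewrite t1.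
have [tl|tl|tl] := ltgtP t (tau0 + lam); last by rewrite tl eqxx in tn2.
  have tt2 : tau0 <= t <= tau0 + lam by rewrite !ltW.
  rewrite /switched (ltW tt) tl /= (perturbation_during x2 x1 tt2).
  have near_X : \forall s \near t, (gb s * psi (x2 s))%g = (gb s * psi (perturbation lam x2 x1 s))%g.
    near=> s; rewrite perturbation_during //; apply/andP; split; apply/ltW; near: s.
      exact: lt_nbhsr.
    exact: lt_nbhsl.
  apply: near_eq_has_velocity near_X _.
  apply: has_velocity_mul_psi gv _ _.
    by apply: cod2; rewrite !ltW.
  have tt' : tau0 < t < tau0 + lam by rewrite tt.
  have EE : E2 t (x2 t) = _ := error_field_in (x2 t) (fun p => Ff2 p tT) tT.
  exact: is_derive_eq (d2 t tt') EE.
rewrite /switched (ltW tt) ltNge (ltW tl) /= (perturbation_after l0 (ltW tl) x12).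
have near_X : \forall s \near t, (gb s * psi (x1 s))%g = (gb s * psi (perturbation lam x2 x1 s))%g.
  near=> s; rewrite perturbation_after //; apply/ltW; near: s; exact: lt_nbhsr.
apply: near_eq_has_velocity near_X _.
apply: has_velocity_mul_psi gv _ _.
  by apply: cod1; rewrite !ltW.
have tt' : tau0 + lam < t < TN by rewrite tl.
have EE : E1 t (x1 t) = _ := error_field_in (x1 t) (fun p => Ff1 p tT) tT.
exact: is_derive_eq (d1 t tt') EE.
Unshelve. all: by end_near. Qed.
End Perturbation.

Lemma widen_itv (R : realType) (a b c d t : R) : a <= c -> d <= b ->
  c <= t <= d -> a - 1 < t < b + 1.
Proof. by move=> ac db /andP[ct td]; apply/andP; split; lra. Qed.

Section SmallPerturbation.
Context {R : realType} {n : nat} {G : lieGroupType R n}.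
Variables (T0 TN tau0 : R) (f1 f2 : G -> R -> 'cV[R]_n) (F1 F2 : G * R -> 'cV[R]_n).
Variables (gb : R -> G).
Hypotheses (T0TN : T0 < TN) (tau0_in : T0 <= tau0 < TN).
Hypotheses (sF1 : left_sdiff T0 TN F1) (sF2 : left_sdiff T0 TN F2).
Hypotheses (Ff1 : forall p t, T0 <= t <= TN -> F1 (p, t) = f1 p t).
Hypotheses (Ff2 : forall p t, T0 <= t <= TN -> F2 (p, t) = f2 p t).
Hypothesis (gb_trajectory : is_trajectory T0 TN tau0 f1 f2 (gb T0) 0 gb).

Local Notation phi := (chart_map (id_chart G)).
Local Notation psi := (chart_inv (id_chart G)).
Local Notation x0 := (phi 1%g).
Local Notation gc := (fun t => gb (clamp T0 TN t)).
Local Notation E1 := (error_field gc T0 TN F1 F1).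
Local Notation E2 := (error_field gc T0 TN F2 F1).

(** [x2] is a single curve for all durations, so its derivative at [tau0] describes
    [x2 (tau0 + lam)] to first order; only the restart [x1 lam] depends on [lam]. *)
Lemma small_perturbations : exists (x2 : R -> 'cV[R]_n) (x1 : R -> R -> 'cV[R]_n) (C : R),
  [/\ 0 < C, x2 tau0 = x0,
      is_derive tau0 1 x2 (f2 (gb tau0) tau0 - f1 (gb tau0) tau0) &
      \forall lam \near 0^'+,
        [/\ tau0 + lam < TN /\ x1 lam (tau0 + lam) = x2 (tau0 + lam),
            continuous (x1 lam) /\
              forall t, tau0 + lam < t < TN -> is_derive t 1 (x1 lam) (E1 t (x1 lam t)),
            forall t, tau0 <= t <= tau0 + lam -> `|x2 t - x0| <= C * lam,
            forall t, tau0 + lam <= t <= TN -> `|x1 lam t - x0| <= C * lam &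
            is_trajectory T0 TN tau0 f1 f2 (gb T0) lam
              (fun t => gb t * psi (perturbation tau0 lam x2 (x1 lam) t))%g]].
Proof.
have T0TN' := ltW T0TN; have TT := lexx TN; have [tau1 tau2] := andP tau0_in.
have tauT : T0 <= tau0 <= TN by rewrite tau1 ltW.
have gbc : {within `[T0, TN], continuous gb} by case: gb_trajectory.
have [d1 d10 [EK1 Ec1]] := error_field_regular T0TN' gbc sF1 sF1.
have [d2 d20 [EK2 Ec2]] := error_field_regular T0TN' gbc sF2 sF1.
have /near_normP[d3 d30 cod] := @near_x0_cod _ _ G.
pose d := Num.min (Num.min d1 d2) d3.
have d0 : 0 < d by rewrite !lt_min d10 d20.
have dd1 : d <= d1 by rewrite !ge_min lexx.
have dd2 : d <= d2 by rewrite !ge_min lexx orbT.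
have dd3 : d <= d3 by rewrite ge_min lexx orbT.
pose r := d / 2; have r0 : 0 < r by rewrite divr_gt0.
have rd : r < d by rewrite /r; lra.
have [pi [pi1 pir pi_id]] := box_retraction x0 (ltW r0).
have x00 : `|x0 - x0| <= r by rewrite subrr normr0 ltW.
have x00' : `|x0 - x0| < d1 by apply: le_lt_trans x00 (lt_le_trans rd dd1).
have K10 : 0 < d1^-1 by rewrite invr_gt0.
have K20 : 0 < d2^-1 by rewrite invr_gt0.
have EKr1 t x y : `|x - x0| <= r -> `|y - x0| <= r -> `|E1 t x - E1 t y| <= d1^-1 * `|x - y|.
  move=> xr yr; apply: EK1; first exact: le_lt_trans xr (lt_le_trans rd dd1).
  exact: le_lt_trans yr (lt_le_trans rd dd1).
have EKr2 t x y : `|x - x0| <= r -> `|y - x0| <= r -> `|E2 t x - E2 t y| <= d2^-1 * `|x - y|.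
  move=> xr yr; apply: EK2; first exact: le_lt_trans xr (lt_le_trans rd dd2).
  exact: le_lt_trans yr (lt_le_trans rd dd2).
have Ecr1 t x : `|x - x0| <= r -> {for (t, x), continuous (fun z : R * 'cV[R]_n => E1 z.1 z.2)}.
  by move=> xr; apply: Ec1; exact: le_lt_trans xr (lt_le_trans rd dd1).
have Ecr2 t x : `|x - x0| <= r -> {for (t, x), continuous (fun z : R * 'cV[R]_n => E2 z.1 z.2)}.
  by move=> xr; apply: Ec2; exact: le_lt_trans xr (lt_le_trans rd dd2).
(* The interval is widened by 1 because [x2] needs a two-sided derivative at [tau0], which may equal
   [T0]. *)
have tau_in3 := widen_itv (lexx T0) (lexx TN) tauT.
have tau_in2 : T0 - 1 <= tau0 <= TN + 1 by case/andP: tau_in3 => h1 h2; rewrite !ltW.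
have [x2 x2t [x2c dx2]] := clamped_picard x0 K20 tau_in2 pi1 pir EKr2 Ecr2.
have /choice[x1 Hx1] lam : exists x : R -> 'cV[R]_n, 0 < lam -> tau0 + lam < TN ->
    [/\ x (tau0 + lam) = x2 (tau0 + lam), continuous x &
      forall t : R, T0 - 1 < t < TN + 1 -> is_derive t 1 x (E1 t (pi (x t)))].
  have [lT|lT] := pselect (0 < lam /\ tau0 + lam < TN); last first.
    by exists (cst x0) => l0 l1; exfalso; exact: lT.
  have tl : T0 <= tau0 + lam <= TN.
    by case: lT => l0 /ltW->; rewrite andbT (le_trans tau1) // lerDl ltW.
  have lam_in : T0 - 1 <= tau0 + lam <= TN + 1.
    by case/andP: (widen_itv (lexx T0) (lexx TN) tl) => h1 h2; rewrite !ltW.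
  have [x xt [xc dx]] := clamped_picard (x2 (tau0 + lam)) K10 lam_in pi1 pir EKr1 Ecr1.
  by exists x.
pose v := f2 (gb tau0) tau0 - f1 (gb tau0) tau0.
have E20 : E2 tau0 x0 = v.
  have ct : clamp T0 TN tau0 = tau0 by exact: clamp_id.
  apply: etrans (error_field0 _ _ _ F2 F1 tau0) _.
  apply: etrans (congr1 (fun c => F2 (gb c, c) - F1 (gb c, c)) ct) _.
  exact: (f_equal2 (fun a b => a - b) (Ff2 _ tauT) (Ff1 _ tauT)).
have E10 t : E1 t x0 = 0.
  by apply: etrans (error_field0 _ _ _ F1 F1 t) _; exact: subrr.
have dx2t : is_derive tau0 1 x2 v.
  apply: is_derive_eq (dx2 tau0 tau_in3) _.
  by rewrite x2t pi_id.
have /near_normP[eta eta0 x2n] := is_derive_near dx2t ltr01.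
(* Near [tau0] the mean speed of [x2] from [tau0] is at most [|v|] plus the tolerance 1. *)
pose C2 := `|v| + 1; have C20 : 0 < C2 by rewrite ltr_wpDl.
have x2C t : `|t - tau0| < eta -> `|x2 t - x0| <= C2 * `|t - tau0|.
  move=> /x2n; rewrite x2t mul1r => h.
  rewrite -(subrK ((t - tau0) *: v) (x2 t - x0)); apply: le_trans (ler_normD _ _) _.
  apply: le_trans (lerD h (lexx _)) _; rewrite normrZ /C2 mulrDl mul1r addrC.
  by rewrite (mulrC `|v|).
pose X := expR (2 * d1^-1 * (TN - T0)).
have X1 : 1 <= X.
  by rewrite -expR0 ler_expR mulr_ge0 ?subr_ge0 // mulr_ge0 // ltW.
(* [C2 * lam] bounds the deviation at the end of the second mode, and [2 * X] is the growth that
   Gronwall's inequality allows afterwards. *)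
pose C := 2 * C2 * X.
have C0 : 0 < C by rewrite !mulr_gt0 // expR_gt0.
have C2C : C2 <= C.
  apply: (@le_trans _ _ (2 * C2)); first by apply: ler_peMl; [exact: ltW|rewrite ler1n].
  by apply: ler_peMr => //; rewrite mulr_ge0 // ltW.
exists x2, x1, C; split => //.
near=> lam.
have l0 : 0 < lam by near: lam; exact: nbhs_right_gt.
have leta : lam < eta by near: lam; exact: nbhs_right_lt.
have lT : tau0 + lam < TN.
  have : lam < TN - tau0 by near: lam; apply: nbhs_right_lt; rewrite subr_gt0.
  by rewrite ltrBrDl.
have tl0 : T0 <= tau0 + lam by rewrite (le_trans tau1) // lerDl ltW.
have lr : C * lam < r.
  have : lam < r / C by near: lam; apply: nbhs_right_lt; rewrite divr_gt0.
  by rewrite ltr_pdivlMr // mulrC.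
have [x1t x1c dx1] := Hx1 lam l0 lT.
have x2s t : tau0 <= t <= tau0 + lam -> `|x2 t - x0| <= C2 * lam.
  move=> /andP[t1 t2]; have tE : `|t - tau0| = t - tau0 by rewrite ger0_norm // subr_ge0.
  have tlam : t - tau0 <= lam by rewrite lerBlDl.
  apply: le_trans (x2C t _) _; rewrite tE; first exact: le_lt_trans leta.
  by apply: ler_wpM2l => //; exact: ltW.
have x2s' t : tau0 <= t <= tau0 + lam -> `|x2 t - x0| <= C * lam.
  by move=> /x2s h; apply: le_trans h _; apply: ler_wpM2r => //; exact: ltW.
(* Gronwall's inequality is applied to the retracted equation: [pi] fixes [x0], where [E1] vanishes,
   so the bound does not presuppose that the solution stays in the ball. Only afterwards is [pi]
   removed. *)
have x1s t : tau0 + lam <= t <= TN -> `|x1 lam t - x0| <= C * lam.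
  move=> tl; pose u s := x1 lam s - x0; pose u' s := E1 s (pi (x1 lam s)).
  have uc : {within `[tau0 + lam, TN], continuous u}.
    apply: continuous_subspaceT => s; apply: cvgB; first exact: x1c.
    exact: cvg_cst.
  have du s : tau0 + lam < s < TN -> is_derive s 1 u (u' s).
    move=> /andP[s1 s2]; have sT : T0 - 1 < s < TN + 1 by apply: (widen_itv tl0 TT); rewrite !ltW.
    by have := is_deriveB (dx1 s sT) (is_derive_cst x0 s 1); rewrite subr0.
  have ub s : tau0 + lam < s < TN -> `|u' s| <= d1^-1 * `|u s|.
    move=> _; have := EKr1 s (pi (x1 lam s)) x0 (pir _) x00.
    rewrite E10 subr0 => /le_trans; apply; apply: ler_wpM2l; first exact: ltW.
    by have := pi1 (x1 lam s) x0; rewrite (pi_id x0 x00).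
  have := gronwall (ltW lT) (ltW K10) uc du ub tl; rewrite /u x1t => /le_trans; apply.
  have h1 : `|x2 (tau0 + lam) - x0| <= C2 * lam.
    by apply: x2s; rewrite lexx andbT lerDl ltW.
  have h2 : expR (2 * d1^-1 * (t - (tau0 + lam))) <= X.
    rewrite ler_expR; apply: ler_wpM2l; first by rewrite mulr_ge0 // ltW.
    by case/andP: tl => _ tN; exact: lerB tN tl0.
  rewrite (_ : C * lam = 2 * (C2 * lam) * X); last by rewrite /C; ring.
  apply: ler_pM => //.
  by apply: ler_wpM2l.
have codr x : `|x - x0| <= C * lam -> chart_cod (id_chart G) x.
  by move=> xl; apply: cod; exact: le_lt_trans xl (lt_trans lr (lt_le_trans rd dd3)).
have dx2' t : tau0 < t < tau0 + lam -> is_derive t 1 x2 (E2 t (x2 t)).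
  move=> /andP[t1 t2]; have tT : T0 - 1 < t < TN + 1 by apply: (widen_itv tau1 (ltW lT)); rewrite !ltW.
  apply: is_derive_eq (dx2 t tT) _; rewrite pi_id //.
  by apply: le_trans (x2s' t _) (ltW lr); rewrite !ltW.
have dx1' t : tau0 + lam < t < TN -> is_derive t 1 (x1 lam) (E1 t (x1 lam t)).
  move=> /andP[t1 t2]; have tT : T0 - 1 < t < TN + 1 by apply: (widen_itv tl0 TT); rewrite !ltW.
  apply: is_derive_eq (dx1 t tT) _; rewrite pi_id //.
  by apply: le_trans (x1s t _) (ltW lr); rewrite !ltW.
split.
- by split.
- by split.
- exact: x2s'.
- exact: x1s.
apply: (perturbed_trajectory tau0_in Ff1 Ff2 gb_trajectory) => //.
- by move=> t /x2s'/codr.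
- by move=> t /x1s/codr.
Unshelve. all: by end_near. Qed.

End SmallPerturbation.

(** * Uniqueness of the perturbed trajectory *)

Section Uniqueness.
Context {R : realType} {n : nat} {G : lieGroupType R n}.
Variables (T0 TN tau0 : R) (f1 f2 : G -> R -> 'cV[R]_n) (F1 F2 : G * R -> 'cV[R]_n).
Hypotheses (tau0_in : T0 <= tau0 < TN).
Hypotheses (sF1 : left_sdiff T0 TN F1) (sF2 : left_sdiff T0 TN F2).
Hypotheses (Ff1 : forall p t, T0 <= t <= TN -> F1 (p, t) = f1 p t).
Hypotheses (Ff2 : forall p t, T0 <= t <= TN -> F2 (p, t) = f2 p t).

Lemma is_trajectory_unique (g0 : G) (lam : R) (h k : R -> G) :
  0 < lam -> tau0 + lam < TN ->
  is_trajectory T0 TN tau0 f1 f2 g0 lam h ->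
  is_trajectory T0 TN tau0 f1 f2 g0 lam k ->
  forall t, T0 <= t <= TN -> h t = k t.
Proof.
move=> l0 lT [hc h0 hv] [kc k0 kv]; have [tau1 tau2] := andP tau0_in.
(* The switched field is regular only between switching times; agreement is carried from one piece
   to the next through the common endpoint. *)
have piece (F : G * R -> 'cV[R]_n) (a b : R) : T0 <= a -> b <= TN -> left_sdiff T0 TN F ->
    (forall t, a < t < b -> forall p, switched f1 f2 tau0 lam p t = F (p, t)) ->
    (forall t, a < t < b -> t != tau0 /\ t != tau0 + lam) ->
    h a = k a -> forall t, a <= t <= b -> h t = k t.
  move=> Ta bT sF Fs tn hka; have sub : `[a, b] `<=` `[T0, TN].
    move=> t /=; rewrite !in_itv /= => /andP[t1 t2].
    by rewrite (le_trans Ta t1) (le_trans t2 bT).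
  have v (e : R -> G) : (forall t, T0 < t < TN -> t != tau0 -> t != tau0 + lam ->
      has_velocity e t (switched f1 f2 tau0 lam (e t) t)) ->
      forall t, a < t < b -> has_velocity e t (F (e t, t)).
    move=> ev t tab; have [t1 t2] := tn t tab; rewrite -(Fs t tab); apply: ev => //.
    by case/andP: tab => h1 h2; rewrite (le_lt_trans Ta h1) (lt_le_trans h2 bT).
  apply: (@trajectory_unique _ _ G F a b h k) => //.
  - move=> p t /andP[t1 t2]; apply: sF.
    by rewrite (le_trans Ta t1) (le_trans t2 bT).
  - exact: continuous_subspaceW sub hc.
  - exact: continuous_subspaceW sub kc.
  - exact: v.
  - exact: v.
have p1 t : T0 <= t <= tau0 -> h t = k t.
  apply: (piece F1) => //; first exact: ltW.
  - move=> s /andP[s1 s2] p; rewrite /switched leNgt s2 /= Ff1 //.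
    by apply/andP; split; apply: ltW => //; exact: lt_trans s2 tau2.
  - move=> s /andP[s1 s2]; split; rewrite lt_eqF //.
    by apply: lt_trans s2 _; rewrite ltrDl.
  - by rewrite h0 k0.
have p2 t : tau0 <= t <= tau0 + lam -> h t = k t.
  apply: (piece F2) => //; first exact: ltW.
  - move=> s /andP[s1 s2] p; rewrite /switched (ltW s1) s2 /= Ff2 //.
    by apply/andP; split; apply: ltW; [exact: le_lt_trans s1|exact: lt_trans s2 lT].
  - by move=> s /andP[s1 s2]; split; [rewrite gt_eqF|rewrite lt_eqF].
  - by apply: p1; rewrite tau1 lexx.
have p3 t : tau0 + lam <= t <= TN -> h t = k t.
  apply: (piece F1) => //; first by apply: le_trans tau1 _; rewrite lerDl ltW.
  - move=> s /andP[s1 s2] p; rewrite /switched (ltNge s) (ltW s1) andbF Ff1 //.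
    apply/andP; split; apply: ltW => //; apply: le_lt_trans s1.
    by apply: le_trans tau1 _; rewrite lerDl ltW.
  - move=> s /andP[s1 s2]; split; rewrite gt_eqF //.
    by apply: lt_trans s1; rewrite ltrDl.
  - by apply: p2; rewrite lexx andbT lerDl ltW.
move=> t /andP[t1 t2]; have [tt|tt] := leP t tau0; first by apply: p1; rewrite t1.
have [tl|tl] := leP t (tau0 + lam); first by apply: p2; rewrite (ltW tt).
by apply: p3; rewrite (ltW tl).
Qed.
End Uniqueness.

(** * The costate and the objective *)

Lemma row_mul_col_norm (R : realType) n (r : 'rV[R]_n) (v : 'cV[R]_n) :
  `|(r *m v) 0 0| <= n%:R * `|r| * `|v|.
Proof.
have rE j : `|r 0 j| <= `|r|.
  rewrite [`|r|]mx_normrE.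
  exact: (@le_bigmax _ _ _ _ (fun ij : 'I_1 * 'I_n => `|r ij.1 ij.2|) (0, j)).
rewrite mxE; apply: le_trans (ler_norm_sum _ _ _) _.
have -> : n%:R * `|r| * `|v| = \sum_(j < n) `|r| * `|v|.
  by rewrite sumr_const card_ord -mulrA mulr_natl.
by apply: ler_sum => j _; rewrite normrM; apply: ler_pM => //; exact: norm_cV_coord.
Qed.

Lemma is_derive_row_mul_col (R : realType) n (rho : R -> 'rV[R]_n) (u : R -> 'cV[R]_n)
    (t : R) r' u' : is_derive t 1 rho r' -> is_derive t 1 u u' ->
  is_derive t 1 (fun s => (rho s *m u s) 0 0) ((r' *m u t) 0 0 + (rho t *m u') 0 0).
Proof.
move=> /is_derive_mx dr /is_derive_mx du.
have dj j := is_deriveM (dr 0 j) (du j 0).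
have E : (fun s => (rho s *m u s) 0 0) =
    \sum_(j < n) ((fun s => rho s 0 j) * (fun s => u s j 0)).
  by apply/funext => s; rewrite mxE fct_sumE.
rewrite E; apply: is_derive_eq (is_derive_sum dj) _.
rewrite [in RHS]mxE [X in _ = _ + X]mxE -big_split.
by apply: eq_bigr => j _; rewrite /= addrC [r' 0 j * _]mulrC.
Qed.

Lemma cvg_row_mul_col (R : realType) n (T : Type) (F : set_system T) (FF : Filter F)
    (rho : T -> 'rV[R]_n) (u : T -> 'cV[R]_n) (r : 'rV[R]_n) (v : 'cV[R]_n) :
  rho s @[s --> F] --> r -> u s @[s --> F] --> v ->
  (rho s *m u s) 0 0 @[s --> F] --> (r *m v) 0 0.
Proof.
move=> rc uc.
have -> : (fun s => (rho s *m u s) 0 0) = (fun s => \sum_j rho s 0 j * u s j 0).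
  by apply/funext => s; rewrite mxE.
rewrite mxE; apply: cvg_big => [|j _]; first exact: add_continuous.
apply: cvgM.
  exact: (cvg_comp _ _ rc (@coord_continuous _ _ _ 0 j r)).
exact: (cvg_comp _ _ uc (@coord_continuous _ _ _ j 0 v)).
Qed.

(* The terms in [rho' u] cancel those in [rho M u] and [l u], so [u] need not be
   compared with a solution of the linearized equation. *)
Lemma costate_pairing_estimate (R : realType) n (rho l : R -> 'rV[R]_n) (M : R -> 'M[R]_n)
    (u u' : R -> 'cV[R]_n) (Q Q' : R -> R) (a b B k : R) :
  a <= b -> 0 <= k ->
  {within `[a, b], continuous rho} -> {within `[a, b], continuous u} ->
  {within `[a, b], continuous Q} ->
  (forall t, a < t < b -> is_derive t 1 rho (- (rho t *m M t) - l t)) ->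
  (forall t, a < t < b -> is_derive t 1 u (u' t)) ->
  (forall t, a < t < b -> is_derive t 1 Q (Q' t)) ->
  (forall t, a < t < b -> `|rho t| <= B) ->
  (forall t, a < t < b -> `|u' t - M t *m u t| <= k) ->
  (forall t, a < t < b -> `|Q' t - (l t *m u t) 0 0| <= k) ->
  `|((rho b *m u b) 0 0 + Q b) - ((rho a *m u a) 0 0 + Q a)| <=
    (n%:R * B + 1) * k * (b - a).
Proof.
move=> ab k0 rc uc Qc dr du dQ rB uk Qk.
pose q s := (rho s *m u s) 0 0 + Q s.
pose q' t := (rho t *m (u' t - M t *m u t)) 0 0 + (Q' t - (l t *m u t) 0 0).
have dq t : a < t < b -> is_derive t 1 q (q' t).
  move=> tab; apply: is_derive_eq (is_deriveD (is_derive_row_mul_col (dr t tab) (du t tab)) (dQ t tab)) _.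
  rewrite /q' mulmxBl mulmxBr mulNmx mulmxA !mxE.
  move: (\sum_j _) (\sum_j _) (\sum_j _) (Q' t) => A1 A2 A3 A4; ring.
have qc : {within `[a, b], continuous q}.
  move: rc uc Qc => /subspace_continuousP rc /subspace_continuousP uc /subspace_continuousP Qc.
  apply/subspace_continuousP => t tab; apply: cvgD; last exact: Qc.
  by apply: cvg_row_mul_col; [exact: rc|exact: uc].
pose K : R := (n%:R * B + 1) * k.
have dK (t : R) : is_derive t 1 (fun s : R => 0 + s *: K) K by exact: (@is_derive_line R R^o).
have -> : (n%:R * B + 1) * k * (b - a) = (0 + b *: K) - (0 + a *: K).
  by rewrite !add0r -scalerBl mulrC.
apply: (@mean_value_ineq _ _ q q' (fun s => 0 + s *: K) (fun=> K)) => //.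
  by apply: continuous_subspaceT => t; exact: is_derive_continuous (dK t).
move=> t tab; apply: le_trans (ler_normD _ _) _; rewrite /K mulrDl mul1r.
apply: lerD (Qk t tab); apply: le_trans (row_mul_col_norm _ _) _.
apply: ler_pM; [by rewrite mulr_ge0|by []|by apply: ler_wpM2l => //; exact: rB|exact: uk].
Qed.

(** Clamping extends [f] continuously to the line, so the antiderivative [I] is differentiable at
    the endpoints too. *)
Lemma integral_antiderivative (R : realType) (a b : R) (f : R -> R) : a < b ->
  {within `[a, b], continuous f} ->
  exists2 I : R -> R, (forall t : R, is_derive t 1 I (f (clamp a b t))) &
    \int[lebesgue_measure]_(t in `[a, b]) f t = I b - I a.
Proof.
move=> ab fc; have [I dI] := antiderivative_line (within_clamp_continuous (ltW ab) fc).
exists I => //.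
have Ic : continuous I by move=> t; exact: is_derive_continuous (dI t).
rewrite /Rintegral (@continuous_FTC2 _ f I a b ab fc) //.
  split => [t _||]; first by case: (dI t).
    exact: cvg_at_right_filter (Ic a).
  exact: cvg_at_left_filter (Ic b).
move=> t; rewrite in_itv /= => /andP[at_ tb]; rewrite derive1E.
by have [_ ->] := dI t; rewrite clamp_id // !ltW.
Qed.

Section ObjectiveEstimate.
Context {R : realType} {n : nat} {G : lieGroupType R n}.

Local Notation phi := (chart_map (id_chart G)).
Local Notation psi := (chart_inv (id_chart G)).
Local Notation x0 := (phi 1%g).

Lemma left_sdiff_continuous (W : normedModType R) (F : G -> W) (p : G) :
  sdiff (fun x => F (p * psi x)%g) x0 -> {for p, continuous F}.
Proof.
move=> [dF _]; pose k q := phi (p^-1 * q)%g.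
have kp : k p = x0 by rewrite /k mulVg.
have mc : {for p, continuous (fun q => p^-1 * q)%g}.
  by apply: mul_continuous; [exact: cst_continuous|move=> A; exact: id].
have near_dom : \forall q \near p, chart_dom (id_chart G) (p^-1 * q)%g.
  by apply: (mc _); rewrite mulVg; exact: nbhs_chart_dom id_chart_dom.
have kc : {for p, continuous k}.
  apply: (@continuous_comp _ _ _ (fun q => p^-1 * q)%g phi p mc).
  by apply: chart_map_continuous; exact: nbhs_singleton near_dom.
have dF' : {for k p, continuous (fun x => F (p * psi x)%g)}.
  by rewrite kp; exact: differentiable_continuous.
have FE : \forall q \near p, F (p * psi (k q))%g = F q.
  by apply: filterS near_dom => q qd; rewrite /k chart_mapK // mulVKg.
have Fc : {for p, continuous (fun q => F (p * psi (k q))%g)} := continuous_comp kc dF'.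
rewrite /prop_for /continuous_at -(nbhs_singleton FE).
by apply: cvg_trans Fc; exact: near_eq_cvg FE.
Qed.

Lemma eq_objective (T0 TN : R) (L vphi : G -> R) (h k : R -> G) : T0 <= TN ->
  (forall t, T0 <= t <= TN -> h t = k t) ->
  objective T0 TN L vphi h = objective T0 TN L vphi k.
Proof.
move=> T0TN hk; rewrite /objective hk ?lexx ?T0TN //; congr (_ + _).
apply: eq_Rintegral => t; rewrite inE /= in_itv /= => tT.
by rewrite /= hk.
Qed.

Variables (T0 TN tau0 : R) (f1 : G -> R -> 'cV[R]_n) (F1 : G * R -> 'cV[R]_n).
Variables (gb : R -> G) (L vphi : G -> R) (rho : R -> 'rV[R]_n).
Hypotheses (T0TN : T0 < TN) (tau0_in : T0 <= tau0 < TN).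
Hypotheses (sF1 : left_sdiff T0 TN F1).
Hypotheses (Ff1 : forall p t, T0 <= t <= TN -> F1 (p, t) = f1 p t).
Hypothesis gbc : {within `[T0, TN], continuous gb}.
Hypothesis sL : forall p, sdiff (fun x => L (p * psi x)%g) x0.
Hypothesis sphi : forall p, sdiff (fun x => vphi (p * psi x)%g) x0.
Hypothesis costate : is_costate T0 TN f1 L vphi gb rho.

Local Notation gc := (fun t => gb (clamp T0 TN t)).
Local Notation E1 := (error_field gc T0 TN F1 F1).
Local Notation EL := (fun t x => L (gc t * psi x)%g).

(** All smallness conditions are gathered in the one tolerance [e]. The coefficient of [e * lam] in
    the bound does not involve [lam], so division by [lam] leaves a fixed multiple of [e]. *)
Lemma objective_estimate (x1 x2 : R -> 'cV[R]_n) (v : 'cV[R]_n) (lam B C e K : R) :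
  let h t := (gb t * psi (perturbation tau0 lam x2 x1 t))%g in
  0 < lam -> tau0 + lam < TN -> 0 <= C -> 0 <= e -> 0 <= K -> K * (C * lam) <= e ->
  x2 tau0 = x0 -> x1 (tau0 + lam) = x2 (tau0 + lam) -> continuous x1 ->
  (forall t, tau0 + lam < t < TN -> is_derive t 1 x1 (E1 t (x1 t))) ->
  (forall t, tau0 <= t <= tau0 + lam -> `|x2 t - x0| <= C * lam) ->
  (forall t, tau0 + lam <= t <= TN -> `|x1 t - x0| <= C * lam) ->
  {within `[T0, TN], continuous h} ->
  (forall t, T0 <= t <= TN -> forall x, `|x - x0| <= C * lam ->
     `|EL t x - EL t x0| <= K * `|x - x0|) ->
  (forall t, T0 <= t <= TN -> forall x, `|x - x0| <= C * lam ->
     `|E1 t x - E1 t x0 - 'd (E1 t) x0 (x - x0)| <= e * `|x - x0|) ->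
  (forall t, T0 <= t <= TN -> forall x, `|x - x0| <= C * lam ->
     `|EL t x - EL t x0 - 'd (EL t) x0 (x - x0)| <= e * `|x - x0|) ->
  (forall x, `|x - x0| <= C * lam ->
     `|vphi (gb TN * psi x)%g - vphi (gb TN) -
       'd (fun x => vphi (gb TN * psi x)%g) x0 (x - x0)| <= e * `|x - x0|) ->
  (forall t, T0 <= t <= TN -> `|rho t| <= B) ->
  `|rho (tau0 + lam) - rho tau0| <= e ->
  `|x2 (tau0 + lam) - x0 - lam *: v| <= e * lam ->
  `|objective T0 TN L vphi h - objective T0 TN L vphi gb - lam * (rho tau0 *m v) 0 0| <=
    (C + (n%:R * B + 1) * C * (TN - T0) + 1 + n%:R * B + n%:R * `|v|) * (e * lam).
Proof.
move=> h l0 lT C0 e0 K0 KCe x2t x12 x1c dx1 x2C x1C hc lipL lin1 linL linphi rhoB rhoe x2e.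
have T0TN' := ltW T0TN; have [tau1 tau2] := andP tau0_in; have [rhoc rhoT drho] := costate.
have l1 : tau0 <= tau0 + lam by rewrite lerDl ltW.
have l2 : T0 <= tau0 + lam := le_trans tau1 l1.
have Cl0 : 0 <= C * lam by apply: mulr_ge0 => //; exact: ltW.
have gcE t : T0 <= t <= TN -> gc t = gb t by move=> tT; rewrite clamp_id.
have Lc p : {for p, continuous L} by exact: left_sdiff_continuous (sL p).
have Lwc (k : R -> G) : {within `[T0, TN], continuous k} ->
    {within `[T0, TN], continuous (L \o k)}.
  move=> /subspace_continuousP kc; apply/subspace_continuousP => t tT.
  exact: (cvg_comp _ _ (kc t tT) (Lc (k t))).
have [Ih dIh hE] := integral_antiderivative T0TN (Lwc _ hc).
have [Ig dIg gE] := integral_antiderivative T0TN (Lwc _ gbc).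
(* [Q] is the change of the running cost accumulated since [T0]; it vanishes at [tau0] because the
   two trajectories agree until then. *)
pose Q t := (Ih t - Ig t) - (Ih T0 - Ig T0).
have dQ (t : R) : T0 <= t <= TN -> is_derive t 1 Q (L (h t) - L (gb t)).
  move=> tT; have := is_deriveB (is_deriveB (dIh t) (dIg t)) (is_derive_cst (Ih T0 - Ig T0) t 1).
  by rewrite subr0 /= clamp_id.
have Qc (a b : R) : T0 <= a -> b <= TN -> {within `[a, b], continuous Q}.
  move=> Ta bT; apply: derivable_within_continuous => t; rewrite in_itv /= => /andP[at_ tb].
  by case: (dQ t _) => //; rewrite (le_trans Ta at_) (le_trans tb bT).
have ELx0 t : T0 <= t <= TN -> EL t x0 = L (gb t) by move=> tT; rewrite gcE // psi_x0 mulg1.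
have Qtau : Q tau0 = 0.
  have <- : Q T0 = 0 by exact: subrr.
  apply/esym; apply: derive0_cst tau1 => t /andP[t1 t2].
  have tT : T0 <= t <= TN by rewrite t1 (le_trans t2) // ltW.
  apply: is_derive_eq (dQ t tT) _.
  by rewrite /h perturbation_before // x2t psi_x0 mulg1 subrr.
(* Two small factors meet here: the interval has length [lam], and on it the running costs differ by
   at most [K * (C * lam) <= e]. *)
have Ql : `|Q (tau0 + lam)| <= e * lam.
  pose V (s : R) : R := 0 + s *: (e : R^o).
  have dK (t : R) : is_derive t 1 V e by exact: (@is_derive_line R R^o).
  have := @mean_value_ineq _ _ Q (fun t => L (h t) - L (gb t)) V (fun=> e) tau0 (tau0 + lam) l1.
  rewrite Qtau subr0 /V !add0r -scalerBl addrAC subrr add0r => mvi.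
  rewrite mulrC; apply: mvi.
  - by apply: Qc => //; exact: ltW.
  - by apply: continuous_subspaceT => t; exact: is_derive_continuous (dK t).
  - by move=> t /andP[t1 t2]; apply: dQ; rewrite (le_trans tau1 (ltW t1)) (ltW (lt_trans t2 lT)).
  move=> t /andP[t1 t2].
  have tt : tau0 <= t <= tau0 + lam by rewrite !ltW.
  have tT : T0 <= t <= TN by rewrite (le_trans tau1 (ltW t1)) (ltW (lt_trans t2 lT)).
  have := lipL t tT (x2 t) (x2C t tt); rewrite ELx0 // gcE // /h perturbation_during //.
  move=> /le_trans; apply; apply: le_trans KCe; apply: ler_wpM2l => //; exact: x2C.
pose c := (rho tau0 *m v) 0 0; pose u t := x1 t - x0.
have pair_est : `|((rho TN *m u TN) 0 0 + Q TN) -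
     ((rho (tau0 + lam) *m u (tau0 + lam)) 0 0 + Q (tau0 + lam))| <=
    (n%:R * B + 1) * (e * (C * lam)) * (TN - (tau0 + lam)).
  have sub t : tau0 + lam < t < TN -> T0 < t < TN.
    by move=> /andP[t1 ->]; rewrite (le_lt_trans l2 t1).
  have sub' t : tau0 + lam < t < TN -> T0 <= t <= TN.
    by move=> /sub/andP[t1 t2]; rewrite !ltW.
  have sub'' t : tau0 + lam < t < TN -> tau0 + lam <= t <= TN.
    by move=> /andP[t1 t2]; rewrite !ltW.
  apply: (@costate_pairing_estimate R n rho (fun t => lieD_row L (gb t))
    (fun t => lieD_mx (f1^~ t) (gb t) - ad_mx (f1 (gb t) t)) u
    (fun t => E1 t (x1 t)) Q (fun t => L (h t) - L (gb t)) (tau0 + lam) TN B (e * (C * lam))).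
  - exact: ltW.
  - exact: mulr_ge0.
  - apply: continuous_subspaceW rhoc => t; rewrite /= !in_itv /= => /andP[t1 ->].
    by rewrite (le_trans l2 t1).
  - apply: continuous_subspaceT => t; apply: cvgB; first exact: x1c.
    exact: cvg_cst.
  - exact: Qc.
  - by move=> t /sub; exact: drho.
  - move=> t tl; have := is_deriveB (dx1 t tl) (is_derive_cst x0 t 1).
    by rewrite subr0.
  - by move=> t /sub'; exact: dQ.
  - by move=> t /sub'; exact: rhoB.
  - move=> t tl; have tT := sub' t tl; have xC := x1C t (sub'' t tl).
    have := lin1 t tT (x1 t) xC.
    have e1 := error_field_diff gc (x1 t - x0) tT sF1 (fun p => Ff1 p tT).
    rewrite e1; rewrite error_field0 subrr subr0 gcE //.
    by move=> /le_trans; apply; apply: ler_wpM2l.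
  - move=> t tl; have tT := sub' t tl; have xC := x1C t (sub'' t tl).
    have := linL t tT (x1 t) xC; rewrite ELx0 //.
    rewrite -(lieD_rowE (x1 t - x0) (sL (gc t)).1) gcE // /h perturbation_after //.
      by move=> /le_trans; apply; apply: ler_wpM2l.
    by case/andP: tl => /ltW.
have phi_est : `|vphi (h TN) - vphi (gb TN) - (rho TN *m u TN) 0 0| <= e * (C * lam).
  have TT : tau0 + lam <= TN <= TN by rewrite lexx ltW.
  have := linphi (x1 TN) (x1C TN TT).
  rewrite -(lieD_rowE (x1 TN - x0) (sphi (gb TN)).1) -rhoT /h perturbation_after //; last exact: ltW.
  by move=> /le_trans; apply; apply: ler_wpM2l => //; exact: x1C.
have B0 : 0 <= B by apply: le_trans (rhoB T0 _); rewrite ?normr_ge0 ?lexx.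
have r1B : `|rho (tau0 + lam)| <= B by apply: rhoB; rewrite l2 ltW.
have w_est : `|(rho (tau0 + lam) *m (x2 (tau0 + lam) - x0 - lam *: v)) 0 0| <= n%:R * B * (e * lam).
  apply: le_trans (row_mul_col_norm _ _) _.
  apply: ler_pM => //.
  by apply: ler_wpM2l.
have r_est : `|((rho (tau0 + lam) - rho tau0) *m v) 0 0| <= n%:R * e * `|v|.
  apply: le_trans (row_mul_col_norm _ _) _.
  by apply: ler_wpM2r => //; apply: ler_wpM2l.
have pair_est' : (n%:R * B + 1) * (e * (C * lam)) * (TN - (tau0 + lam)) <=
    (n%:R * B + 1) * (e * (C * lam)) * (TN - T0).
  apply: ler_wpM2l; last by rewrite lerD2l lerN2.
  by apply: mulr_ge0; [apply: addr_ge0 => //; apply: mulr_ge0|apply: mulr_ge0].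
(* The errors are, in order: linearization of the terminal cost, drift of the costate pairing, cost
   during the second mode, displacement compared with [lam *: v], and variation of [rho] over the
   switching interval. *)
have dec : objective T0 TN L vphi h - objective T0 TN L vphi gb - lam * c =
    (vphi (h TN) - vphi (gb TN) - (rho TN *m u TN) 0 0) +
    (((rho TN *m u TN) 0 0 + Q TN) -
     ((rho (tau0 + lam) *m u (tau0 + lam)) 0 0 + Q (tau0 + lam))) + Q (tau0 + lam) +
    (rho (tau0 + lam) *m (x2 (tau0 + lam) - x0 - lam *: v)) 0 0 +
    lam * ((rho (tau0 + lam) - rho tau0) *m v) 0 0.
  have e1 (r : 'rV[R]_n) w : (r *m (w - lam *: v)) 0 0 = (r *m w) 0 0 - lam * (r *m v) 0 0.
    by rewrite mulmxBr -scalemxAr !mxE.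
  have e2 (r s : 'rV[R]_n) : ((r - s) *m v) 0 0 = (r *m v) 0 0 - (s *m v) 0 0.
    by rewrite mulmxBl !mxE.
  rewrite /objective hE gE e1 e2 /u x12 /c /Q.
  by ring.
rewrite -/c dec.
have r_est' : `|lam * ((rho (tau0 + lam) - rho tau0) *m v) 0 0| <= lam * (n%:R * e * `|v|).
  by rewrite normrM gtr0_norm // ler_wpM2l // ltW.
have final : (C + (n%:R * B + 1) * C * (TN - T0) + 1 + n%:R * B + n%:R * `|v|) * (e * lam) =
   e * (C * lam) + (n%:R * B + 1) * (e * (C * lam)) * (TN - T0) + e * lam +
   n%:R * B * (e * lam) + lam * (n%:R * e * `|v|) by ring.
rewrite final; apply: le_trans (ler_normD _ _) _; apply: lerD r_est'.
apply: le_trans (ler_normD _ _) _; apply: lerD w_est.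
apply: le_trans (ler_normD _ _) _; apply: lerD Ql.
apply: le_trans (ler_normD _ _) _; apply: lerD phi_est _.
exact: le_trans pair_est pair_est'.
Qed.
End ObjectiveEstimate.

(** * The limit of the difference quotient *)

Lemma near_at_right_shift (R : realType) (a : R) (P : R -> Prop) :
  (\forall s \near a^'+, P s) -> \forall l \near 0^'+, P (a + l).
Proof.
move=> [d /= d0 H]; exists d => //= l ld l0; apply: H; last by rewrite /= ltrDl.
by move: ld; rewrite /= sub0r normrN opprD addrA subrr sub0r normrN.
Qed.

Lemma within_norm_bound (R : realType) (V : normedModType R) (f : R -> V) (a b : R) :
  a <= b -> {within `[a, b], continuous f} ->
  exists B : R, forall t, a <= t <= b -> `|f t| <= B.
Proof.
move=> ab /subspace_continuousP fc.
have nc : {within `[a, b], continuous (fun t => `|f t|)}.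
  by apply/subspace_continuousP => t tab; apply: cvg_norm; exact: fc.
have [c _ fcB] := EVT_max ab nc.
by exists `|f c| => t tab; apply: fcB; rewrite in_itv.
Qed.

Theorem corollary1 (R : realType) (n : nat) (G : lieGroupType R n)
    (T0 TN tau0 : R) (T0_ge0 : 0 <= T0) (T0_lt_TN : T0 < TN)
    (tau0_in : T0 <= tau0 < TN)
    (f1 f2 : G -> R -> 'cV[R]_n) (f1_C1 : C1_time f1) (f2_C1 : C1_time f2)
    (L phi : G -> R) (L_C1 : C1 (L : G -> R^o)) (phi_C1 : C1 (phi : G -> R^o))
    (g0 : G)
    (* g lam is the trajectory for the duration lam, whenever there is one *)
    (g : R -> R -> G)
    (g_zero : is_trajectory T0 TN tau0 f1 f2 g0 0 (g 0))
    (g_pos : forall lam : R, 0 < lam ->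
       (exists h : R -> G, is_trajectory T0 TN tau0 f1 f2 g0 lam h) ->
       is_trajectory T0 TN tau0 f1 f2 g0 lam (g lam))
    (rho : R -> 'rV[R]_n)
    (rho_costate : is_costate T0 TN f1 L phi (g 0) rho) :
  (\forall lam \near 0^'+, is_trajectory T0 TN tau0 f1 f2 g0 lam (g lam)) /\
  (fun lam : R => (objective T0 TN L phi (g lam)
                   - objective T0 TN L phi (g 0)) / lam) @ 0^'+ -->
    (rho tau0 *m (f2 (g 0 tau0) tau0 - f1 (g 0 tau0) tau0)) 0 0.
Proof.
have [gbc g0E _] := g_zero; move: g_zero; rewrite -g0E => gb_traj.
have [F1 F1E sF1] := C1_time_left_sdiff f1_C1.
have [F2 F2E sF2] := C1_time_left_sdiff f2_C1.
have T0p t : T0 <= t <= TN -> 0 <= t by case/andP=> t1 _; exact: le_trans t1.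
have Ff1 p t : T0 <= t <= TN -> F1 (p, t) = f1 p t by move=> /T0p; exact: F1E.
have Ff2 p t : T0 <= t <= TN -> F2 (p, t) = f2 p t by move=> /T0p; exact: F2E.
have sF1' : left_sdiff T0 TN F1 by move=> p t /T0p; exact: sF1.
have sF2' : left_sdiff T0 TN F2 by move=> p t /T0p; exact: sF2.
have sL p : sdiff (fun x => L (p * chart_inv (id_chart G) x)%g : R) (chart_map (id_chart G) 1%g).
  exact: (C1_left_sdiff p L_C1).
have sphi p : sdiff (fun x => phi (p * chart_inv (id_chart G) x)%g : R) (chart_map (id_chart G) 1%g).
  exact: (C1_left_sdiff p phi_C1).
have T0TN := ltW T0_lt_TN; have [tau1 tau2] := andP tau0_in.
pose v := f2 (g 0 tau0) tau0 - f1 (g 0 tau0) tau0.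
have [x2 [x1 [C [C0 x2t dx2 SP]]]] := small_perturbations T0_lt_TN tau0_in sF1' sF2' Ff1 Ff2 gb_traj.
have gcc : continuous (fun t => g 0 (clamp T0 TN t)) by exact: within_clamp_continuous.
have usL t : T0 <= t <= TN -> unif_sdiff (fun s x => L (g 0 (clamp T0 TN s) * chart_inv (id_chart G) x)%g)
    (chart_map (id_chart G) 1%g) t.
  by move=> _; exact: (shift_unif_sdiff gcc t sL).
have usE t : T0 <= t <= TN -> unif_sdiff (error_field (fun t => g 0 (clamp T0 TN t)) T0 TN F1 F1)
    (chart_map (id_chart G) 1%g) t.
  by move=> _; exact: (error_field_unif_sdiff gcc T0TN t sF1' sF1').
have [dL dL0 lipL] := unif_sdiff_lipschitz usL.
have [rhoc _ _] := rho_costate.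
have [B rhoB] := within_norm_bound T0TN rhoc.
(* The constructed trajectory witnesses existence, which is the condition under which [g lam] is
   known to be a trajectory. *)
have traj_near : \forall lam \near 0^'+, is_trajectory T0 TN tau0 f1 f2 (g 0 T0) lam (g lam).
  apply: filterS2 (nbhs_right_gt (0 : R)) SP => lam l0 [_ _ _ _ tr].
  by rewrite g0E; apply: g_pos => //; rewrite -g0E; eexists; exact: tr.
split => //.
pose D := C + (n%:R * B + 1) * C * (TN - T0) + 1 + n%:R * B + n%:R * `|v|.
have B0 : 0 <= B by apply: le_trans (rhoB T0 _); rewrite ?normr_ge0 ?lexx.
have D0 : 0 < D.
  have h1 : 0 <= n%:R * B + n%:R * `|v| by rewrite addr_ge0 // mulr_ge0.
  have h2 : 0 <= (n%:R * B + 1) * C * (TN - T0).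
    apply: mulr_ge0; last by rewrite subr_ge0.
    by apply: mulr_ge0; [rewrite addr_ge0 // mulr_ge0|exact: ltW].
  rewrite /D -addrA; apply: ltr_wpDr => //; apply: ltr_wpDl => //.
  by apply: addr_ge0 => //; exact: ltW.
apply/cvgrPdist_le => eps eps0.
(* [D] is the coefficient in [objective_estimate], so the total error becomes [eps * lam]. *)
pose e := eps / D; have e0 : 0 < e by rewrite divr_gt0.
have [d1 d10 lin1] := unif_sdiff_linearization usE e0.
have [d2 d20 linL] := unif_sdiff_linearization usL e0.
have /near_normP[d3 d30 linphi] := differentiable_near (sphi (g 0 TN)).1 e0.
have rho_near : \forall lam \near 0^'+, `|rho tau0 - rho (tau0 + lam)| <= e.
  apply: near_at_right_shift (_ : \forall s \near tau0^'+, `|rho tau0 - rho s| <= e).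
  have /cvgrPdist_le := within_cvg_right rhoc tau0_in; exact.
have x2_near := near_at_right_shift (near_at_right (is_derive_near dx2 e0)).
have small (d : R) : 0 < d -> \forall lam \near 0^'+, C * lam < d.
  move=> d0; have : \forall lam \near 0^'+, lam < d / C.
    by apply: nbhs_right_lt; rewrite divr_gt0.
  by apply: filterS => lam; rewrite ltr_pdivlMr // mulrC.
have sizes : \forall lam \near 0^'+, [/\ C * lam < d1, C * lam < d2, C * lam < d3, C * lam < dL &
    dL^-1 * (C * lam) <= e].
  near=> lam; split; [near: lam; exact: small..|].
  rewrite ler_pdivrMl // ltW //; near: lam; apply: small; exact: mulr_gt0.
have near2 : \forall lam \near 0^'+, is_trajectory T0 TN tau0 f1 f2 (g 0 T0) lam (g lam) /\
   (`|rho tau0 - rho (tau0 + lam)| <= e /\ 0 < lam /\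
    `|x2 (tau0 + lam) - x2 tau0 - (tau0 + lam - tau0) *: v| <= e * `|tau0 + lam - tau0|).
  apply: filterI => //; apply: filterI => //; apply: filterI => //; exact: nbhs_right_gt.
apply: filterS3 SP near2 sizes => lam [[lT x12] [x1c dx1] x2C x1C tr] [tr' [rhol [l0 x2l]]] [l1 l2 l3 l4 l5].
have objE : objective T0 TN L phi (g lam) = objective T0 TN L phi
    (fun t => g 0 t * chart_inv (id_chart G) (perturbation tau0 lam x2 (x1 lam) t))%g.
  apply: eq_objective => //; exact: (is_trajectory_unique tau0_in sF1' sF2' Ff1 Ff2 l0 lT tr' tr).
have [trc _ _] := tr.
have est : `|objective T0 TN L phi (g lam) - objective T0 TN L phi (g 0) - lam * (rho tau0 *m v) 0 0|
    <= D * (e * lam).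
  rewrite objE; apply: (@objective_estimate R n G T0 TN tau0 f1 F1 (g 0) L phi rho T0_lt_TN
    tau0_in sF1' Ff1 gbc sL sphi rho_costate (x1 lam) x2 v lam B C e dL^-1).
  - exact: l0.
  - exact: lT.
  - exact: ltW.
  - exact: ltW.
  - by rewrite invr_ge0 ltW.
  - exact: l5.
  - exact: x2t.
  - exact: x12.
  - exact: x1c.
  - exact: x2C.
  - exact: x1C.
  - exact: trc.
  - move=> t tT x xC; apply: (lipL t tT).1; first exact: le_lt_trans xC l4.
    by rewrite subrr normr0.
  - by move=> t tT x xC; apply: lin1 => //; exact: le_lt_trans xC l1.
  - by move=> t tT x xC; apply: linL => //; exact: le_lt_trans xC l2.
  - move=> x xC; have := linphi x (le_lt_trans xC l3); by rewrite psi_x0 mulg1.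
  - exact: rhoB.
  - by rewrite distrC.
  - have lE : tau0 + lam - tau0 = lam by rewrite addrAC subrr add0r.
    by move: x2l; rewrite x2t lE (gtr0_norm l0).
have quot (d c : R) : `|d - lam * c| <= eps * lam -> `|c - d / lam| <= eps.
  have lam_neq0 : lam != 0 by rewrite gt_eqF.
  have -> : c - d / lam = - (d - lam * c) / lam by field.
  by rewrite normrM normrN normfV (gtr0_norm l0) ler_pdivrMr.
apply: quot; apply: le_trans est _.
by rewrite le_eqVlt; apply/orP; left; apply/eqP; rewrite /e; field; rewrite gt_eqF.
Unshelve. all: by end_near. Qed.
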